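(* Let $1\le p<\infty$ and let $v$ be a positive weight on $\mathbb T^n\times\mathbb R^m$. For $0<R<\frac12$ define the local maximal operator $W_R^*f(x,y)=\sup_{0<t<R}|\phi_t^{WG}*f(x,y)|$. Then the following statements are equivalent: (1) $v\in D_p^{WG}$ (the weight class defined in the context). (2) There exist $0<R<\frac12$ and a weight $u$ on $\mathbb T^n\times\mathbb R^m$ such that the operator $f\mapsto W_R^*f$ maps $L^p_v(\mathbb T^n\times\mathbb R^m)$ into $L^p_u(\mathbb T^n\times\mathbb R^m)$ if $p>1$, and maps $L^1_v(\mathbb T^n\times\mathbb R^m)$ into weak $L^1_u(\mathbb T^n\times\mathbb R^m)$ if $p=1$. (3) There exists $0<R<\frac12$ such that, for all $f\in L^p_v(\mathbb T^n\times\mathbb R^m)$, $\phi_R^{WG}*f$ is finite almost everywhere and the limit $\lim_{t\to0^+}\phi_t^{WG}*f(x,y)=f(x,y)$ exists for almost every $(x,y)$. (4) There exists $0<R<\frac12$ such that $W_R^*f(x,y)$ is finite for almost every $(x,y)$, for all $f\in L^p_v(\mathbb T^n\times\mathbb R^m)$.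
   Context: $\mathbb T^n=\mathbb R^n/\mathbb Z^n$ is identified with $Q_n=[-\frac12,\frac12)^n$ and $\mathbb T^n\times\mathbb R^m$ with $Q_n\times\mathbb R^m$ with Lebesgue measure. A weight is a measurable function with values in $(0,\infty)$. For $t>0$, $$\phi_t^{WG}(x,y)=(4\pi t)^{-\frac{n+m}2}\sum_{k\in\mathbb Z^n}e^{-\frac{|x+k|^2+|y|^2}{4t}},$$ and $*$ denotes convolution on $\mathbb T^n\times\mathbb R^m$. For a weight $w$, $L^p_w(\mathbb T^n\times\mathbb R^m)$ is the space of measurable complex-valued $f$ with $\|f\|_{L^p_w}=\|fw^{1/p}\|_{L^p(\mathbb T^n\times\mathbb R^m)}<\infty$. Let $\frac1p+\frac1{p'}=1$. The class $D_p^{WG}$ consists of the weights $v$ for which there exists $t_0>0$ such that $$\int_{\mathbb T^n\times\mathbb R^m}\left|v^{-\frac1p}(x,y)e^{-\frac{|y|^2}{4t_0}}\right|^{p'}dx\,dy<\infty,$$ where for $p=1$ ($p'=\infty$) this is read as $v^{-1}(x,y)e^{-|y|^2/(4t_0)}\in L^\infty(\mathbb T^n\times\mathbb R^m)$. Conventions: ''finite'' for a convolution (or for the supremum of convolutions) includes that the convolution integrals involved converge absolutely. ''$S$ maps $L^p_v$ into $L^p_u$'' means $Sf$ is defined a.e. and $\|Sf\|_{L^p_u}\le C\|f\|_{L^p_v}$ for all $f$, with $C$ independent of $f$; ''$S$ maps $L^1_v$ into weak $L^1_u$'' means $Sf$ is defined a.e. and $\int_{\{|Sf|>\lambda\}}u\,dx\,dy\le\frac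 C\lambda\|f\|_{L^1_v}$ for all $\lambda>0$ and all $f$. *)

(* Defs.v *)
From HB Require Import structures.
From mathcomp Require Import all_boot all_order all_algebra.
From mathcomp Require Import all_classical all_reals all_analysis measurable_realfun.
From mathcomp Require Import complex.

Set Implicit Arguments.
Unset Strict Implicit.
Unset Printing Implicit Defensive.

Import Order.TTheory GRing.Theory Num.Theory.
Import numFieldNormedType.Exports.

Local Open Scope classical_set_scope.
Local Open Scope ring_scope.

Lemma sigma_finite_product_measure1 d1 d2 (T1 : measurableType d1)
    (T2 : measurableType d2) (R : realType)
    (m1 : {sigma_finite_measure set T1 -> \bar R})
    (m2 : {sigma_finite_measure set T2 -> \bar R}) :
  sigma_finite setT (m1 \x m2)%E.
Proof.
have /sigma_finiteP[F [TF ndF Foo]] := sigma_finiteT m1.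
have /sigma_finiteP[G [TG ndG Goo]] := sigma_finiteT m2.
exists (fun n => F n `*` G n).
  rewrite -setXTT TF TG predeqE => -[x y]; split.
    move=> [/= [n _ Fnx] [k _ Gky]]; exists (maxn n k) => //; split.
    - by move: x Fnx; exact/subsetPset/ndF/leq_maxl.
    - by move: y Gky; exact/subsetPset/ndG/leq_maxr.
  by move=> [n _ []/= ? ?]; split; exists n.
move=> k; have [? ?] := Foo k; have [? ?] := Goo k.
split; first exact: measurableX.
by rewrite product_measure1E// lte_mul_pinfty// ge0_fin_numE.
Qed.

(* Lebesgue measure on R^n, by recursion on n: R^0 is a point of mass 1, and   *)
(* the measure on R^(n+1) is the image of the product measure on R * R^n under *)
(* (x, y) |-> x :: y.                                                          *)
Section lebesgue_tuple_measure.
Context (R : realType).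
Local Open Scope ereal_scope.

Section cons_measure.
Context (n : nat).
Variable nu : {sigma_finite_measure set (n.-tuple (measurableTypeR R)) -> \bar R}.

Definition tcons (z : measurableTypeR R * n.-tuple (measurableTypeR R)) :
    n.+1.-tuple (measurableTypeR R) :=
  [tuple of z.1 :: z.2].

Definition tuncons (x : n.+1.-tuple (measurableTypeR R)) :
    measurableTypeR R * n.-tuple (measurableTypeR R) :=
  (thead x, [tuple of behead x]).

Lemma tconsK : cancel tcons tuncons.
Proof. by case=> a b; congr (_, _); exact/val_inj. Qed.

Lemma measurable_tcons : measurable_fun setT tcons.
Proof. by apply: measurable_cons. Qed.

Lemma measurable_tuncons : measurable_fun setT tuncons.
Proof.
apply: measurable_fun_pair; first exact: measurable_tnth.
exact: measurable_behead.
Qed.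

Definition cons_measure : set (n.+1.-tuple (measurableTypeR R)) -> \bar R :=
  pushforward (lebesgue_measure \x nu) tcons.

Let cons_measure0 : cons_measure set0 = 0.
Proof. by rewrite /cons_measure /pushforward preimage_set0 measure0. Qed.

Let cons_measure_ge0 A : 0 <= cons_measure A.
Proof. by rewrite /cons_measure /pushforward; apply: measure_ge0. Qed.

Let cons_measure_sigma_additive : semi_sigma_additive cons_measure.
Proof.
have mpre A : measurable A -> measurable (tcons @^-1` A).
  by move=> mA; rewrite -[X in measurable X]setTI; exact: measurable_tcons.
move=> F mF tF mUF; rewrite /cons_measure /pushforward preimage_bigcup.
apply: measure_semi_sigma_additive.
- by move=> k; exact: mpre.
- apply/trivIsetP => /= i j _ _ ij; rewrite -preimage_setI.
  by move/trivIsetP : tF => /(_ _ _ _ _ ij) ->//; rewrite preimage_set0.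
- by rewrite -preimage_bigcup; exact: mpre.
Qed.

HB.instance Definition _ := isMeasure.Build _ _ _ cons_measure
  cons_measure0 cons_measure_ge0 cons_measure_sigma_additive.

Let cons_measure_sigma_finite : sigma_finite setT cons_measure.
Proof.
have [F FT mF] := sigma_finite_product_measure1 (@lebesgue_measure R) nu.
exists (fun k => tuncons @^-1` F k).
  by rewrite -preimage_bigcup -FT preimage_setT.
move=> k; have [mFk Fk] := mF k; split.
  by rewrite -[X in measurable X]setTI; exact: measurable_tuncons.
rewrite /cons_measure /pushforward -comp_preimage.
by rewrite (_ : tuncons \o tcons = id)//; apply/funext => z /=; rewrite tconsK.
Qed.

HB.instance Definition _ := Measure_isSigmaFinite.Build _ _ _ cons_measure
  cons_measure_sigma_finite.

End cons_measure.

Fixpoint lebesgue_tuple (n : nat) :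
    {sigma_finite_measure set (n.-tuple (measurableTypeR R)) -> \bar R} :=
  match n with
  | 0%N => \d_([tuple] : 0.-tuple (measurableTypeR R))
  | k.+1 => cons_measure (lebesgue_tuple k)
  end.

End lebesgue_tuple_measure.

Section torus_measure.
Context (R : realType) (n : nat).

Definition unit_cell : set (n.-tuple (measurableTypeR R)) :=
  [set x | forall i, - 2^-1 <= (tnth x i : R) < 2^-1].

Lemma measurable_unit_cell : measurable unit_cell.
Proof.
rewrite (_ : unit_cell = \big[setI/setT]_(i < n)
    ((fun x : n.-tuple (measurableTypeR R) => tnth x i) @^-1`
      [set` `[- 2^-1 : R, 2^-1[])).
  apply: bigsetI_measurable => i _; rewrite -[X in measurable X]setTI.
  by apply: measurable_tnth => //; exact: measurable_itv.
rewrite -bigcap_seq; apply/seteqP; split => x /= xP i.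
  by move=> _; rewrite /= in_itv /=; exact: xP.
by have /= := xP i (mem_index_enum i); rewrite in_itv.
Qed.

(* Lebesgue measure on Q_n = [-1/2, 1/2)^n, the fundamental domain with which *)
(* T^n is identified; it is kept as a measure on R^n that vanishes off Q_n.   *)
Definition torus_measure : set (n.-tuple (measurableTypeR R)) -> \bar R :=
  mrestr (lebesgue_tuple R n) measurable_unit_cell.

HB.instance Definition _ := Measure.on torus_measure.

Let torus_measure_sigma_finite : sigma_finite setT torus_measure.
Proof.
have [F FT mF] := sigma_finiteT (lebesgue_tuple R n).
exists F => // k; have [mFk Fk] := mF k; split => //.
apply: le_lt_trans Fk; rewrite /torus_measure /mrestr.
apply: le_measure; rewrite ?inE//.
by apply: measurableI => //; exact: measurable_unit_cell.
Qed.

HB.instance Definition _ := Measure_isSigmaFinite.Build _ _ _ torus_measure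
  torus_measure_sigma_finite.

End torus_measure.
Arguments torus_measure : clear implicits.

(* Points of T^n * R^m: functions on the waveguide are represented by total   *)
(* functions on R^n * R^m, of which only the values on Q_n * R^m matter.      *)
Notation waveguide R n m :=
  (n.-tuple (measurableTypeR R) * m.-tuple (measurableTypeR R))%type.

Definition WG_measure (R : realType) (n m : nat) :
    {measure set (waveguide R n m) -> \bar R} :=
  (torus_measure R n \x lebesgue_tuple R m)%E.

Section waveguide_definitions.
Context (R : realType) (n m : nat).
Local Notation WG := (waveguide R n m).
Local Notation mu := (WG_measure R n m).
Implicit Types (z : WG) (f : WG -> R[i]).

(* Measurability is with respect to the completion of the Borel sigma-algebra. *)
(* The library's integral of a nonnegative function is the supremum of those  *)
(* of the Borel simple functions below it, so it is the Lebesgue integral for  *)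
(* these functions as well.                                                   *)
Definition lebesgue_measurable_fun (g : WG -> R) :=
  forall Y : set R, measurable Y -> completed_algebra_gen mu (g @^-1` Y).

Definition complex_measurable_fun f :=
  lebesgue_measurable_fun (fun z => complex.Re (f z)) /\
  lebesgue_measurable_fun (fun z => complex.Im (f z)).

Definition weight (w : WG -> R) :=
  lebesgue_measurable_fun w /\ forall z, unit_cell z.1 -> 0 < w z.

(* The norm of L^p_w is defined on extended real functions, since it is also  *)
(* applied to the maximal function.                                           *)
Definition wLnorm (p : R) (w : WG -> R) (g : WG -> \bar R) : \bar R :=
  Lnorm mu p%:E (fun z => g z * (w z `^ p^-1)%:E)%E.

Definition cabs f : WG -> \bar R := fun z => (Normc.normc (f z))%:E.

Definition wLp (p : R) (w : WG -> R) : set (WG -> R[i]) :=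
  [set f | complex_measurable_fun f /\ (wLnorm p w (cabs f) < +oo)%E].

Definition sqnorm k (x : k.-tuple R) : R := \sum_(i < k) tnth x i ^+ 2.

Definition tshift k (x : k.-tuple R) (a : k.-tuple int) : k.-tuple R :=
  [tuple tnth x i + (tnth a i)%:~R | i < k].

Definition tsub k (x y : k.-tuple R) : k.-tuple R :=
  [tuple tnth x i - tnth y i | i < k].

Definition heat_kernel (t : R) (z : WG) : R :=
  (4 * pi * t) `^ (- ((n + m)%N%:R / 2)) *
  fine (\esum_(k in [set: n.-tuple int])
    (expR (- ((sqnorm (tshift z.1 k) + sqnorm z.2) / (4 * t))))%:E).

(* The first argument is a difference in R^n * R^m, not reduced to Q_n * R^m: *)
(* the kernel is Z^n-periodic in its first variable.                          *)
Definition heat_kernel_sub (t : R) (z w : WG) : R :=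
  heat_kernel t (tsub z.1 w.1, tsub z.2 w.2).

Definition heat_conv_finite (t : R) f z : Prop :=
  (\int[mu]_w (heat_kernel_sub t z w * Normc.normc (f w))%:E < +oo)%E.

Definition heat_conv (t : R) f z : R[i] :=
  Complex (\int[mu]_w (heat_kernel_sub t z w * complex.Re (f w)))
          (\int[mu]_w (heat_kernel_sub t z w * complex.Im (f w))).

Definition heat_maximal (r : R) f z : \bar R :=
  ereal_sup [set (Normc.normc (heat_conv t f z))%:E | t in [set t | 0 < t < r]].

Definition heat_maximal_defined (r : R) f z : Prop :=
  forall t, 0 < t < r -> heat_conv_finite t f z.

Definition heat_conv_converges f z : Prop :=
  (\forall t \near 0^'+, heat_conv_finite t f z) /\
  Normc.normc (heat_conv t f z - f z) @[t --> 0^'+] --> (0 : R).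

(* At p = 1 the conjugate exponent is +oo and Lnorm is an essential supremum. *)
Definition D_WG (p : R) : set (WG -> R) :=
  [set v | weight v /\ exists2 t0 : R, 0 < t0 &
    (Lnorm mu (hoelder_conjugate p%:E)
      (fun z => (v z `^ (- p^-1) * expR (- (sqnorm z.2 / (4 * t0))))%:E)
      < +oo)%E].

(* dom f z expresses that the value of S f at z is defined. *)
Definition maps_strong (p : R) (v u : WG -> R)
    (S : (WG -> R[i]) -> WG -> \bar R) (dom : (WG -> R[i]) -> WG -> Prop) :=
  (forall f, wLp p v f -> {ae mu, forall z, dom f z}) /\
  exists C : R, forall f, wLp p v f ->
    (wLnorm p u (S f) <= C%:E * wLnorm p v (cabs f))%E.

Definition maps_weak1 (v u : WG -> R)
    (S : (WG -> R[i]) -> WG -> \bar R) (dom : (WG -> R[i]) -> WG -> Prop) :=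
  (forall f, wLp 1 v f -> {ae mu, forall z, dom f z}) /\
  exists C : R, forall f, wLp 1 v f -> forall lam : R, 0 < lam ->
    (\int[mu]_(z in [set z | lam%:E < `|S f z|]) (u z)%:E
      <= (C / lam)%:E * wLnorm 1 v (cabs f))%E.

End waveguide_definitions.

(* Main.v *)
(* For z in the open cell and small t, the term of index 0 of the heat kernel  *)
(* is dominated by a superposition of normalized boxes around z, and the other *)
(* terms are O(t), both with a spare factor g(y) = exp (- |y|^2 / (4 t0)).     *)
(* Hence phi_t * |f| (z) <= C(z) N(|f| g)(z), where N adds to the integral the *)
(* maximal functions over the dyadic grids shifted by 0 or 1/3 in each         *)
(* coordinate (a box of radius 2^-k / 3 lies in a cell of one of them); each   *)
(* is of weak type (1,1) by a stopping argument.                               *)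
(* If v is in D_p, Hoelder's inequality makes |f| g integrable for f in L^p_v. *)
(* This gives (4), and (3) since a.e. convergence passes from indicators of    *)
(* boxes to limits in L^1(g). For p = 1, (2) is the weak type of N. For p > 1, *)
(* write |f| g = h sigma with sigma = (v^(-1/p) g)^p', so that the norm of h   *)
(* in L^p(sigma) is that of f in L^p_v; as h |-> N(h sigma) / (1 + N sigma) is *)
(* bounded on L^oo and of weak type (1,1) from sigma to g, Marcinkiewicz       *)
(* interpolation gives (2).                                                    *)
(* Conversely, each of (2), (3), (4) makes phi_t * |f| (z) finite for some t   *)
(* and z, so that |f| exp (- |y|^2 / (2 t)) is integrable for every f in       *)
(* L^p_v, and (1) follows from the converse of Hoelder's inequality.           *)

Require Import Defs.
From HB Require Import structures.
From mathcomp Require Import all_boot all_order all_algebra.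
From mathcomp Require Import all_classical all_reals all_analysis measurable_realfun.
From mathcomp Require Import ess_sup_inf complex.
From mathcomp Require Import ring lra.

Set Implicit Arguments.
Unset Strict Implicit.
Unset Printing Implicit Defensive.

Import Order.TTheory GRing.Theory Num.Theory.
Import numFieldNormedType.Exports HBSimple HBNNSimple.

Local Open Scope classical_set_scope.
Local Open Scope ring_scope.

Section null_sets.
Context d (T : measurableType d) (R : realType).
Variable mu : {measure set T -> \bar R}.
Local Open Scope ereal_scope.

(* No measurability is needed: the library's integral of a nonnegative         *)
(* function is a supremum over measurable simple functions.                    *)
Lemma le_integral_off_null (N : set T) (f g : T -> \bar R) :
  measurable N -> mu N = 0 -> (forall x, 0 <= f x) -> (forall x, 0 <= g x) ->
  (forall x, ~ N x -> f x <= g x) -> \int[mu]_x f x <= \int[mu]_x g x.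
Proof.
move=> mN N0 f0 g0 fg; rewrite !ge0_integralTE//.
apply/ge_ereal_sup => /= _ [h /= hf <-].
pose h' : {nnsfun T >-> R} := proj_nnsfun h (measurableC mN).
have -> : sintegral mu h = sintegral mu h'.
  rewrite -!integralT_nnsfun; apply: ge0_ae_eq_integral => //.
  - exact/measurable_EFinP.
  - exact/measurable_EFinP.
  - by move=> x _; rewrite lee_fin.
  - by move=> x _; rewrite lee_fin.
  - exists N; split => // x /= /not_implyP[_]; apply: contra_notP => xN.
    by rewrite /h' /= /mindic /= indicE mem_set ?mulr1.
apply: ereal_sup_ubound; exists h' => // x.
rewrite /h' /= /mindic /= indicE; have [xN|xN] := boolP (x \in ~` N).
  by rewrite mulr1 (le_trans (hf x))// fg//; move: xN; rewrite inE.
by rewrite mulr0.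
Qed.

Lemma le_integral_nomeas (f g : T -> \bar R) :
  (forall x, 0 <= f x) -> (forall x, f x <= g x) ->
  \int[mu]_x f x <= \int[mu]_x g x.
Proof.
move=> f0 fg; apply: (@le_integral_off_null set0) => // x.
exact: le_trans (fg x).
Qed.

Lemma ge0_eq_integral_off_null (N : set T) (f g : T -> \bar R) :
  measurable N -> mu N = 0 -> (forall x, 0 <= f x) -> (forall x, 0 <= g x) ->
  (forall x, ~ N x -> f x = g x) -> \int[mu]_x f x = \int[mu]_x g x.
Proof.
move=> mN N0 f0 g0 fg; apply/eqP; rewrite eq_le; apply/andP; split;
  by apply: (le_integral_off_null mN) => // x Nx; rewrite fg.
Qed.

Lemma eq_integral_off_null (N : set T) (f g : T -> \bar R) :
  measurable N -> mu N = 0 -> (forall x, ~ N x -> f x = g x) ->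
  \int[mu]_x f x = \int[mu]_x g x.
Proof.
move=> mN N0 fg; rewrite integralE [RHS]integralE; congr (_ - _).
  by apply: (ge0_eq_integral_off_null mN) => // x Nx; rewrite !funeposE fg.
by apply: (ge0_eq_integral_off_null mN) => // x Nx; rewrite !funenegE fg.
Qed.

Lemma measure_setU_null (A B : set T) : measurable A -> measurable B ->
  mu A = 0 -> mu B = 0 -> mu (A `|` B) = 0.
Proof.
move=> mA mB A0 B0; apply/negligibleP; first exact: measurableU.
by apply: negligibleU; exact/negligibleP.
Qed.

Lemma measure_bigsetU_null (I : finType) (A : I -> set T) : (forall i, measurable (A i)) ->
  (forall i, mu (A i) = 0) -> mu (\big[setU/set0]_(i : I) A i) = 0.
Proof.
move=> mA A0; apply/negligibleP; first exact: bigsetU_measurable.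
elim/big_ind : _ => [|B C|i _]; [exact: negligible_set0|exact: negligibleU|].
by apply/negligibleP; [exact: mA|exact: A0].
Qed.

Lemma completed_measurable_borel (g : T -> R) :
  (forall Y : set R, measurable Y -> completed_algebra_gen mu (g @^-1` Y)) ->
  exists g' N, [/\ measurable_fun setT (g' : T -> R), measurable N, mu N = 0 &
    forall x, ~ N x -> g x = g' x].
Proof.
move=> mg.
have key (q : rat) : exists AN : set T * set T, [/\ measurable AN.1, measurable AN.2, mu AN.2 = 0
    & g @^-1` `]-oo, ratr q[%classic `\` AN.2 = AN.1 `\` AN.2].
  have [A mA [B [N [mN N0 BN]]] AB] := mg `]-oo, (ratr q : R)[%classic (measurable_itv _).
  exists (A, N); split => //=; rewrite -AB; apply/seteqP; split => x.
    by move=> [[|/BN]].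
  by move=> [Ax Nx]; split => //; left.
have {key}[F /all_and4[mA mN N0 HF]] := choice key.
pose N := \bigcup_(q in @setT rat) (F q).2.
have mNN : measurable N by apply: countable_bigcupT_measurable => [|q]; [exact: countableP|exact: mN].
have NN0 : mu N = 0.
  apply/negligibleP => //.
  have -> : N = \bigcup_k (if unpickle k is Some q then (F q).2 else set0).
    apply/seteqP; split => x [q _ qx].
      by exists (pickle q); [exact: Logic.I|rewrite pickleK].
    by move: qx; case: (unpickle q) => // r rx; exists r.
  apply: negligible_bigcup => k; case: unpickle => [r|]; last exact: negligible_set0.
  by apply/negligibleP; [exact: mN|exact: N0].
exists (fun x => if x \in N then 0%R else g x), N; split => //; last first.
  by move=> x Nx; rewrite memNset.
have mg'q (q : rat) : measurable ((fun x => if x \in N then 0%R else g x) @^-1`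
    `]-oo, ratr q[%classic).
  have -> : (fun x => if x \in N then 0%R else g x) @^-1` `]-oo, ratr q[%classic =
     ((F q).1 `\` N) `|` (if (0 < ratr q :> R)%R then N else set0).
    apply/seteqP; split => x /=; rewrite in_itv/=.
      case: ifPn => [|/negP]; rewrite inE => Nx.
        by move=> ->; right.
      move=> gx; left; split => //.
      have : ((F q).1 `\` (F q).2) x.
        rewrite -HF; split; first by rewrite /= in_itv.
        by move=> Fx; apply: Nx; exists q.
      by case.
    move=> [[Fx Nx]|].
      rewrite memNset//.
      have : (g @^-1` `]-oo, ratr q[%classic `\` (F q).2) x.
        by rewrite HF; split => // F2; apply: Nx; exists q.
      by move=> [/=]; rewrite in_itv.
    by case: ifPn => // q0 Nx; rewrite mem_set.
  apply: measurableU; first exact: measurableD.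
  by case: ifP.
apply: (measurability _ (RGenInftyO.measurableE R)) => /= _ [_ [a ->] <-].
rewrite setTI.
rewrite (_ : _ @^-1` _ = \bigcup_(q in [set q | (ratr q < a :> R)%R])
   ((fun x => if x \in N then 0%R else g x) @^-1` `]-oo, ratr q[%classic)).
  rewrite bigcup_mkcond; apply: countable_bigcupT_measurable => [|q]; first exact: countableP.
  by case: ifP => _; [exact: mg'q|exact: measurable0].
apply/seteqP; split => x /=.
  rewrite in_itv/= => /rat_in_itvoo[q]; rewrite in_itv/= => /andP[xq qa].
  by exists q => //=; rewrite in_itv.
by move=> [q /= qa]; rewrite !in_itv/= => /lt_trans; apply.
Qed.
End null_sets.

Section powers_of_two.
Context (R : realType).

Lemma exists_exp2_ge (x : R) : exists k : nat, x <= 2 ^+ k.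
Proof.
exists (Num.bound `|x|); apply: (le_trans (ler_norm _)).
apply/ltW/(lt_le_trans (archi_boundP (normr_ge0 x))).
by rewrite -natrX ler_nat ltnW// ltn_expl.
Qed.

Lemma sum_half_le2 (k : nat) : \sum_(i < k) 2^-1 ^+ i <= 2 :> R.
Proof.
have := subrX1 (2^-1 : R) k; set Y := \sum_(_ < _) _.
have : 0 <= 2^-1 ^+ k :> R by rewrite exprn_ge0.
by set V := _ ^+ k; lra.
Qed.

Lemma nneseries_half_le2 : (\sum_(i <oo) ((2^-1 : R) ^+ i)%:E <= 2%:E)%E.
Proof.
apply: lime_le; first by apply: is_cvg_nneseries => i _ _; rewrite lee_fin.
by apply: nearW => k; rewrite sumEFin lee_fin big_mkord; exact: sum_half_le2.
Qed.

End powers_of_two.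


(** * Dyadic maximal functions *)

Section dyadic_maximal.
Context d (T : measurableType d) (R : realType) (I : countType).
Variable mu : {measure set T -> \bar R}.
Local Open Scope ereal_scope.

Lemma measure_le_integral_bigcup (lam : R) (F : T -> \bar R) (G : (set T)^nat) :
  (0 <= lam)%R -> measurable_fun setT F -> (forall z, 0 <= F z) ->
  (forall j, measurable (G j)) -> trivIset setT G ->
  (forall j, lam%:E * mu (G j) <= \int[mu]_(z in G j) F z) ->
  lam%:E * mu (\bigcup_j G j) <= \int[mu]_(z in \bigcup_j G j) F z.
Proof.
move=> lam0 mF F0 mG tG lamG; rewrite ge0_integral_bigcup//; last first.
  exact: measurable_funTS.
rewrite measure_bigcup// -nneseriesZl//.
rewrite (@eq_eseriesl _ _ xpredT); last by move=> i; rewrite in_setT.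
by apply: lee_nneseries => [j _ _|j _]; [rewrite mule_ge0|exact: lamG].
Qed.

Variables (c : nat -> T -> I) (a : nat -> R).
Hypothesis a0 : forall k, (0 < a k)%R.
Hypothesis mc : forall k i, measurable [set z | c k z = i].
Hypothesis nested : forall k z w, c k.+1 z = c k.+1 w -> c k z = c k w.
Hypothesis mua : forall k i, mu [set z | c k z = i] <= (a k)%:E.

Definition cell_average k (F : T -> \bar R) z : \bar R :=
  (a k)^-1%:E * \int[mu]_(w in [set w | c k w = c k z]) F w.

Definition cell_maximal (F : T -> \bar R) z : \bar R :=
  ereal_sup [set cell_average k F z | k in setT].

Lemma nested_le j k z w : (j <= k)%N -> c k z = c k w -> c j z = c j w.
Proof.
move=> /subnK <-; elim: (k - j)%N => [//|i IH].
by rewrite addSn => /nested.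
Qed.

Lemma measurable_cell_saturated k (S : set T) :
  (forall z w, c k z = c k w -> S z -> S w) -> measurable S.
Proof.
move=> satS.
rewrite (_ : S = \bigcup_(i in [set i | exists2 z, S z & c k z = i]) [set z | c k z = i]).
  rewrite bigcup_mkcond; apply: countable_bigcupT_measurable => [|i].
    exact: countableP.
  by case: ifP => // _; exact: measurable0.
apply/seteqP; split => z.
  by move=> Sz; exists (c k z) => //; exists z.
by move=> [_ [w Sw <-]] /= zw; exact: satS Sw.
Qed.

Lemma measurable_cell_average k F : measurable_fun setT (cell_average k F).
Proof.
move=> _ Y mY; rewrite setTI; apply: (@measurable_cell_saturated k) => z w zw.
by rewrite /= /cell_average zw.
Qed.

Lemma measurable_cell_maximal F : measurable_fun setT (cell_maximal F).
Proof.
rewrite /cell_maximal.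
apply: (eq_measurable_fun (fun z => esups (fun k => cell_average k F z) 0%N)).
  move=> z _; rewrite /cell_maximal /esups /= /sdrop; congr ereal_sup.
  by apply/seteqP; split => _ [k _ <-]; exists k.
apply: measurable_fun_esups => k; exact: measurable_cell_average.
Qed.

Lemma cell_maximal_ge k F z : cell_average k F z <= cell_maximal F z.
Proof. by apply: ereal_sup_ubound; exists k. Qed.

Lemma cell_maximal_weak F (lam : R) : (0 < lam)%R ->
  measurable_fun setT F -> (forall z, 0 <= F z) ->
  lam%:E * mu [set z | lam%:E < cell_maximal F z] <= \int[mu]_z F z.
Proof.
move=> lam0 mF F0.
pose E k := [set z | lam%:E < cell_average k F z].
have Esat j k z w : (j <= k)%N -> c k z = c k w -> E j z -> E j w.
  by move=> jk zw; rewrite /E /= /cell_average (nested_le jk zw).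
have Dsat k z w : c k z = c k w -> seqDU E k z -> seqDU E k w.
  move=> zw [Ez nEz]; split; first exact: (Esat k k z).
  rewrite -bigcup_mkord => -[j /= jk Ejw]; apply: nEz.
  by rewrite -bigcup_mkord; exists j => //; exact: (Esat j k w _ (ltnW jk)).
have mD k : measurable (seqDU E k) by exact: (measurable_cell_saturated (Dsat k)).
have -> : [set z | lam%:E < cell_maximal F z] = \bigcup_k seqDU E k.
  rewrite -seqDU_bigcup_eq; apply/seteqP; split => z.
    by move=> /ereal_sup_gt[_ [k _ <-]] kz; exists k.
  by move=> [k _]; rewrite /E /= => /lt_le_trans; apply; exact: cell_maximal_ge.
apply: (@le_trans _ _ (\int[mu]_(z in \bigcup_k seqDU E k) F z)); last first.
  by apply: ge0_subset_integral => //; exact: bigcupT_measurable.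
apply: (measure_le_integral_bigcup (ltW lam0) mF F0 mD (@trivIset_seqDU _ E)) => k.
pose G j := if pickle_inv j is Some i then seqDU E k `&` [set z | c k z = i] else set0.
have -> : seqDU E k = \bigcup_j G j.
  apply/seteqP; split => z.
    by move=> Dz; exists (pickle (c k z)) => //; rewrite /G pickleK_inv.
  by move=> [j _]; rewrite /G; case: pickle_inv => // i [].
have mG j : measurable (G j).
  by rewrite /G; case: pickle_inv => [i|//]; exact: measurableI.
have tG : trivIset setT G.
  apply/trivIsetP => i j _ _ /eqP ij; rewrite -subset0 => z []; rewrite /G.
  case Ei : (pickle_inv i) => [x|//] [_ /= zx].
  case Ej : (pickle_inv j) => [y|//] [_ /= zy]; apply: ij.
  have := pickle_invK (T := I) i; have := pickle_invK (T := I) j.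
  by rewrite Ei Ej /= -zx -zy => -> ->.
apply: (measure_le_integral_bigcup (ltW lam0) mF F0 mG tG) => j.
rewrite /G; case: pickle_inv => [i|]; last first.
  by rewrite measure0 mule0 integral_set0.
have [->|/set0P[z [Dz /= zi]]] := eqVneq (seqDU E k `&` [set z | c k z = i]) set0.
  by rewrite measure0 mule0 integral_set0.
rewrite (_ : _ `&` _ = [set w | c k w = i]); last first.
  apply/seteqP; split => w /=; first by case.
  move=> wi; split => //.
  by apply: (Dsat k z) => //; rewrite zi.
apply: (@le_trans _ _ (lam%:E * (a k)%:E)).
  by rewrite lee_pmul2l//.
have [+ _] := Dz; rewrite /E /= /cell_average zi => /ltW.
by rewrite lee_pdivlMl// [lam%:E * _]muleC.
Qed.

End dyadic_maximal.

(** * Marcinkiewicz interpolation with a change of measure *)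

Section dyadic_sums.
Context (R : realType).
Implicit Types b x y q p eps : R.

Lemma sum_dyadic_powR_le q b x (J : nat) : 0 < q -> 0 < b -> 0 <= x ->
  \sum_(j < J) (if b * 2 ^+ j < x then (b * 2 ^+ j) `^ q else 0)
    <= (2 `^ q / (2 `^ q - 1)) * x `^ q.
Proof.
move=> q0 b0 x0; set rho := 2 `^ q.
have rho1 : 1 < rho.
  apply: (@le_lt_trans _ _ (1 `^ q)); first by rewrite powR1.
  by rewrite /rho gt0_ltr_powR ?nnegrE// ltr1n.
have rho'0 : 0 < rho - 1 by rewrite subr_gt0.
have powM j : (b * 2 ^+ j) `^ q = b `^ q * rho ^+ j.
  rewrite powRM ?exprn_ge0 ?(ltW b0)//; congr (_ * _).
  by rewrite -[2 ^+ j]powR_mulrn// -powRrM mulrC powRrM powR_mulrn ?powR_ge0.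
have full (K : nat) : \sum_(j < K.+1) b `^ q * rho ^+ j <= rho / (rho - 1) * (b `^ q * rho ^+ K).
  rewrite -big_distrr /= mulrCA ler_wpM2l ?powR_ge0//.
  rewrite mulrAC -exprS -(ler_pM2r rho'0) divfK ?gt_eqF//.
  by rewrite mulrC -subrX1 lerBlDr lerDl.
elim: J => [|J IH].
  by rewrite big_ord0 mulr_ge0 ?powR_ge0// divr_ge0 ?powR_ge0// ltW.
have [bx|bx] := ltP (b * 2 ^+ J) x; last first.
  by rewrite big_ord_recr /= ltNge bx /= addr0.
apply: (@le_trans _ _ (\sum_(j < J.+1) b `^ q * rho ^+ j)).
  apply: ler_sum => j _; case: ifPn => _; first by rewrite powM.
  by rewrite mulr_ge0 ?powR_ge0// exprn_ge0// ltW// (lt_trans _ rho1).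
apply: (le_trans (full J)); rewrite ler_wpM2l//.
  by rewrite divr_ge0// ltW// (lt_trans _ rho1).
by rewrite -powM ge0_ler_powR ?nnegrE ?mulr_ge0 ?exprn_ge0// ltW.
Qed.

Local Open Scope ereal_scope.

Lemma nneseries_dyadic_powR_le q b x : (0 < q)%R -> (0 < b)%R -> (0 <= x)%R ->
  \sum_(j <oo) (if b * 2 ^+ j < x then (b * 2 ^+ j) `^ q else 0)%R%:E
    <= (2 `^ q / (2 `^ q - 1) * x `^ q)%R%:E.
Proof.
move=> q0 b0 x0; apply: lime_le.
  by apply: is_cvg_nneseries => j _ _; rewrite lee_fin; case: ifP => // _; exact: powR_ge0.
apply: nearW => J; rewrite sumEFin lee_fin big_mkord.
exact: sum_dyadic_powR_le.
Qed.

Lemma powR_le_dyadic_series p eps y : (0 < p)%R -> (0 < eps)%R -> (0 <= y)%R ->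
  (y `^ p)%:E <= (eps `^ p)%:E +
    \sum_(j <oo) ((eps * 2 ^+ j.+1) `^ p * (eps * 2 ^+ j < y)%R%:R)%R%:E.
Proof.
move=> p0 eps0 y0.
have s0 j : 0 <= ((eps * 2 ^+ j.+1) `^ p * (eps * 2 ^+ j < y)%R%:R)%R%:E.
  by rewrite lee_fin mulr_ge0// powR_ge0.
have [yeps|epsy] := leP y eps.
  rewrite -[leLHS]adde0 leeD//; last by apply: nneseries_ge0.
  by rewrite lee_fin ge0_ler_powR ?nnegrE// ltW.
have [j jP] : exists j, (eps * 2 ^+ j < y <= eps * 2 ^+ j.+1)%R.
  have ex : exists j, (y <= eps * 2 ^+ j)%R.
    have [j Hj] := exists_exp2_ge (y / eps); exists j.
    by rewrite mulrC -ler_pdivrMr.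
  case: (ex_minnP ex) => -[|j] jy jmin.
    by move: jy; rewrite expr0 mulr1 leNgt epsy.
  exists j; rewrite jy andbT ltNge; apply/negP => /jmin.
  by rewrite ltnn.
case/andP: jP => jy yj.
rewrite -[leLHS]add0e leeD//; first by rewrite lee_fin powR_ge0.
apply: (@le_trans _ _ (\sum_(0 <= i < j.+1) ((eps * 2 ^+ i.+1) `^ p * (eps * 2 ^+ i < y)%R%:R)%R%:E)).
  rewrite big_nat_recr//= jy mulr1 -[leLHS]add0e leeD//.
    by apply: sume_ge0 => i _.
  by rewrite lee_fin ge0_ler_powR ?nnegrE ?mulr_ge0 ?exprn_ge0// ltW.
exact: nneseries_lim_ge.
Qed.

End dyadic_sums.

Section marcinkiewicz.
Context d (T : measurableType d) (R : realType).
Variable mu : {measure set T -> \bar R}.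
Local Open Scope ereal_scope.

Variable N : (T -> R) -> T -> \bar R.
Let adm (F : T -> R) := measurable_fun setT F /\ forall z, (0 <= F z)%R.

Variables (kappa : T -> R) (C : R).
Hypothesis C0 : (0 <= C)%R.
Hypothesis mkappa : measurable_fun setT kappa.
Hypothesis kappa0 : forall z, (0 <= kappa z)%R.
Hypothesis kappafin : \int[mu]_z (kappa z)%:E < +oo.
Hypothesis mN : forall F, adm F -> measurable_fun setT (N F).
Hypothesis N0 : forall F z, adm F -> 0 <= N F z.
Hypothesis Nsub : forall F G (k : R) z, adm F -> adm G -> (0 <= k)%R ->
  N (fun w => F w + k * G w)%R z <= N F z + k%:E * N G z.
Hypothesis Nle : forall F G z, adm F -> adm G -> (forall w, (F w <= G w)%R) ->
  N F z <= N G z.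
Hypothesis Nweak : forall F (lam : R), adm F -> (0 < lam)%R ->
  lam%:E * \int[mu]_(z in [set z | lam%:E < N F z]) (kappa z)%:E
    <= C%:E * \int[mu]_z (F z)%:E.

Variables (sigma h B : T -> R) (Z : set T) (p : R).
Hypothesis p1 : (1 < p)%R.
Hypothesis admsigma : adm sigma.
Hypothesis admh : adm h.
Hypothesis mB : measurable_fun setT B.
Hypothesis B1 : forall z, (1 <= B z)%R.
Hypothesis mZ : measurable Z.
Hypothesis Z0 : mu Z = 0.
Hypothesis NB : forall z, ~ Z z -> N sigma z <= (B z)%:E.

Let hs z := (h z * sigma z)%R.
Let y z := (fine (N hs z) / B z)%R.
Let hl (l : R) z := (h z * (l < h z)%R%:R * sigma z)%R.

Let admhs : adm hs.
Proof.
by split; [apply: measurable_funM; [exact: admh.1|exact: admsigma.1]|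
  move=> z; rewrite mulr_ge0 ?admh.2 ?admsigma.2].
Qed.

Let mchi (l : R) (f : T -> R) : measurable_fun setT f ->
  measurable_fun setT (fun z => (l < f z)%R%:R : R).
Proof.
move=> mf; rewrite (_ : (fun z => _) = \1_([set z | (l < f z)%R])).
  apply: measurable_indic; rewrite -[X in measurable X]setTI.
  exact: (measurable_fun_ltr (measurable_cst _) mf).
apply/funext => z; rewrite indicE.
by have -> : (z \in [set z | (l < f z)%R]) = (l < f z)%R by apply/idP/idP; rewrite inE.
Qed.

Let admhl l : adm (hl l).
Proof.
split; last by move=> z; rewrite !mulr_ge0 ?admh.2 ?admsigma.2.
apply: measurable_funM; last exact: admsigma.1.
by apply: measurable_funM; [exact: admh.1|apply: mchi; exact: admh.1].
Qed.

Let my : measurable_fun setT y.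
Proof.
apply: measurable_funM; first by apply: measurableT_comp => //; exact: mN.
apply: (eq_measurable_fun (fun z => B z `^ (-1))%R) => [z _|].
  by rewrite powR_inv1// (le_trans _ (B1 z)).
exact: (measurableT_comp (measurable_powR _)).
Qed.

(* Where [h <= lam / 2], the function [h * sigma] is at most [lam / 2] times    *)
(* [sigma], whose image under [N] is at most [B]; only the truncation [hl]     *)
(* contributes to the level set.                                               *)
Let levelset (lam : R) : (0 < lam)%R ->
  lam%:E * \int[mu]_z (kappa z * (lam < y z)%R%:R)%:E
    <= (2 * C)%:E * \int[mu]_z (hl (lam / 2) z)%:E.
Proof.
move=> lam0; have l20 : (0 < lam / 2)%R by rewrite divr_gt0.
apply: (@le_trans _ _ (lam%:E *
    \int[mu]_(z in [set z | (lam / 2)%:E < N (hl (lam / 2)) z]) (kappa z)%:E)).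
  rewrite lee_pmul2l// [leRHS]integral_mkcond; apply: (le_integral_off_null mZ) => //.
  - by move=> z; rewrite lee_fin mulr_ge0.
  - by move=> z; rewrite patchE; case: ifP => // _; rewrite lee_fin.
  move=> z nZ; have [ly|_] := boolP (lam < y z)%R; last first.
    by rewrite mulr0 patchE; case: ifP => // _; rewrite lee_fin.
  rewrite mulr1 patchE mem_set//= ltNge; apply/negP => Nhl.
  have Nhs : N hs z <= (lam / 2)%:E + (lam / 2)%:E * (B z)%:E.
    apply: (@le_trans _ _ (N (hl (lam / 2)) z + (lam / 2)%:E * N sigma z)).
      apply: le_trans (Nsub _ _ _ _) => //; last exact: ltW.
      apply: Nle => //.
        split; last first.
          by move=> w; rewrite addr_ge0 ?((admhl _).2 w)// mulr_ge0 ?admsigma.2 ?(ltW l20).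
        apply: measurable_funD; first exact: (admhl _).1.
        by apply: measurable_funM => //; exact: admsigma.1.
      move=> w; rewrite /hs /hl; have [|hle] := ltP (lam / 2)%R (h w).
        by rewrite mulr1 lerDl mulr_ge0 ?admsigma.2 ?(ltW l20).
      by rewrite mulr0 mul0r add0r ler_wpM2r// admsigma.2.
    by rewrite leeD// lee_pmul2l// NB.
  move: ly; rewrite ltNge => /negP; apply; rewrite /y.
  have B0 : (0 < B z)%R by rewrite (lt_le_trans _ (B1 z)).
  rewrite ler_pdivrMr//.
  case: (N hs z) (N0 z admhs) Nhs => [a| |] /=; last 2 first.
  - by move=> _ _; rewrite mulr_ge0 ?(ltW lam0) ?(ltW B0).
  - by move=> _ _; rewrite mulr_ge0 ?(ltW lam0) ?(ltW B0).
  rewrite -EFinM -EFinD !lee_fin => a0 /le_trans; apply.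
  by have := B1 z; nra.
have -> : lam%:E = 2%:E * (lam / 2)%:E by rewrite -EFinM; congr EFin; field.
by rewrite [(2 * C)%:E]EFinM -!muleA lee_pmul2l//; exact: Nweak.
Qed.

Lemma marcinkiewicz :
  \int[mu]_z ((fine (N (fun w => h w * sigma w)%R z) / B z) `^ p * kappa z)%:E <=
  (2 `^ p * (2 * C) * (2 `^ (p - 1) / (2 `^ (p - 1) - 1) * 2 `^ (p - 1)))%:E *
    \int[mu]_z ((h z) `^ p * sigma z)%:E.
Proof.
rewrite -/hs.
set K := (2 `^ p * (2 * C))%R; set K' := (2 `^ (p - 1) / (2 `^ (p - 1) - 1))%R.
set J := \int[mu]_z ((h z) `^ p * sigma z)%:E.
have p0 : (0 < p)%R by rewrite (lt_trans _ p1).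
have q0 : (0 < p - 1)%R by rewrite subr_gt0.
have y0 z : (0 <= y z)%R.
  by rewrite divr_ge0 ?(le_trans _ (B1 z))// fine_ge0// N0.
have K0 : (0 <= K)%R by rewrite !mulr_ge0 ?powR_ge0.
have K'0 : (0 <= K')%R.
  by rewrite divr_ge0 ?powR_ge0// subr_ge0 -[leLHS](powRr0 2) ler_powR ?ler1n// ltW.
suff key eps : (0 < eps)%R -> \int[mu]_z ((y z) `^ p * kappa z)%:E <=
    (eps `^ p)%:E * \int[mu]_z (kappa z)%:E + (K * (K' * 2 `^ (p - 1)))%:E * J.
  apply/lee_addgt0Pr => e e0.
  set M := \int[mu]_z (kappa z)%:E in key.
  have M0 : 0 <= M by apply: integral_ge0 => z _; rewrite lee_fin.
  have Mfin : M \is a fin_num by rewrite ge0_fin_numE.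
  have M10 : (0 < fine M + 1)%R by rewrite ltr_wpDl// fine_ge0.
  apply: (le_trans (key ((e / (fine M + 1)) `^ p^-1)%R _)).
    by rewrite powR_gt0// divr_gt0.
  rewrite -powRrM mulVf ?gt_eqF// powRr1 ?divr_ge0 ?(ltW e0) ?(ltW M10)//.
  rewrite addeC; apply: leeD => //; rewrite -(fineK Mfin) -EFinM lee_fin.
  by rewrite mulrAC ler_pdivrMr// ler_wpM2l ?(ltW e0)// lerDl.
move=> eps0.
have mt j : measurable_fun setT (fun z =>
    (((eps * 2 ^+ j.+1) `^ p * (eps * 2 ^+ j < y z)%R%:R) * kappa z)%R%:E).
  apply/measurable_EFinP; apply: measurable_funM => //; apply: measurable_funM => //.
  exact: mchi.
have t0 j z : 0 <= (((eps * 2 ^+ j.+1) `^ p * (eps * 2 ^+ j < y z)%R%:R) * kappa z)%R%:E.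
  by rewrite lee_fin !mulr_ge0 ?powR_ge0.
apply: (@le_trans _ _ (\int[mu]_z ((eps `^ p)%:E * (kappa z)%:E + \sum_(j <oo)
    (((eps * 2 ^+ j.+1) `^ p * (eps * 2 ^+ j < y z)%R%:R) * kappa z)%R%:E))).
  apply: le_integral_nomeas => z; first by rewrite lee_fin mulr_ge0 ?powR_ge0.
  have -> : \sum_(j <oo) (((eps * 2 ^+ j.+1) `^ p * (eps * 2 ^+ j < y z)%R%:R) * kappa z)%R%:E
     = (kappa z)%:E * \sum_(j <oo) ((eps * 2 ^+ j.+1) `^ p * (eps * 2 ^+ j < y z)%R%:R)%R%:E.
    rewrite -nneseriesZl; last by move=> j _; rewrite lee_fin mulr_ge0 ?powR_ge0.
    by apply: eq_eseriesr => j _; rewrite -EFinM mulrC.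
  rewrite EFinM [_%:E * (kappa z)%:E]muleC [(eps `^ p)%:E * _]muleC.
  rewrite -ge0_muleDr ?lee_fin ?powR_ge0//; last first.
    by apply: nneseries_ge0 => j _ _; rewrite lee_fin mulr_ge0 ?powR_ge0.
  rewrite lee_wpmul2l ?lee_fin//; exact: powR_le_dyadic_series.
rewrite ge0_integralD//; first last.
- by apply: ge0_emeasurable_sum => // j z _ _; exact: t0.
- by move=> z _; apply: nneseries_ge0 => j _ _; exact: t0.
- by apply: measurable_funeM; exact/measurable_EFinP.
- by move=> z _; rewrite mule_ge0// lee_fin ?powR_ge0.
apply: leeD.
  rewrite ge0_integralZl//; first exact/measurable_EFinP.
  - by move=> z _; rewrite lee_fin.
  - by rewrite lee_fin powR_ge0.
rewrite integral_nneseries//.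
have step j : \int[mu]_z (((eps * 2 ^+ j.+1) `^ p * (eps * 2 ^+ j < y z)%R%:R) * kappa z)%R%:E
   <= \int[mu]_z (K%:E * ((h z * sigma z)%:E * (if eps / 2 * 2 ^+ j < h z
             then (eps * 2 ^+ j) `^ (p - 1) else 0)%R%:E)).
  set lam := (eps * 2 ^+ j)%R.
  have lam0 : (0 < lam)%R by rewrite mulr_gt0 ?exprn_gt0.
  have -> : (eps * 2 ^+ j.+1)%R = (2 * lam)%R by rewrite /lam exprS mulrCA.
  have -> : (eps / 2 * 2 ^+ j)%R = (lam / 2)%R by rewrite /lam mulrAC.
  have -> : ((2 * lam) `^ p)%R = (2 `^ p * lam `^ (p - 1) * lam)%R.
    by rewrite powRM ?(ltW lam0)// -mulrA [(_ * lam)%R]mulrC mulr_powRB1 ?(ltW lam0).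
  have L0 : (0 <= 2 `^ p * lam `^ (p - 1))%R by rewrite mulr_ge0 ?powR_ge0.
  rewrite (_ : \int[mu]_z _ = (2 `^ p * lam `^ (p - 1))%:E *
      (lam%:E * \int[mu]_z (kappa z * (lam < y z)%R%:R)%:E)); last first.
    rewrite muleA -EFinM -ge0_integralZl//.
    - by apply: eq_integral => z _; rewrite -EFinM; congr EFin; ring.
    - by apply/measurable_EFinP; apply: measurable_funM => //; exact: mchi.
    - by move=> z _; rewrite lee_fin mulr_ge0.
    - by rewrite lee_fin mulr_ge0 ?(ltW lam0).
  rewrite (_ : \int[mu]_z (K%:E * _) = (2 `^ p * lam `^ (p - 1))%:E *
      ((2 * C)%:E * \int[mu]_z (hl (lam / 2) z)%:E)); last first.
    rewrite muleA -EFinM -ge0_integralZl//.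
    - apply: eq_integral => z _; rewrite -!EFinM; congr EFin.
      by rewrite /K /hl; case: ifPn => _; rewrite ?mulr1 ?mulr0 ?mul0r ?mulr0; ring.
    - by apply/measurable_EFinP; exact: (admhl _).1.
    - by move=> z _; rewrite lee_fin; exact: (admhl _).2.
    - by rewrite lee_fin !mulr_ge0 ?powR_ge0.
  by rewrite lee_wpmul2l ?lee_fin//; exact: levelset.
have u0 j z : 0 <= K%:E * ((h z * sigma z)%:E * (if eps / 2 * 2 ^+ j < h z
             then (eps * 2 ^+ j) `^ (p - 1) else 0)%R%:E).
  rewrite !mule_ge0 ?lee_fin ?mulr_ge0 ?admh.2 ?admsigma.2//.
  by case: ifP => // _; exact: powR_ge0.
have mu' j : measurable_fun setT (fun z => K%:E * ((h z * sigma z)%:E *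
     (if eps / 2 * 2 ^+ j < h z then (eps * 2 ^+ j) `^ (p - 1) else 0)%R%:E)).
  apply: measurable_funeM; apply: emeasurable_funM.
    by apply/measurable_EFinP; exact: admhs.1.
  apply/measurable_EFinP; apply: (eq_measurable_fun (fun z =>
     (eps * 2 ^+ j) `^ (p - 1) * (eps / 2 * 2 ^+ j < h z)%R%:R)%R) => [z _|].
    by case: ifPn => _; rewrite ?mulr1 ?mulr0.
  by apply: measurable_funM => //; apply: mchi; exact: admh.1.
apply: (@le_trans _ _ (\sum_(j <oo) \int[mu]_z (K%:E * ((h z * sigma z)%:E *
   (if eps / 2 * 2 ^+ j < h z then (eps * 2 ^+ j) `^ (p - 1) else 0)%R%:E)))).
  by apply: lee_nneseries => [j _ _|j _]; [exact: integral_ge0|exact: step].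
rewrite -integral_nneseries// -ge0_integralZl//; first last.
- by rewrite lee_fin; apply: mulr_ge0 => //; apply: mulr_ge0; rewrite ?powR_ge0.
- by move=> z _; rewrite lee_fin mulr_ge0 ?powR_ge0 ?admsigma.2.
- apply/measurable_EFinP; apply: measurable_funM; last exact: admsigma.1.
  by apply: (measurableT_comp (measurable_powR _)); exact: admh.1.
apply: le_integral_nomeas => z; first by apply: nneseries_ge0 => j _ _; exact: u0.
have h0 : (0 <= h z)%R by exact: admh.2.
have s0 : (0 <= sigma z)%R by exact: admsigma.2.
rewrite (_ : \sum_(j <oo) _ = (K * (h z * sigma z) * 2 `^ (p - 1))%:E *
   \sum_(j <oo) (if eps / 2 * 2 ^+ j < h z then (eps / 2 * 2 ^+ j) `^ (p - 1) else 0)%R%:E); last first.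
  rewrite -nneseriesZl; last by move=> j _; rewrite lee_fin; case: ifP => // _; exact: powR_ge0.
  apply: eq_eseriesr => j _; rewrite -!EFinM; congr EFin.
  case: ifPn => _; last by rewrite !mulr0.
  have -> : (eps * 2 ^+ j = 2 * (eps / 2 * 2 ^+ j))%R by field.
  rewrite powRM ?mulr_ge0 ?exprn_ge0 ?divr_ge0 ?(ltW eps0)//; ring.
apply: (@le_trans _ _ ((K * (h z * sigma z) * 2 `^ (p - 1))%:E * (K' * (h z) `^ (p - 1))%:E)).
  rewrite lee_wpmul2l ?lee_fin ?mulr_ge0 ?powR_ge0//.
  by apply: nneseries_dyadic_powR_le => //; rewrite divr_gt0.
rewrite -!EFinM lee_fin -(mulr_powRB1 h0 p0) le_eqVlt; apply/orP; left; apply/eqP; ring.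
Qed.

End marcinkiewicz.

(** * Converse of Hoelder's inequality *)

Section converse_hoelder.
Context d (T : measurableType d) (R : realType).
Variable mu : {measure set T -> \bar R}.
Local Open Scope ereal_scope.

Lemma integral_lty_fin_off_null (f : T -> \bar R) :
  measurable_fun setT f -> (forall z, 0 <= f z) -> \int[mu]_z f z < +oo ->
  exists Z, [/\ measurable Z, mu Z = 0 & forall z, ~ Z z -> f z < +oo].
Proof.
move=> mf f0 fy.
have /integrable_ae : mu.-integrable setT f.
  apply/integrableP; split => //.
  by under eq_integral do rewrite gee0_abs//.
move=> /(_ measurableT)[Z [mZ Z0 HZ]]; exists Z; split => // z nZ.
rewrite ltey; apply/eqP => fz; apply: nZ; apply: HZ => /=.
by rewrite fz => /(_ I).
Qed.

Lemma ge0_integral_restrict_indic (A : set T) (f : T -> R) :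
  \int[mu]_(z in A) (f z)%:E = \int[mu]_z (f z * \1_A z)%:E.
Proof.
rewrite integral_mkcond; apply: eq_integral => z _; rewrite patchE indicE.
by case: ifP => _; rewrite ?mulr1 ?mulr0.
Qed.

Variables (G : T -> R) (p : R).
Hypothesis mG : measurable_fun setT G.
Hypothesis G0 : forall z, (0 <= G z)%R.
Let adm (P : T -> R) := measurable_fun setT P /\ forall z, (0 <= P z)%R.
Hypothesis p1 : (1 <= p)%R.
Let p0 : (0 < p)%R. Proof. by rewrite (lt_le_trans _ p1). Qed.

(* The witnesses are glued into the l^p-type sum [(sum_j 2^-j P_j^p)^(1/p)].   *)
Lemma unbounded_pairing :
  (forall M : R, exists P, [/\ adm P, \int[mu]_z (P z `^ p)%:E <= 1 &
    M%:E <= \int[mu]_z (P z * G z)%:E]) ->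
  exists P, [/\ adm P, \int[mu]_z (P z `^ p)%:E < +oo &
    \int[mu]_z (P z * G z)%:E = +oo].
Proof.
move=> H; have /choice[P] := fun j : nat => H (4 ^+ j)%R.
move=> /all_and3[/all_and2[mP P0] Pp PG].
pose s j z : \bar R := ((2^-1) ^+ j * P j z `^ p)%R%:E.
have s0 j z : 0 <= s j z by rewrite lee_fin mulr_ge0 ?powR_ge0.
have ms j : measurable_fun setT (s j).
  apply/measurable_EFinP; apply: measurable_funM => //.
  exact: (measurableT_comp (measurable_powR _)).
pose S z := \sum_(j <oo) s j z.
have S0 z : 0 <= S z by apply: nneseries_ge0.
have mS : measurable_fun setT S by apply: ge0_emeasurable_sum.
have intS : \int[mu]_z S z < +oo.
  rewrite /S integral_nneseries//.
  apply: (@le_lt_trans _ _ (\sum_(j <oo) ((2^-1) ^+ j)%R%:E)).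
    apply: lee_nneseries => [j _ _|j _]; first exact: integral_ge0.
    under eq_integral do rewrite /s EFinM.
    rewrite ge0_integralZl//; first by rewrite -[leRHS]mule1 lee_wpmul2l.
    - by apply/measurable_EFinP; exact: (measurableT_comp (measurable_powR _)).
    - by move=> z _; rewrite lee_fin powR_ge0.
  exact: le_lt_trans (nneseries_half_le2 R) (ltry _).
have [Z [mZ Z0 SZ]] := integral_lty_fin_off_null mS S0 intS.
have mPP : measurable_fun setT (fun z => fine (S z) `^ p^-1)%R.
  apply: (measurableT_comp (measurable_powR _)).
  exact: measurableT_comp.
exists (fun z => (fine (S z) `^ p^-1)%R); split.
- by split => // z; rewrite powR_ge0.
- apply: le_lt_trans intS; apply: le_integral_nomeas => z.
    by rewrite lee_fin powR_ge0.
  rewrite -powRrM mulVf ?gt_eqF// powRr1 ?fine_ge0//.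
  by case: (S z) (S0 z) => [r| |]//= _; rewrite leey.
- apply: eq_infty => t.
  have [j tj] := exists_exp2_ge t.
  apply: (@le_trans _ _ (2 ^+ j)%R%:E); first by rewrite lee_fin.
  apply: (@le_trans _ _ (\int[mu]_z ((2^-1 ^+ j)%R%:E * (P j z * G z)%:E))).
    rewrite ge0_integralZl//; first last.
    - by move=> z _; rewrite lee_fin mulr_ge0.
    - by apply/measurable_EFinP; exact: measurable_funM.
    apply: (@le_trans _ _ ((2^-1 ^+ j)%R%:E * (4 ^+ j)%R%:E)); last by rewrite lee_wpmul2l.
    by rewrite -EFinM lee_fin -exprMn (_ : 2^-1 * 4 = 2)%R//; field.
  apply: (le_integral_off_null mZ) => // z.
  - by rewrite mule_ge0 ?lee_fin ?mulr_ge0.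
  - by rewrite lee_fin mulr_ge0 ?powR_ge0.
  move=> nZ; rewrite -EFinM lee_fin mulrA ler_wpM2r//.
  have e0 : (0 < 2^-1 ^+ j :> R)%R by rewrite exprn_gt0.
  apply: (@le_trans _ _ ((2^-1 ^+ j * P j z `^ p) `^ p^-1)%R).
    rewrite powRM ?powR_ge0 ?(ltW e0)// -powRrM divff ?gt_eqF// powRr1//.
    rewrite ler_wpM2r// ger1_powR// ?e0 ?exprn_ile1 ?invf_le1 ?ler1n//.
  have Sfin : S z \is a fin_num by rewrite ge0_fin_numE// SZ.
  rewrite ge0_ler_powR ?nnegrE ?invr_ge0 ?(ltW p0) ?mulr_ge0 ?powR_ge0 ?fine_ge0//.
  rewrite -lee_fin fineK//; apply: le_trans (nneseries_lim_ge j.+1 _) => //.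
  by rewrite big_nat_recr//= leeDr// sume_ge0.
Qed.

Hypothesis HG : forall P, adm P -> \int[mu]_z (P z `^ p)%:E < +oo ->
    \int[mu]_z (P z * G z)%:E < +oo.

Hypothesis sf : sigma_finite setT mu.

Let bounded_pairing : ~ (forall M : R, exists P, [/\ adm P,
    \int[mu]_z (P z `^ p)%:E <= 1 & M%:E <= \int[mu]_z (P z * G z)%:E]).
Proof. by move=> /unbounded_pairing[P [aP /(HG aP)]] => /[swap] ->. Qed.

Let m_gt (M : R) : measurable [set z | (M < G z)%R].
Proof.
rewrite -[X in measurable X]setTI.
exact: (measurable_fun_ltr (measurable_cst _) mG).
Qed.

Lemma converse_hoelder1 : p = 1%R -> exists M : R, mu [set z | (M < G z)%R] = 0.
Proof.
move=> pE; apply: contrapT => noM; apply: bounded_pairing => M0.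
pose M := Num.max M0 0%R; pose A := [set z | (M < G z)%R].
have M00 : (0 <= M)%R by rewrite le_max lexx orbT.
have [F [TF ndF mF]] := (sigma_finiteP _ _).1 sf.
have [k Ak] : exists k, mu (A `&` F k) != 0.
  apply: contrapT => /forallNP nk; apply: noM; exists M.
  rewrite (_ : [set z | _] = \bigcup_k (A `&` F k)); last first.
    by rewrite -setI_bigcupr -TF setIT.
  have : mu.-negligible (\bigcup_k (A `&` F k)).
    apply: negligible_bigcup => k; apply/negligibleP.
      by apply: measurableI; [exact: m_gt|exact: (mF k).1].
    by apply/eqP/negPn/negP; exact: nk.
  move/negligibleP => -> //; apply: bigcupT_measurable => k.
  by apply: measurableI; [exact: m_gt|exact: (mF k).1].
have mB : measurable (A `&` F k) by apply: measurableI; [exact: m_gt|exact: (mF k).1].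
have Bfin : mu (A `&` F k) \is a fin_num.
  rewrite ge0_fin_numE//; apply: le_lt_trans (mF k).2.
  by apply: le_measure; rewrite ?inE//; exact: (mF k).1.
set a := mu (A `&` F k) in Ak Bfin.
have a0 : (0 < fine a)%R by apply: fine_gt0; rewrite lt0e Ak measure_ge0 /= -ge0_fin_numE ?measure_ge0.
have intP (c : R) : (0 <= c)%R ->
    \int[mu]_z (c * ((fine a)^-1 * \1_(A `&` F k) z))%:E = c%:E.
  move=> c0; under eq_integral do rewrite mulrA EFinM.
  rewrite ge0_integralZl ?lee_fin ?divr_ge0 ?(ltW a0)//.
    rewrite integral_indic// setIT -/a -(fineK Bfin) -EFinM.
    by rewrite divfK ?gt_eqF.
  exact/measurable_EFinP.
exists (fun z => (fine a)^-1 * \1_(A `&` F k) z)%R; split.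
- split; first exact: measurable_funM.
  by move=> z; rewrite mulr_ge0 ?invr_ge0 ?(ltW a0).
- rewrite (_ : \int[mu]_z _ = \int[mu]_z (1 * ((fine a)^-1 * \1_(A `&` F k) z))%:E).
    by rewrite intP.
  by apply: eq_integral => z _; rewrite pE powRr1 ?mul1r ?mulr_ge0 ?invr_ge0 ?(ltW a0).
apply: (@le_trans _ _ M%:E); first by rewrite lee_fin le_max lexx.
rewrite -(intP M)//; apply: le_integral_nomeas => z; rewrite lee_fin.
  by rewrite !mulr_ge0 ?invr_ge0 ?(ltW a0).
rewrite [leRHS]mulrC indicE; have [|_] := boolP (z \in _); rewrite ?mulr0//.
by rewrite inE => -[/= /ltW Az _]; rewrite ler_wpM2r ?mulr_ge0 ?invr_ge0 ?(ltW a0).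
Qed.

Lemma converse_hoelder : (1 < p)%R -> \int[mu]_z (G z `^ (p / (p - 1)))%:E < +oo.
Proof.
move=> p_gt1; rewrite ltey; apply/eqP => Gy; apply: bounded_pairing => M.
have pp0 : (0 < p - 1)%R by rewrite subr_gt0.
set q := (p / (p - 1))%R in Gy.
have q0 : (0 < q)%R by rewrite divr_gt0.
have [F [TF ndF mF]] := (sigma_finiteP _ _).1 sf.
pose A k := F k `&` [set z | (G z <= k%:R)%R].
have mA k : measurable (A k).
  apply: measurableI; first exact: (mF k).1.
  rewrite -[X in measurable X]setTI.
  exact: (measurable_fun_ler mG (measurable_cst _)).
have ndA : nondecreasing_seq A.
  move=> i j ij; apply/subsetPset => z [Fz /= Gz]; split.
    by move/subsetPset: (ndF _ _ ij); exact.
  by rewrite /= (le_trans Gz)// ler_nat.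
have TA : \bigcup_k A k = setT.
  apply/seteqP; split => // z _; have : setT z by [].
  rewrite TF => -[i _ Fi]; exists (maxn i (Num.bound (G z))) => //; split.
    by move/subsetPset: (ndF _ _ (leq_maxl i (Num.bound (G z)))); exact.
  by rewrite /= (le_trans (ltW (archi_boundP (G0 z))))// ler_nat leq_maxr.
have mGq : measurable_fun setT (fun z => G z `^ q)%R by exact: (measurableT_comp (measurable_powR _)).
have : \int[mu]_(z in A k) (G z `^ q)%:E @[k --> \oo] --> +oo.
  rewrite -Gy -TA; apply: ge0_nondecreasing_set_cvg_integral => //.
    by move=> k; apply: measurable_funTS; exact/measurable_EFinP.
  by move=> k z _; rewrite lee_fin powR_ge0.
move=> /cvgeyPge /(_ (Num.max 1 (Num.max 0 M `^ (p / (p - 1))))%R)[k _ /(_ _ (leqnn k)) /= ak].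
set a := \int[mu]_(z in A k) (G z `^ q)%:E in ak.
have afin : a \is a fin_num.
  rewrite ge0_fin_numE; last by apply: integral_ge0 => z _; rewrite lee_fin powR_ge0.
  apply: (@le_lt_trans _ _ (\int[mu]_(z in A k) (k%:R `^ q)%:E)).
    apply: ge0_le_integral => //.
    - by move=> z _; rewrite lee_fin powR_ge0.
    - by apply: measurable_funTS; exact/measurable_EFinP.
    - by move=> z [_ /= Gz]; rewrite lee_fin ge0_ler_powR ?nnegrE ?(ltW q0).
  rewrite integral_cst//; apply: lte_mul_pinfty; rewrite ?lee_fin ?powR_ge0//.
  apply: le_lt_trans (mF k).2; apply: le_measure; rewrite ?inE//.
    exact: (mF k).1.
  by move=> z [].
have [a1 aM] : (1 <= fine a)%R /\ (Num.max 0 M `^ q <= fine a)%R.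
  by move: ak; rewrite -(fineK afin) lee_fin ge_max => /andP[].
have a0 : (0 < fine a)%R by rewrite (lt_le_trans _ a1).
have intP (c : R) : (0 <= c)%R -> \int[mu]_z (c * (G z `^ q * \1_(A k) z))%:E = (c * fine a)%:E.
  move=> c0; under eq_integral do rewrite EFinM.
  rewrite ge0_integralZl//.
  - by rewrite -ge0_integral_restrict_indic EFinM fineK.
  - by apply/measurable_EFinP; exact: measurable_funM.
  - by move=> z _; rewrite lee_fin mulr_ge0 ?powR_ge0.
exists (fun z => (fine a) `^ (- p^-1) * (G z `^ (q - 1) * \1_(A k) z))%R; split.
- split; last by move=> z; rewrite !mulr_ge0 ?powR_ge0.
  apply: measurable_funM => //; apply: measurable_funM => //.
  exact: (measurableT_comp (measurable_powR _)).
- rewrite (_ : \int[mu]_z _ = \int[mu]_z ((fine a)^-1 * (G z `^ q * \1_(A k) z))%:E).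
    by rewrite intP ?invr_ge0 ?(ltW a0)// mulVf ?gt_eqF.
  apply: eq_integral => z _; congr EFin.
  rewrite powRM ?mulr_ge0 ?powR_ge0// powRM ?powR_ge0// -!powRrM.
  rewrite mulNr mulVf ?gt_eqF// powR_inv1 ?(ltW a0)//; congr (_ * (_ * _))%R.
    by congr (_ `^ _)%R; rewrite /q; field; rewrite gt_eqF.
  by rewrite indicE; case: (_ \in _); rewrite ?powR1 ?powR0 ?gt_eqF.
rewrite (_ : \int[mu]_z _ = \int[mu]_z ((fine a) `^ (- p^-1) * (G z `^ q * \1_(A k) z))%:E); last first.
  apply: eq_integral => z _; congr EFin.
  by rewrite -(mulr_powRB1 (G0 z) q0); ring.
rewrite intP ?powR_ge0// lee_fin.
have -> : (fine a `^ (- p^-1) * fine a = fine a `^ q^-1)%R.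
  rewrite -[X in (_ * X)%R]powRr1 ?(ltW a0)// -powRD; last by rewrite (gt_eqF a0) implybT.
  by congr (_ `^ _)%R; rewrite /q; field; rewrite !gt_eqF.
apply: (@le_trans _ _ ((Num.max 0 M `^ q) `^ q^-1)%R).
  by rewrite -powRrM divff ?gt_eqF// powRr1 ?le_max ?lexx// orbT.
by rewrite ge0_ler_powR ?nnegrE ?powR_ge0 ?invr_ge0 ?(ltW q0) ?(ltW a0).
Qed.

End converse_hoelder.

(** * Integrals and boxes on the waveguide *)

Section tuple_integrals.
Context (R : realType).
Local Open Scope ereal_scope.
Local Notation Rm := (measurableTypeR R).
Local Notation leb := (@lebesgue_measure R).

Lemma measurable_prod_tnth n (h : 'I_n -> R -> R) :
  (forall i, measurable_fun setT (h i : Rm -> R)) ->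
  measurable_fun setT (fun w : n.-tuple Rm => \prod_(i < n) h i (tnth w i))%R.
Proof.
move=> mh; apply: measurable_prod => i _.
exact: (measurableT_comp (mh i) (measurable_tnth i)).
Qed.

Lemma integral_lebesgue_tuple_prod n (h : 'I_n -> R -> R) (c : 'I_n -> R) :
  (forall i, measurable_fun setT (h i : Rm -> R)) ->
  (forall i s, (0 <= h i s)%R) ->
  (forall i, \int[leb]_s (h i s)%:E = (c i)%:E) ->
  \int[lebesgue_tuple R n]_w (\prod_(i < n) h i (tnth w i))%:E
    = (\prod_(i < n) c i)%:E.
Proof.
elim: n h c => [|n IH] h c mh h0 hc.
  rewrite integral_dirac//; last first.
    by apply/measurable_EFinP; exact: measurable_prod_tnth.
  by rewrite diracT mul1e !big_ord0.
have mprod := measurable_prod_tnth mh.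
have F0 : {in setT, forall w : n.+1.-tuple Rm, 0 <= (\prod_(i < n.+1) h i (tnth w i))%:E}.
  by move=> w _; rewrite lee_fin prodr_ge0.
have := @ge0_integral_pushforward _ _ _ _ R _ (@measurable_tcons R n)
  (leb \x lebesgue_tuple R n) setT (fun w => (\prod_(i < n.+1) h i (tnth w i))%:E)
  measurableT ((measurable_EFinP _ _).2 mprod) F0.
rewrite preimage_setT => E; apply: (etrans (etrans _ E)) => {E}.
  by apply: eq_measure_integral => [|mt A _ _]; [exact: measurable_tcons|].
rewrite fubini_tonelli1//; first last.
- by move=> z; rewrite lee_fin prodr_ge0.
- apply/measurable_EFinP; apply: (measurableT_comp mprod); exact: measurable_tcons.
have factor (a : Rm) (w : n.-tuple Rm) : (\prod_(i < n.+1) h i (tnth (tcons (a, w)) i) =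
    h ord0 a * \prod_(i < n) h (lift ord0 i) (tnth w i))%R.
  rewrite big_ord_recl; congr (_ * _)%R; apply: eq_bigr => i _.
  by rewrite tnthS; congr (h _ (tnth _ _)); exact/val_inj.
transitivity (\int[leb]_a ((\prod_(i < n) c (lift ord0 i))%:E * (h ord0 a)%:E)).
  apply: eq_integral => a _; rewrite /fubini_F /=.
  under eq_integral do rewrite factor EFinM.
  rewrite ge0_integralZl//; first last.
  - by rewrite lee_fin.
  - by move=> w _; rewrite lee_fin prodr_ge0.
  - by apply/measurable_EFinP; apply: (@measurable_prod_tnth n (fun i => h (lift ord0 i))).
  by rewrite (IH (fun i => h (lift ord0 i)) (fun i => c (lift ord0 i)))// muleC.
have c0 i : (0 <= c i)%R.
  by rewrite -lee_fin -hc; apply: integral_ge0 => s _; rewrite lee_fin.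
rewrite ge0_integralZl//; first last.
- by rewrite lee_fin prodr_ge0.
- by move=> w _; rewrite lee_fin.
- by apply/measurable_EFinP; exact: mh.
by rewrite hc big_ord_recl EFinM muleC.
Qed.

End tuple_integrals.

Section waveguide_integrals.
Context (R : realType) (n m : nat).
Local Open Scope ereal_scope.
Local Notation Rm := (measurableTypeR R).
Local Notation leb := (@lebesgue_measure R).
Local Notation WG := (waveguide R n m).
Local Notation mu := (WG_measure R n m).
Local Notation cellI := (`[(- 2^-1)%R : R, 2^-1%R[%classic).

Lemma lebesgue_measure_cell : leb cellI = 1%:E.
Proof.
rewrite lebesgue_measure_itv /= lte_fin.
have -> : (- 2^-1 < 2^-1 :> R)%R by lra.
by rewrite -?EFinN -?EFinD (_ : 2^-1 - - 2^-1 = 1)%R//; lra.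
Qed.

Lemma indic_unit_cellE (x : n.-tuple Rm) :
  (\1_(@unit_cell R n) x = \prod_(i < n) \1_cellI (tnth x i : R) :> R)%R.
Proof.
have [xU|xU] := boolP (x \in @unit_cell R n).
  rewrite indicE xU big1// => i _; rewrite indicE mem_set//= in_itv/=.
  by move: xU; rewrite inE; exact.
rewrite indicE (negbTE xU).
have [i ni] : exists i, ~ (- 2^-1 <= (tnth x i : R) < 2^-1)%R.
  by apply/existsNP; move: xU; rewrite notin_setE.
by rewrite (bigD1 i)//= indicE memNset ?mul0r//= in_itv.
Qed.

Lemma integral_torus (f : n.-tuple Rm -> R) : measurable_fun setT f ->
  (forall x, (0 <= f x)%R) ->
  \int[torus_measure R n]_x (f x)%:E
    = \int[lebesgue_tuple R n]_x (f x * \1_(@unit_cell R n) x)%:E.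
Proof.
move=> mf f0; have mU := @measurable_unit_cell R n.
rewrite -ge0_integral_restrict_indic.
transitivity (\int[torus_measure R n]_x (f x * \1_(@unit_cell R n) x)%:E).
  apply: (ge0_eq_integral_off_null (measurableC mU)) => [|x|x|x nx].
  - by rewrite /= /torus_measure /mrestr setICl measure0.
  - by rewrite lee_fin.
  - by rewrite lee_fin mulr_ge0.
  - by rewrite indicE mem_set ?mulr1//; apply: contrapT.
rewrite -ge0_integral_restrict_indic; apply: eq_measure_integral => A mA AU.
by rewrite /= /torus_measure /mrestr setIidl.
Qed.

Lemma integral_WG_prod (a : 'I_n -> R -> R) (b : 'I_m -> R -> R)
    (ca : 'I_n -> R) (cb : 'I_m -> R) :
  (forall i, measurable_fun setT (a i : Rm -> R)) ->
  (forall j, measurable_fun setT (b j : Rm -> R)) ->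
  (forall i s, (0 <= a i s)%R) -> (forall j s, (0 <= b j s)%R) ->
  (forall i, \int[leb]_s (a i s * \1_cellI s)%:E = (ca i)%:E) ->
  (forall j, \int[leb]_s (b j s)%:E = (cb j)%:E) ->
  \int[mu]_z (\prod_(i < n) a i (tnth z.1 i) * \prod_(j < m) b j (tnth z.2 j))%:E
   = (\prod_(i < n) ca i * \prod_(j < m) cb j)%:E.
Proof.
move=> ma mb a0 b0 hca hcb.
have mpa := measurable_prod_tnth ma; have mpb := measurable_prod_tnth mb.
have cb0 j : (0 <= cb j)%R.
  by rewrite -lee_fin -hcb; apply: integral_ge0 => s _; rewrite lee_fin.
rewrite /WG_measure fubini_tonelli1; first last.
- by move=> z; rewrite lee_fin mulr_ge0 ?prodr_ge0.
- apply/measurable_EFinP; apply: measurable_funM.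
    exact: (measurableT_comp mpa).
  exact: (measurableT_comp mpb).
rewrite /fubini_F.
transitivity (\int[torus_measure R n]_x ((\prod_(j < m) cb j)%:E * (\prod_(i < n) a i (tnth x i))%:E)).
  apply: eq_integral => x _ /=.
  under eq_integral do rewrite EFinM.
  rewrite ge0_integralZl//; first last.
  - by rewrite lee_fin prodr_ge0.
  - by move=> w _; rewrite lee_fin prodr_ge0.
  - exact/measurable_EFinP.
  by rewrite (integral_lebesgue_tuple_prod mb b0 hcb) muleC.
rewrite ge0_integralZl//; first last.
- by rewrite lee_fin prodr_ge0.
- by move=> w _; rewrite lee_fin prodr_ge0.
- exact/measurable_EFinP.
rewrite integral_torus//; last by move=> x; rewrite prodr_ge0.
under eq_integral do rewrite indic_unit_cellE -big_split/=.
rewrite (@integral_lebesgue_tuple_prod R n (fun i s => a i s * \1_cellI s)%R ca)//.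
- by rewrite muleC.
- by move=> i; apply: measurable_funM.
- by move=> i s; rewrite mulr_ge0.
Qed.

Definition wbox (A : 'I_n -> set R) (B : 'I_m -> set R) : set WG :=
  [set z | (forall i, A i (tnth z.1 i)) /\ (forall j, B j (tnth z.2 j))].

Lemma measurable_wbox A B : (forall i, measurable (A i : set Rm)) ->
  (forall j, measurable (B j : set Rm)) -> measurable (wbox A B).
Proof.
move=> mA mB.
rewrite (_ : wbox A B = (\bigcap_(i in [set: 'I_n]) ((fun z : WG => tnth z.1 i) @^-1` A i)) `&`
  (\bigcap_(j in [set: 'I_m]) ((fun z : WG => tnth z.2 j) @^-1` B j))); last first.
  apply/seteqP; split => z.
    by move=> [H1 H2]; split => i _ /=.
  by move=> [H1 H2]; split => i; [exact: H1|exact: H2].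
apply: measurableI; apply: fin_bigcap_measurable => // i _.
  rewrite -[X in measurable X]setTI.
  exact: (measurableT_comp (measurable_tnth i) measurable_fst).
rewrite -[X in measurable X]setTI.
exact: (measurableT_comp (measurable_tnth i) measurable_snd).
Qed.

Lemma indic_wboxE A B (z : WG) : (\1_(wbox A B) z =
  \prod_(i < n) \1_(A i) (tnth z.1 i : R) * \prod_(j < m) \1_(B j) (tnth z.2 j : R) :> R)%R.
Proof.
have [/[!inE] -[zA zB]|nz] := boolP (z \in wbox A B).
  rewrite indicE mem_set; last by split.
  by rewrite !big1 ?mulr1// => i _; rewrite indicE mem_set.
rewrite indicE (negbTE nz); apply/esym/eqP; rewrite mulf_eq0.
apply: contraNT nz; rewrite negb_or inE => /andP[/prodf_neq0 HA /prodf_neq0 HB].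
split => i; apply: contrapT => ni.
  by have := HA i isT; rewrite indicE memNset// eqxx.
by have := HB i isT; rewrite indicE memNset// eqxx.
Qed.

Lemma WG_measure_wbox A B (ca : 'I_n -> R) (cb : 'I_m -> R) :
  (forall i, measurable (A i : set Rm)) -> (forall j, measurable (B j : set Rm)) ->
  (forall i, leb (A i `&` cellI) = (ca i)%:E) -> (forall j, leb (B j) = (cb j)%:E) ->
  mu (wbox A B) = (\prod_(i < n) ca i * \prod_(j < m) cb j)%:E.
Proof.
move=> mA mB hca hcb.
have mW := measurable_wbox mA mB.
rewrite -(setIT (wbox A B)) -integral_indic// (eq_integral (fun z : WG =>
  (\prod_(i < n) \1_(A i) (tnth z.1 i : R) * \prod_(j < m) \1_(B j) (tnth z.2 j : R))%R%:E)).
  apply: (@integral_WG_prod (fun i s => \1_(A i) s) (fun j s => \1_(B j) s)) => //.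
  - by move=> i; apply: measurable_indic.
  - by move=> i; apply: measurable_indic.
  - move=> i; rewrite -hca -(setIT (_ `&` _)) -integral_indic//; last exact: measurableI.
    by apply: eq_integral => s _; rewrite indicI.
  - by move=> i; rewrite -hcb -[in RHS](setIT (B i)) -integral_indic//; exact: mB.
by move=> z _; rewrite indic_wboxE.
Qed.

Lemma sigma_finite_WG : sigma_finite setT mu.
Proof. exact: sigma_finite_product_measure1. Qed.

Lemma WG_measure_not_cell : mu [set z | ~ unit_cell z.1] = 0.
Proof.
rewrite (_ : [set z | _] = (~` (@unit_cell R n)) `*` setT); last first.
  by apply/seteqP; split => z /=; [|case].
have mC : measurable (~` @unit_cell R n) by exact: measurableC (@measurable_unit_cell R n).
apply: (etrans (product_measure1E _ _ mC measurableT)).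
by rewrite /= /torus_measure /mrestr setICl measure0 mul0e.
Qed.

Lemma WG_measure_gt0 : 0 < mu setT.
Proof.
rewrite (@lt_le_trans _ _ (mu (wbox (fun=> setT) (fun=> `[0%R, 1%R : R]%classic))))//.
  rewrite (@WG_measure_wbox _ _ (fun=> 1%R) (fun=> 1%R))//.
  - by rewrite !big1// mulr1.
  - by move=> i; rewrite setTI lebesgue_measure_cell.
  - by move=> j; rewrite lebesgue_measure_itv/= lte_fin ltr01 -?EFinN -?EFinD subr0.
by apply: le_measure; rewrite ?inE//; exact: measurable_wbox.
Qed.

Lemma WG_null_of_slabs (S : set WG) : measurable S ->
  (forall K : nat, mu (S `&` [set z | forall j, (`|(tnth z.2 j : R)| <= K%:R)%R]) = 0) ->
  mu S = 0.
Proof.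
move=> mS H; apply/negligibleP => //.
pose W (K : nat) := wbox (fun=> setT) (fun=> `[(- K%:R)%R : R, K%:R%R]%classic).
have WE K : S `&` [set z | forall j, (`|(tnth z.2 j : R)| <= K%:R)%R] = S `&` W K.
  apply/seteqP; split => z [Sz zK]; split => //.
    by split => // j; rewrite /= in_itv/= -ler_norml; exact: zK.
  by move=> j; have := zK.2 j; rewrite /= in_itv/= -ler_norml.
rewrite (_ : S = \bigcup_K (S `&` W K)).
  apply: negligible_bigcup => K; apply/negligibleP.
    by apply: measurableI => //; exact: measurable_wbox.
  by have := H K; rewrite WE.
apply/seteqP; split => z; last by case=> K _ [].
move=> Sz; exists (Num.bound (\sum_j `|(tnth z.2 j : R)|)%R) => //.
rewrite -WE; split => // j.
apply/ltW/(le_lt_trans _ (archi_boundP _)); last by rewrite sumr_ge0.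
by rewrite (bigD1 j)//= lerDl sumr_ge0.
Qed.

Let leb_slab (K : nat) : leb `[(- K%:R)%R : R, K%:R%R]%classic = (K%:R *+ 2 : R)%:E.
Proof.
rewrite lebesgue_measure_itv/= lte_fin -?EFinN -?EFinD opprK -mulr2n.
case: ifPn => // nK; congr EFin; apply/esym.
have : (K%:R <= 0 :> R)%R by move: nK; rewrite -leNgt; lra.
by rewrite lern0 => /eqP ->; rewrite mul0rn.
Qed.

Lemma measurable_hyperplane1 (i : 'I_n) (a : R) : measurable [set z : WG | tnth z.1 i = a].
Proof.
rewrite -[X in measurable X]setTI.
exact: (measurableT_comp (measurable_tnth i) measurable_fst measurableT
  (measurable_set1 (a : R))).
Qed.

Lemma measurable_hyperplane2 (j : 'I_m) (a : R) : measurable [set z : WG | tnth z.2 j = a].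
Proof.
rewrite -[X in measurable X]setTI.
exact: (measurableT_comp (measurable_tnth j) measurable_snd measurableT
  (measurable_set1 (a : R))).
Qed.

Lemma WG_measure_hyperplane1 (i : 'I_n) (a : R) : mu [set z | tnth z.1 i = a] = 0.
Proof.
have mS := measurable_hyperplane1 i a.
apply: WG_null_of_slabs => // K.
pose A k := if k == i then [set a] else [set: R].
pose B (j : 'I_m) := `[(- K%:R)%R : R, K%:R%R]%classic.
rewrite (_ : _ `&` _ = wbox A B); last first.
  apply/seteqP; split => z /= [H1 H2]; split.
  - by move=> k; rewrite /A; case: eqP => // ->.
  - by move=> j; rewrite /B /= in_itv/= -ler_norml.
  - by have := H1 i; rewrite /A eqxx.
  - by move=> j; have := H2 j; rewrite /B /= in_itv/= -ler_norml.
rewrite (@WG_measure_wbox A B (fun k => if k == i then 0 else 1)%R (fun=> K%:R *+ 2)%R).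
- by rewrite (bigD1 i)//= eqxx !mul0r.
- by move=> k; rewrite /A; case: ifP.
- by move=> j; exact: measurable_itv.
- move=> k; rewrite /A; case: ifP => _; last by rewrite setTI lebesgue_measure_cell.
  apply/eqP; rewrite eq_le measure_ge0 andbT.
  apply: (@le_trans _ _ (leb [set a])); last by rewrite lebesgue_measure_set1.
  by apply: le_measure; rewrite ?inE//; apply: measurableI.
- by move=> j; exact: leb_slab.
Qed.

Lemma WG_measure_hyperplane2 (j : 'I_m) (a : R) : mu [set z | tnth z.2 j = a] = 0.
Proof.
have mS := measurable_hyperplane2 j a.
apply: WG_null_of_slabs => // K.
pose A (k : 'I_n) := [set: R].
pose B k := (if k == j then [set a] else setT) `&` `[(- K%:R)%R : R, K%:R%R]%classic.
have mB k : measurable (B k : set Rm).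
  by apply: measurableI => //; case: ifP.
rewrite (_ : _ `&` _ = wbox A B); last first.
  apply/seteqP; split => z /= [H1 H2]; split => //.
  - by move=> k; rewrite /B; split; [case: eqP => // ->|rewrite /= in_itv/= -ler_norml].
  - by have := H2 j; rewrite /B eqxx => -[].
  - by move=> k; have [_] := H2 k; rewrite /= in_itv/= -ler_norml.
rewrite (@WG_measure_wbox A B (fun=> 1)%R (fun k => if k == j then 0 else K%:R *+ 2)%R)//.
- by rewrite [X in (_ * X)%R](bigD1 j)//= eqxx mul0r mulr0.
- by move=> k; exact: measurableT.
- by move=> k; rewrite /A setTI lebesgue_measure_cell.
- move=> k; rewrite /B; case: ifP => _; last by rewrite setTI leb_slab.
  apply/eqP; rewrite eq_le measure_ge0 andbT.
  apply: (@le_trans _ _ (leb [set a])); last by rewrite lebesgue_measure_set1.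
  by apply: le_measure; rewrite ?inE//; apply: measurableI.
Qed.

End waveguide_integrals.

(** * Shifted dyadic grids *)

Section shifted_grids.
Context (R : realType).
Implicit Types x w u v : R.

Lemma floor_dyadic_nested k x w :
  Num.floor (2 ^+ k.+1 * x) = Num.floor (2 ^+ k.+1 * w) ->
  Num.floor (2 ^+ k * x) = Num.floor (2 ^+ k * w).
Proof.
rewrite exprS -!mulrA; set a := 2 ^+ k * x; set b := 2 ^+ k * w => ab.
apply/eqP; rewrite eq_sym floor_eq.
have dblE (q : int) : (2 * q%:~R : R) = (2 * q)%:~R by rewrite intrM.
have := floor_itv a; set q := Num.floor a => /andP[qa aq].
have h1 : 2 * q <= Num.floor (2 * b) by rewrite -ab floor_ge_int -dblE; lra.
have h2 : Num.floor (2 * b) < 2 * (q + 1) by rewrite -ab floor_lt_int -dblE; lra.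
by move: h1 h2; rewrite floor_ge_int floor_lt_int -!dblE; lra.
Qed.

Lemma floor_neq_sep u v : Num.floor u <> Num.floor v ->
  exists a : int, u < a%:~R <= v \/ v < a%:~R <= u.
Proof.
move=> /eqP; rewrite neq_lt => /orP[uv|vu].
  by exists (Num.floor v); left; rewrite floor_le -floor_lt_int uv.
by exists (Num.floor u); right; rewrite floor_le -floor_lt_int vu.
Qed.

(* 1/3 is never closer than 2^-k/3 to a dyadic number of level k, so an        *)
(* interval of length < 2^-k/3 cannot meet endpoints of both grids.            *)
Lemma floor_shift_third k x w : `|x - w| < (2 ^+ k)^-1 / 3 ->
  Num.floor (2 ^+ k * x) = Num.floor (2 ^+ k * w) \/
  Num.floor (2 ^+ k * (x - 1 / 3)) = Num.floor (2 ^+ k * (w - 1 / 3)).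
Proof.
set D : R := 2 ^+ k => xw; have D0 : 0 < D by rewrite exprn_gt0.
apply: contrapT => /not_orP[/floor_neq_sep[a Ha] /floor_neq_sep[b Hb]].
have {}xw : `|D * x - D * w| < 1 / 3.
  by rewrite -mulrBr normrM gtr0_norm// -ltr_pdivlMl// mul1r.
move: xw Ha Hb; rewrite ltr_norml !mulrBr => /andP[xw1 xw2] Ha Hb.
have : `|3 * (a - b)%:~R - D| < 1.
  rewrite ltr_norml intrB; case: Ha Hb => /andP[Ha1 Ha2] [] /andP[Hb1 Hb2];
  apply/andP; split; lra.
have -> : 3 * (a - b)%:~R - D = (3 * (a - b) - (2 ^ k)%N%:Z)%:~R.
  by rewrite [in RHS]intrB [in RHS]intrM; congr (_ - _); rewrite /D -natrX.
rewrite -intr_norm ltrz1 -[X in _ < X]add0r ltzD1 normr_le0 subr_eq0 => /eqP E.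
have := congr1 absz E; rewrite abszM /= => E'.
have : (3 %| 2 ^ k)%N by rewrite -E' dvdn_mulr.
by rewrite Euclid_dvdX.
Qed.
End shifted_grids.

Section waveguide_grids.
Context (R : realType) (n m : nat).
Local Notation Rm := (measurableTypeR R).
Local Notation WG := (waveguide R n m).
Local Notation mu := (WG_measure R n m).
Local Notation shift := (n.-tuple bool * m.-tuple bool)%type.
Local Notation code := (n.-tuple int * m.-tuple int)%type.

Definition grid_code (al : shift) (k : nat) (z : WG) : code :=
  ([tuple Num.floor (2 ^+ k * ((tnth z.1 i : R) - (tnth al.1 i)%:R / 3)) | i < n],
   [tuple Num.floor (2 ^+ k * ((tnth z.2 j : R) - (tnth al.2 j)%:R / 3)) | j < m]).

Definition cell_bound (k : nat) : R := ((2 ^+ k)^-1) ^+ (n + m).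

Definition near_box (rho : R) (z w : WG) : Prop :=
  (forall i, `|(tnth z.1 i : R) - tnth w.1 i| < rho) /\
  (forall j, `|(tnth z.2 j : R) - tnth w.2 j| < rho).

Lemma cell_bound_gt0 k : 0 < cell_bound k.
Proof. by rewrite exprn_gt0// invr_gt0 exprn_gt0. Qed.

Let grid_itv (k : nat) (b : bool) (q : int) : set R :=
  `[(2 ^+ k)^-1 * q%:~R + b%:R / 3, (2 ^+ k)^-1 * (q + 1)%:~R + b%:R / 3[%classic.

Let grid_itvP k (b : bool) q (s : R) :
  Num.floor (2 ^+ k * (s - b%:R / 3)) = q <-> grid_itv k b q s.
Proof.
have D0 : 0 < 2 ^+ k :> R by rewrite exprn_gt0.
rewrite /grid_itv /= in_itv /= -lerBrDr -ltrBlDr [_^-1 * _]mulrC [_^-1 * _]mulrC.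
by rewrite ler_pdivrMr// ltr_pdivlMr// [_ * 2 ^+ k]mulrC -floor_eq; split => /eqP.
Qed.

Lemma grid_cellE al k q : [set z | grid_code al k z = q] =
  wbox (fun i => grid_itv k (tnth al.1 i) (tnth q.1 i))
       (fun j => grid_itv k (tnth al.2 j) (tnth q.2 j)).
Proof.
apply/seteqP; split => z /=.
  move=> <-; split => i /=; apply/grid_itvP; by rewrite tnth_mktuple.
case: q => q1 q2 [H1 H2]; congr (_, _); apply: eq_from_tnth => i; rewrite tnth_mktuple; apply/grid_itvP.
  exact: H1.
exact: H2.
Qed.

Lemma measurable_grid_cell al k q : measurable [set z | grid_code al k z = q].
Proof. by rewrite grid_cellE; apply: measurable_wbox => i; exact: measurable_itv. Qed.

Lemma grid_code_nested al k z w :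
  grid_code al k.+1 z = grid_code al k.+1 w -> grid_code al k z = grid_code al k w.
Proof.
move=> E; have E1 := congr1 fst E; have E2 := congr1 snd E.
congr (_, _); apply: eq_from_tnth => i; rewrite !tnth_mktuple;
  apply: floor_dyadic_nested.
- by have := congr1 (fun t : n.-tuple int => tnth t i) E1; rewrite !tnth_mktuple.
- by have := congr1 (fun t : m.-tuple int => tnth t i) E2; rewrite !tnth_mktuple.
Qed.

Local Open Scope ereal_scope.

Let leb_grid_itv k b q : @lebesgue_measure R (grid_itv k b q) = ((2 ^+ k)^-1)%R%:E.
Proof.
rewrite lebesgue_measure_itv/= lte_fin ltrD2r.
have D0 : (0 < (2 ^+ k)^-1 :> R)%R by rewrite invr_gt0 exprn_gt0.
rewrite ltr_pM2l// ltr_int ltrDl ltr01 -?EFinN -?EFinD; congr (_%:E).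
rewrite intrD; lra.
Qed.

Lemma measure_grid_cell_le al k q :
  mu [set z | grid_code al k z = q] <= (cell_bound k)%:E.
Proof.
rewrite grid_cellE.
set A := fun i => grid_itv k (tnth al.1 i) (tnth q.1 i).
have mA i : measurable (A i : set Rm) by exact: measurable_itv.
have leA i : @lebesgue_measure R (A i `&` `[(- 2^-1)%R : R, 2^-1%R[%classic) <= ((2 ^+ k)^-1)%R%:E.
  rewrite -(leb_grid_itv k (tnth al.1 i) (tnth q.1 i)).
  apply: le_measure; rewrite ?inE; [|exact: mA|by move=> ? []].
  by apply: measurableI.
have fA i : @lebesgue_measure R (A i `&` `[(- 2^-1)%R : R, 2^-1%R[%classic) \is a fin_num.
  by rewrite ge0_fin_numE//; apply: le_lt_trans (leA i) _; exact: ltry.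
have cA i : @lebesgue_measure R (A i `&` `[(- 2^-1)%R : R, 2^-1%R[%classic) =
    (fine (@lebesgue_measure R (A i `&` `[(- 2^-1)%R : R, 2^-1%R[%classic)))%:E.
  by rewrite fineK.
rewrite (WG_measure_wbox mA _ cA (fun j => leb_grid_itv _ _ _)); last first.
  by move=> j; exact: measurable_itv.
rewrite lee_fin /cell_bound exprD; apply: ler_pM.
- by apply: prodr_ge0 => i _; exact: fine_ge0.
- by apply: prodr_ge0 => i _; rewrite invr_ge0.
- rewrite -[n in leRHS]card_ord -prodr_const; apply: ler_prod => i _.
  by rewrite fine_ge0//= -lee_fin fineK.
- by rewrite prodr_const card_ord.
Qed.

Lemma near_box_code k z w : near_box ((2 ^+ k)^-1 / 3) z w ->
  exists al, grid_code al k z = grid_code al k w.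
Proof.
move=> [H1 H2].
pose b (x y : R) := ~~ (Num.floor (2 ^+ k * x) == Num.floor (2 ^+ k * y)).
have bP x y : (`|x - y| < (2 ^+ k)^-1 / 3)%R ->
    Num.floor (2 ^+ k * (x - (b x y)%:R / 3))%R = Num.floor (2 ^+ k * (y - (b x y)%:R / 3))%R.
  rewrite /b => /floor_shift_third; case: eqP => [E _|nE [//|]] /=.
    by rewrite !mul0r !subr0.
  by [].
exists ([tuple b (tnth z.1 i) (tnth w.1 i) | i < n], [tuple b (tnth z.2 j) (tnth w.2 j) | j < m]).
by congr (_, _); apply: eq_from_tnth => i; rewrite !tnth_mktuple; apply: bP.
Qed.

End waveguide_grids.

Section waveguide_maximal.
Context (R : realType) (n m : nat).
Local Notation WG := (waveguide R n m).
Local Notation mu := (WG_measure R n m).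
Local Notation shift := (n.-tuple bool * m.-tuple bool)%type.
Local Open Scope ereal_scope.

Definition grid_maximal (al : shift) (F : WG -> R) : WG -> \bar R :=
  cell_maximal mu (grid_code al) (cell_bound R n m) (EFin \o F).

(* The integral of [F] accounts for the part of the heat kernel away from the  *)
(* diagonal, on which it is bounded.                                           *)
Definition wg_maximal (F : WG -> R) z : \bar R :=
  \int[mu]_w (F w)%:E + \sum_(al : shift) grid_maximal al F z.

Definition nonneg_measurable (F : WG -> R) :=
  measurable_fun setT F /\ forall z, (0 <= F z)%R.
Local Notation adm := nonneg_measurable.

Let average_ge0 al k F z : (forall w, (0 <= F w)%R) ->
  0 <= cell_average mu (grid_code al) (cell_bound R n m) k (EFin \o F) z.
Proof.
move=> F0; apply: mule_ge0; first by rewrite lee_fin invr_ge0 ltW ?cell_bound_gt0.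
by apply: integral_ge0 => w _; rewrite lee_fin.
Qed.

Lemma grid_maximal_ge0 al F z : (forall w, (0 <= F w)%R) -> 0 <= grid_maximal al F z.
Proof.
by move=> F0; apply: le_trans (cell_maximal_ge _ _ _ 0%N _ _); exact: average_ge0.
Qed.

Lemma wg_maximal_ge0 F z : (forall w, (0 <= F w)%R) -> 0 <= wg_maximal F z.
Proof.
move=> F0; apply: adde_ge0; first by apply: integral_ge0 => w _; rewrite lee_fin.
by apply: sume_ge0 => al _; exact: grid_maximal_ge0.
Qed.

Lemma measurable_grid_maximal al F : measurable_fun setT (grid_maximal al F).
Proof. by apply: measurable_cell_maximal => k q; exact: measurable_grid_cell. Qed.

Lemma measurable_wg_maximal F : measurable_fun setT (wg_maximal F).
Proof.
apply: emeasurable_funD => //; apply: emeasurable_sum => al.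
exact: measurable_grid_maximal.
Qed.

Let integral_comb (D : set WG) F G (k : R) : measurable D -> adm F -> adm G -> (0 <= k)%R ->
  \int[mu]_(w in D) (F w + k * G w)%:E =
  \int[mu]_(w in D) (F w)%:E + k%:E * \int[mu]_(w in D) (G w)%:E.
Proof.
move=> mD [mF F0] [mG G0] k0; under eq_integral do rewrite EFinD EFinM.
rewrite ge0_integralD//; first last.
- by apply: measurable_funTS; apply: measurable_funeM; exact/measurable_EFinP.
- by move=> w _; rewrite mule_ge0 ?lee_fin.
- by apply: measurable_funTS; exact/measurable_EFinP.
- by move=> w _; rewrite lee_fin.
rewrite ge0_integralZl//.
- by apply: measurable_funTS; exact/measurable_EFinP.
- by move=> w _; rewrite lee_fin.
Qed.

Lemma wg_maximal_sub F G (k : R) z : adm F -> adm G -> (0 <= k)%R ->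
  wg_maximal (fun w => F w + k * G w)%R z <= wg_maximal F z + k%:E * wg_maximal G z.
Proof.
move=> aF aG k0; have [mF F0] := aF; have [mG G0] := aG.
have gm0 al : 0 <= grid_maximal al G z by exact: grid_maximal_ge0.
have gs0 : 0 <= \sum_(al : shift) grid_maximal al G z by exact: sume_ge0.
have i0 : 0 <= \int[mu]_w (G w)%:E by apply: integral_ge0 => w _; rewrite lee_fin.
rewrite /wg_maximal ge0_muleDr// addeACA.
apply: leeD; first by rewrite integral_comb.
rewrite ge0_sume_distrr// -big_split /=; apply: lee_sum => al _.
apply: ge_ereal_sup => _ [j _ <-].
rewrite /cell_average /= integral_comb//; last exact: measurable_grid_cell.
rewrite ge0_muleDr; first last.
- by rewrite mule_ge0 ?lee_fin//; apply: integral_ge0 => w _; rewrite lee_fin.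
- by apply: integral_ge0 => w _; rewrite lee_fin.
apply: leeD; first exact: (cell_maximal_ge _ _ _ j).
rewrite muleCA lee_wpmul2l ?lee_fin//; exact: (cell_maximal_ge _ _ _ j).
Qed.

Lemma wg_maximal_le_off_null (Z : set WG) F G z : measurable Z -> mu Z = 0 ->
  (forall w, (0 <= F w)%R) -> (forall w, (0 <= G w)%R) ->
  (forall w, ~ Z w -> (F w <= G w)%R) -> wg_maximal F z <= wg_maximal G z.
Proof.
move=> mZ Z0 F0 G0 FG; apply: leeD.
  by apply: (le_integral_off_null mZ Z0) => w; rewrite lee_fin//; exact: FG.
apply: lee_sum => al _; apply: ge_ereal_sup => _ [j _ <-].
apply: le_trans (cell_maximal_ge _ _ _ j _ _).
rewrite /cell_average lee_wpmul2l ?lee_fin ?invr_ge0 ?(ltW (cell_bound_gt0 _ _ _ _))//.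
rewrite [leLHS]ge0_integral_restrict_indic [leRHS]ge0_integral_restrict_indic.
apply: (le_integral_off_null mZ Z0) => w; rewrite lee_fin ?mulr_ge0// => nZ.
by rewrite ler_wpM2r// FG.
Qed.

Lemma wg_maximalZ_le G (k : R) z : adm G -> (0 <= k)%R ->
  wg_maximal (fun w => k * G w)%R z <= k%:E * wg_maximal G z.
Proof.
move=> aG k0; have a0 : adm (fun=> 0%R) by [].
have := wg_maximal_sub z a0 aG k0.
rewrite (_ : (fun w => _) = (fun w => k * G w)%R); last by apply/funext => w; rewrite add0r.
move/le_trans; apply; rewrite [X in X + _](_ : _ = 0) ?add0e// /wg_maximal.
rewrite integral0 add0e big1// => al _; apply/eqP; rewrite eq_le grid_maximal_ge0// andbT.
by apply: ge_ereal_sup => _ [j _ <-]; rewrite /cell_average integral0 mule0.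
Qed.

Lemma grid_maximal_weak al F (lam : R) : adm F -> (0 < lam)%R ->
  lam%:E * mu [set z | lam%:E < grid_maximal al F z] <= \int[mu]_z (F z)%:E.
Proof.
move=> [mF F0] lam0; apply: cell_maximal_weak => //.
- exact: cell_bound_gt0.
- by move=> k q; exact: measurable_grid_cell.
- by move=> k z w; exact: grid_code_nested.
- by move=> k q; exact: measure_grid_cell_le.
- exact/measurable_EFinP.
Qed.

Lemma wg_maximal_fin F : adm F -> \int[mu]_z (F z)%:E < +oo ->
  exists Z, [/\ measurable Z, mu Z = 0 & forall z, ~ Z z -> wg_maximal F z < +oo].
Proof.
move=> aF Fy; have [mF F0] := aF.
have I0 : 0 <= \int[mu]_z (F z)%:E by apply: integral_ge0 => w _; rewrite lee_fin.
pose Z al := [set z | grid_maximal al F z = +oo].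
have mZ al : measurable (Z al).
  rewrite -[X in measurable X]setTI.
  exact: (measurable_grid_maximal al F measurableT (emeasurable_set1 _)).
exists (\big[setU/set0]_(al : shift) Z al); split.
- by apply: bigsetU_measurable => al _.
- apply: measure_bigsetU_null => // al; apply/eqP; rewrite eq_le measure_ge0 andbT.
  apply/lee_addgt0Pr => e e0; rewrite add0e.
  set I := \int[mu]_z (F z)%:E in Fy I0.
  have Ifin : I \is a fin_num by rewrite ge0_fin_numE.
  have fI0 : (0 <= fine I)%R by rewrite fine_ge0.
  have fI1 : (0 < fine I + 1)%R by rewrite ltr_wpDl.
  have l0 : (0 < (fine I + 1) / e)%R by rewrite divr_gt0.
  have : ((fine I + 1) / e)%:E * mu (Z al) <= I.
    apply: le_trans (grid_maximal_weak al aF l0).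
    rewrite lee_pmul2l//; apply: le_measure; rewrite ?inE//.
      rewrite -[X in measurable X]setTI; apply: emeasurable_fun_o_infty => //.
      exact: measurable_grid_maximal.
    by move=> z /= ->; exact: ltry.
  rewrite -lee_pdivlMl// => /le_trans; apply.
  rewrite -(fineK Ifin) -EFinM lee_fin invf_div mulrAC ler_pdivrMr//.
  by rewrite ler_wpM2l ?(ltW e0)// lerDl.
move=> z nZ; rewrite /wg_maximal lte_add_pinfty//.
apply: lte_sum_pinfty => al _; rewrite ltey; apply: contra_notN nZ => /eqP gy.
by rewrite (bigD1 al)//=; left.
Qed.

Lemma wg_maximal_weak (kappa : WG -> R) : measurable_fun setT kappa ->
  (forall z, (0 <= kappa z <= 1)%R) -> \int[mu]_z (kappa z)%:E < +oo ->
  exists2 C : R, (0 <= C)%R & forall F (lam : R), adm F -> (0 < lam)%R ->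
    lam%:E * \int[mu]_(z in [set z | lam%:E < wg_maximal F z]) (kappa z)%:E
      <= C%:E * \int[mu]_z (F z)%:E.
Proof.
move=> mk k01 ky.
pose N := #|[the finType of shift]|; pose K : R := (N.+1%:R)%R.
have k0 z : (0 <= kappa z)%R by case/andP: (k01 z).
have k1 z : (kappa z <= 1)%R by case/andP: (k01 z).
have ik0 : 0 <= \int[mu]_z (kappa z)%:E by apply: integral_ge0 => w _; rewrite lee_fin.
exists (K * (fine (\int[mu]_z (kappa z)%:E) + N%:R))%R.
  by rewrite mulr_ge0// addr_ge0// fine_ge0.
move=> F lam aF lam0; have [mF F0] := aF.
have kfin : \int[mu]_z (kappa z)%:E \is a fin_num by rewrite ge0_fin_numE.
set I := \int[mu]_z (F z)%:E.
have I0 : 0 <= I by apply: integral_ge0 => w _; rewrite lee_fin.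
set fk := fine _; have fk0 : (0 <= fk)%R by rewrite fine_ge0.
have K0 : (0 < K)%R by rewrite ltr0n.
have lK0 : (0 < lam / K)%R by rewrite divr_gt0.
have lamE : lam%:E = K%:E * (lam / K)%:E.
  by rewrite -EFinM mulrC divfK ?gt_eqF.
rewrite integral_mkcond; have [FK|FK] := ltP (lam / K)%:E I.
  apply: (@le_trans _ _ (lam%:E * fk%:E)).
    rewrite lee_pmul2l// /fk fineK//; apply: le_integral_nomeas => z.
      by rewrite patchE; case: ifP => // _; rewrite lee_fin.
    by rewrite patchE; case: ifP => // _; rewrite lee_fin.
  apply: (@le_trans _ _ ((K * fk)%:E * I)).
    have -> : (K * fk)%:E * I = K%:E * (I * fk%:E).
      by rewrite EFinM -muleA [fk%:E * _]muleC.
    rewrite lamE -muleA lee_pmul2l//.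
    by rewrite lee_wpmul2r ?lee_fin// ltW.
  by rewrite lee_wpmul2r// lee_fin ler_wpM2l ?(ltW K0)// lerDl.
pose S al := [set z | (lam / K)%:E < grid_maximal al F z].
have mS al : measurable (S al).
  rewrite -[X in measurable X]setTI; apply: emeasurable_fun_o_infty => //.
  exact: measurable_grid_maximal.
apply: (@le_trans _ _ (lam%:E * \sum_(al : shift) mu (S al))).
  rewrite lee_pmul2l//.
  have -> : \sum_(al : shift) mu (S al) = \int[mu]_z \sum_(al : shift) (\1_(S al) z)%:E.
    rewrite ge0_integral_sum//.
      by apply: eq_bigr => al _; rewrite integral_indic// setIT.
    by move=> al; apply/measurable_EFinP.
  apply: le_integral_nomeas => z.
    by rewrite patchE; case: ifP => // _; rewrite lee_fin.
  rewrite patchE; case: ifPn => [|_]; last by apply: sume_ge0 => al _; rewrite lee_fin.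
  rewrite inE /= => zS.
  have [al alS] : exists al, S al z.
    apply: contrapT => /forallNP nS; move: zS; apply/negP; rewrite -leNgt.
    apply: (@le_trans _ _ ((lam / K)%:E + \sum_(al : shift) (lam / K)%:E)).
      apply: leeD => //; apply: lee_sum => al _; rewrite leNgt; apply/negP; exact: nS.
    rewrite sumEFin sumr_const -EFinD lee_fin -mulrS.
    by rewrite -[X in (_ <= X)%R](divfK (lt0r_neq0 K0)) -mulr_natr.
  apply: (@le_trans _ _ (\1_(S al) z)%:E).
    by rewrite indicE (mem_set alS) lee_fin k1.
  rewrite (bigD1 al isT) /=.
  by apply: leeDl; apply: sume_ge0 => be _; rewrite lee_fin.
rewrite ge0_sume_distrr//.
apply: (@le_trans _ _ (\sum_(al : shift) K%:E * I)).
  apply: lee_sum => al _; rewrite lamE -muleA lee_pmul2l//.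
  exact: grid_maximal_weak.
rewrite -ge0_sume_distrl; last by move=> al _; rewrite lee_fin ltW.
rewrite lee_wpmul2r// sumEFin lee_fin sumr_const -[leLHS]mulr_natr.
by rewrite ler_wpM2l ?(ltW K0)// lerDr.
Qed.

Let near_itv (rho a : R) : set R := `](a - rho)%R, (a + rho)%R[%classic.

Lemma near_boxE (rho : R) (z : WG) : [set w : WG | near_box rho z w] =
  wbox (fun i => near_itv rho (tnth z.1 i)) (fun j => near_itv rho (tnth z.2 j)).
Proof.
by apply/seteqP; split => w [H1 H2]; split => i /=;
  [have := H1 i|have := H2 i|have := H1 i|have := H2 i];
  rewrite /near_itv /= in_itv/= -ltr_distlC.
Qed.

Lemma measurable_near_box (rho : R) z : measurable [set w : WG | near_box rho z w].
Proof. by rewrite near_boxE; apply: measurable_wbox => i; exact: measurable_itv. Qed.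

Lemma integral_near_box_le F k z : adm F ->
  \int[mu]_(w in [set w | near_box ((2 ^+ k)^-1 / 3) z w]) (F w)%:E <=
  (cell_bound R n m k)%:E * wg_maximal F z.
Proof.
move=> [mF F0]; set D := (X in integral _ X).
pose C (al : shift) := [set w : WG | grid_code al k w = grid_code al k z].
have mC al : measurable (C al) by exact: measurable_grid_cell.
apply: (@le_trans _ _ (\sum_(al : shift) \int[mu]_(w in C al) (F w)%:E)).
  rewrite ge0_integral_restrict_indic.
  under eq_bigr do rewrite ge0_integral_restrict_indic.
  rewrite -ge0_integral_sum//; first last.
  - by move=> al w _; rewrite lee_fin mulr_ge0.
  - by move=> al; apply/measurable_EFinP; apply: measurable_funM.
  apply: le_integral_nomeas => w; first by rewrite lee_fin mulr_ge0.
  rewrite indicE; have [|_] := boolP (w \in D); last first.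
    by rewrite mulr0; apply: sume_ge0 => al _; rewrite lee_fin mulr_ge0.
  rewrite inE => /near_box_code[al alE].
  rewrite (bigD1 al)//= indicE mem_set// -[leLHS]adde0 leeD//.
  by apply: sume_ge0 => be _; rewrite lee_fin mulr_ge0.
have c0 := cell_bound_gt0 R n m k.
apply: (@le_trans _ _ (\sum_(al : shift) (cell_bound R n m k)%:E * grid_maximal al F z)).
  apply: lee_sum => al _; rewrite -lee_pdivrMl//.
  exact: (cell_maximal_ge _ _ _ k (EFin \o F) z).
rewrite -ge0_sume_distrr; last by move=> al _; exact: grid_maximal_ge0.
rewrite lee_pmul2l// leeDr//; apply: integral_ge0 => w _; by rewrite lee_fin.
Qed.

End waveguide_maximal.

(** * Heat kernel bounds *)

Section lattice_sums.
Context (R : realType).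
Local Open Scope ereal_scope.

Lemma esum_nneseries (T : countType) (a : T -> \bar R) : (forall k, 0 <= a k) ->
  \esum_(k in [set: T]) a k =
  \sum_(i <oo) (if pickle_inv i is Some k then a k else 0).
Proof.
move=> a0; pose b i := if pickle_inv i is Some k then a k else 0 : \bar R.
rewrite nneseries_esumT; last by move=> i; case: pickle_inv => [k|].
rewrite -/b (_ : [set: nat] = range (@pickle T) `|` ~` range (@pickle T)); last by rewrite setUv.
rewrite -[LHS](_ : \esum_(i in range (@pickle T)) b i = _); last first.
  rewrite esum_image; last by move=> x y _ _; exact: (pcan_inj pickleK_inv).
  by apply: eq_esum => k _; rewrite /b pickleK_inv.
rewrite setUv [LHS]esum_mkcond; apply: eq_esum => i _.
case: ifPn => //; rewrite notin_setE => ni; rewrite /b.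
case E : (pickle_inv i) => [k|//]; exfalso; apply: ni; exists k => //.
by have := pickle_invK (T := T) i; rewrite E.
Qed.

Lemma ge0_esumZl (T : countType) (c : R) (a : T -> \bar R) : (forall k, 0 <= a k) ->
  (0 <= c)%R ->
  \esum_(k in [set: T]) (c%:E * a k) = c%:E * \esum_(k in [set: T]) a k.
Proof.
move=> a0 c0; rewrite !esum_nneseries//; last by move=> k; rewrite mule_ge0.
rewrite -nneseriesZl; last by move=> i _; case: pickle_inv.
by apply: eq_eseriesr => i _; case: pickle_inv => // ; rewrite mule0.
Qed.

Lemma measurable_esum d (T : measurableType d) (I : countType) (f : I -> T -> \bar R) :
  (forall k, measurable_fun setT (f k)) -> (forall k z, 0 <= f k z) ->
  measurable_fun setT (fun z => \esum_(k in [set: I]) f k z).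
Proof.
move=> mf f0.
apply: (eq_measurable_fun (fun z => \sum_(i <oo) (if @pickle_inv I i is Some k then f k z else 0))).
  by move=> z _; rewrite esum_nneseries.
apply: ge0_emeasurable_sum => [i z _ _|i _]; by case: pickle_inv.
Qed.

Definition lattice_weight (j : int) : R := expR ((2 - `|j|%N%:R) / 4).

Lemma esum_lattice_weight : exists c : R,
  \esum_(j in [set: int]) (lattice_weight j)%:E <= c%:E.
Proof.
pose e : R := expR (- 4^-1).
have e0 : (0 < e)%R by exact: expR_gt0.
have e1 : (e < 1)%R by rewrite expR_lt1; lra.
have wE (j : int) : lattice_weight j = (expR (2 / 4) * e ^+ `|j|%N)%R.
  by rewrite /lattice_weight -expRM_natl -expRD; congr expR; field.
have half (f : nat -> int) : (forall k, (k <= `|f k|)%N) ->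
    \esum_(k in [set: nat]) (lattice_weight (f k))%:E <= (expR (2 / 4) / (1 - e))%:E.
  move=> fk; rewrite -nneseries_esumT; last by move=> k; rewrite lee_fin expR_ge0.
  apply: lime_le; first by apply: is_cvg_nneseries => k _ _; rewrite lee_fin expR_ge0.
  apply: nearW => N; rewrite sumEFin lee_fin.
  apply: (@le_trans _ _ (\sum_(0 <= k < N) expR (2 / 4) * e ^+ k)%R).
    apply: ler_sum => k _; rewrite wE ler_wpM2l ?expR_ge0// ler_wiXn2l ?(ltW e0) ?(ltW e1)//.
  rewrite -big_distrr/= ler_wpM2l ?expR_ge0// big_mkord.
  have de : (0 < 1 - e)%R by rewrite subr_gt0.
  rewrite -[leRHS]mul1r ler_pdivlMr// -opprB mulrN mulrC -subrX1 opprB gerBl exprn_ge0// ltW//.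
exists (expR (2 / 4) / (1 - e) + expR (2 / 4) / (1 - e))%R.
rewrite (esumID (range Posz)); last by move=> j _; rewrite lee_fin expR_ge0.
rewrite EFinD; apply: leeD.
  rewrite setTI esum_image; last by move=> x y _ _ [].
  exact: half.
apply: (@le_trans _ _ (\esum_(j in range Negz) (lattice_weight j)%:E)).
  apply: le_ereal_sup => _ [X [finX XI] <-]; exists X => //; split => // j /XI [_].
  by case: j => k nk; [exfalso; apply: nk; exists k|exists k].
rewrite esum_image; last by move=> x y _ _ [].
exact: half.
Qed.

Lemma esum_lattice_weight_tuple n : exists c : R,
  \esum_(k in [set: n.-tuple int]) (\prod_(i < n) lattice_weight (tnth k i))%:E <= c%:E.
Proof.
have [c0 Hc0] := esum_lattice_weight.
elim: n => [|n [c Hc]].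
  exists 1%R; rewrite (_ : setT = [set [tuple]]); last first.
    by apply/seteqP; split => // k _; rewrite [k]tuple0.
  by rewrite esum_set1 ?big_ord0.
have p0 N (k : N.-tuple int) : 0 <= (\prod_(i < N) lattice_weight (tnth k i))%:E.
  by rewrite lee_fin prodr_ge0// => i _; exact: expR_ge0.
exists (c0 * c)%R.
pose cons_pair (a : int * n.-tuple int) : n.+1.-tuple int := [tuple of a.1 :: a.2].
rewrite (@reindex_esum _ _ _ ([set: int] `*`` (fun=> [set: n.-tuple int])) _ cons_pair); last first.
  split => //.
  - by move=> [a x] [b y] _ _ /(congr1 val) [-> /val_inj ->].
  - move=> k _; exists (thead k, [tuple of behead k]) => //.
    by rewrite /cons_pair /= [RHS]tuple_eta.
have factor j k : (\prod_(i < n.+1) lattice_weight (tnth (cons_pair (j, k)) i) =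
    lattice_weight j * \prod_(i < n) lattice_weight (tnth k i))%R.
  rewrite big_ord_recl; congr (_ * _)%R; apply: eq_bigr => i _.
  by rewrite tnthS; congr (lattice_weight (tnth _ _)); exact/val_inj.
rewrite (_ : esum _ _ = \esum_(j in [set: int]) \esum_(k in [set: n.-tuple int])
    ((lattice_weight j)%:E * (\prod_(i < n) lattice_weight (tnth k i))%:E)); last first.
  rewrite esum_esum; last by move=> j k _ _; rewrite mule_ge0// lee_fin expR_ge0.
  by apply: eq_esum => -[j k] _; rewrite factor EFinM.
have c_ge0 : (0 <= c)%R.
  by rewrite -lee_fin; apply: le_trans Hc; exact: esum_ge0.
apply: (@le_trans _ _ (\esum_(j in [set: int]) (c%:E * (lattice_weight j)%:E))).
  apply: le_esum => j _; rewrite ge0_esumZl ?expR_ge0// muleC.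
  by rewrite lee_wpmul2r// lee_fin expR_ge0.
rewrite ge0_esumZl//; last by move=> j; rewrite lee_fin expR_ge0.
by rewrite mulrC EFinM lee_wpmul2l ?lee_fin.
Qed.
End lattice_sums.

Section gaussian_majorants.
Context (R : realType) (n m : nat).
Local Notation WG := (waveguide R n m).
Local Notation mu := (WG_measure R n m).
Local Notation d := (n + m)%N.
Implicit Types (t : R) (z w : WG).

Definition amplitude t : R := (4 * pi * t) `^ (- (d%:R / 2)).

Definition dist2 z w : R := sqnorm (tsub z.1 w.1) + sqnorm (tsub z.2 w.2).

(* [gauss 4] is the term of index 0 of the heat kernel. *)
Definition gauss (a t : R) z w : R := amplitude t * expR (- (dist2 z w / (a * t))).

Let two2 : 2 ^+ 2 = 4 :> R. Proof. by rewrite -natrX. Qed.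

Lemma sqnorm_ge0 k (x : k.-tuple R) : 0 <= sqnorm x.
Proof. by apply: sumr_ge0 => i _; exact: sqr_ge0. Qed.

Lemma dist2_ge0 z w : 0 <= dist2 z w.
Proof. by rewrite addr_ge0 ?sqnorm_ge0. Qed.

Lemma amplitude_ge0 t : 0 <= amplitude t.
Proof. exact: powR_ge0. Qed.

Lemma gauss_ge0 a t z w : 0 <= gauss a t z w.
Proof. by rewrite mulr_ge0 ?amplitude_ge0 ?expR_ge0. Qed.

Lemma expRN_le_pow (u : R) k : 0 < u -> expR (- u) <= (k.+1)`!%:R / u ^+ k.+1.
Proof.
move=> u0; rewrite expRN -[leRHS]invf_div lef_pV2 ?posrE ?expR_gt0//; last first.
  by rewrite divr_gt0 ?exprn_gt0// ltr0n fact_gt0.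
by apply: le_trans (expR_ge1Dxn k (ltW u0)); rewrite lerDr.
Qed.

Lemma amplitude_le_dyadic K t : (4 ^+ K)^-1 <= t -> amplitude t <= 2 ^+ (K * d).
Proof.
move=> Kt.
have K0 : 0 < (4 ^+ K)^-1 :> R by rewrite invr_gt0 exprn_gt0.
have t0 : 0 < t by exact: lt_le_trans Kt.
have le1 : (4 ^+ K)^-1 <= 4 * pi * t.
  apply: (le_trans Kt); rewrite -[leLHS]mul1r ler_wpM2r ?(ltW t0)//.
  have := pi_ge2 R; lra.
have -> : 2 ^+ (K * d) = ((4 ^+ K)^-1) `^ (- (d%:R / 2)) :> R.
  rewrite -[(4 ^+ K)^-1]powR_inv1 ?exprn_ge0// -powRrM mulN1r opprK.
  rewrite (_ : 4 ^+ K = 2 ^+ (2 * K)); last by rewrite exprM two2.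
  rewrite -!powR_mulrn// -powRrM; congr (_ `^ _).
  by rewrite !natrM; field.
rewrite /amplitude !powRN lef_pV2 ?posrE ?powR_gt0//; last 1 first.
  exact: lt_le_trans le1.
by rewrite ge0_ler_powR ?nnegrE ?divr_ge0// ?(ltW K0)// (le_trans _ le1)// ltW.
Qed.

Lemma amplitude_le t : 0 < t <= 1 -> amplitude t <= (t ^+ d)^-1.
Proof.
move=> /andP[t0 t1].
have le1 : t <= 4 * pi * t.
  by rewrite -[leLHS]mul1r ler_wpM2r ?(ltW t0)//; have := pi_ge2 R; lra.
rewrite /amplitude powRN lef_pV2 ?posrE ?powR_gt0 ?exprn_gt0//; last exact: lt_le_trans le1.
rewrite -powR_mulrn ?(ltW t0)//.
apply: (@le_trans _ _ (t `^ (d%:R / 2))).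
  by apply: ger_powR; rewrite ?t0// ler_pdivrMr// ler_peMr// ler1n.
by rewrite ge0_ler_powR ?nnegrE ?divr_ge0 ?(ltW t0)// (le_trans _ le1)// ltW.
Qed.

Lemma amplitude_exp_small (c : R) : 0 < c -> exists2 C : R, 0 <= C &
  forall t, 0 < t <= 1 -> amplitude t * expR (- (c / t)) <= C * t.
Proof.
move=> c0; exists ((d.+1)`!%:R / c ^+ d.+1).
  by rewrite divr_ge0// exprn_ge0// ltW.
move=> t t01; have t0 : 0 < t by case/andP: t01.
apply: (@le_trans _ _ ((t ^+ d)^-1 * ((d.+1)`!%:R / (c / t) ^+ d.+1))).
  by apply: ler_pM; rewrite ?amplitude_ge0 ?expR_ge0 ?amplitude_le ?expRN_le_pow// divr_gt0.
rewrite le_eqVlt; apply/orP; left; apply/eqP.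
by rewrite expr_div_n exprS [t ^+ d.+1]exprS; field; rewrite !expf_neq0 ?gt_eqF.
Qed.

Lemma sqnorm_ge_coord k (x : k.-tuple R) i (rho : R) : 0 <= rho ->
  rho <= `|tnth x i| -> rho ^+ 2 <= sqnorm x.
Proof.
move=> r0 rx; rewrite /sqnorm (bigD1 i)//= ler_wpDr//.
  by apply: sumr_ge0 => j _; exact: sqr_ge0.
by rewrite -[leRHS]real_normK ?num_real// ler_pXn2r ?nnegrE.
Qed.

Lemma dist2_not_near (rho : R) z w : 0 <= rho -> ~ near_box rho z w -> rho ^+ 2 <= dist2 z w.
Proof.
move=> r0 nn; rewrite /dist2.
have [[i Hi]|[j Hj]] : (exists i, rho <= `|tnth z.1 i - tnth w.1 i|) \/
  (exists j, rho <= `|tnth z.2 j - tnth w.2 j|).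
- apply: contrapT => /not_orP[/forallNP H1 /forallNP H2]; apply: nn.
  by split => i; rewrite ltNge; apply/negP; [exact: H1|exact: H2].
- rewrite ler_wpDr ?sqnorm_ge0//; apply: (@sqnorm_ge_coord _ _ i) => //.
  by rewrite tnth_mktuple.
- rewrite ler_wpDl ?sqnorm_ge0//; apply: (@sqnorm_ge_coord _ _ j) => //.
  by rewrite tnth_mktuple.
Qed.

Lemma gauss_far (rho : R) : 0 < rho -> exists2 C : R, 0 <= C &
  forall t z w, 0 < t <= 1 -> ~ near_box rho z w -> gauss 8 t z w <= C * t.
Proof.
move=> r0; have [|C C0 HC] := @amplitude_exp_small (rho ^+ 2 / 8).
  by rewrite divr_gt0// exprn_gt0.
exists C => // t z w t01 nn; have /andP[t0 _] := t01.
apply: le_trans (HC t t01); rewrite ler_wpM2l ?amplitude_ge0// ler_expR lerN2.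
rewrite invfM mulrA ler_pM2r ?invr_gt0// ler_pM2r//.
exact: dist2_not_near (ltW r0) nn.
Qed.

Lemma gauss_dyadic : exists2 C : R, 0 <= C & forall (K k : nat) t z w,
  (k <= K)%N -> (4 ^+ K.+1)^-1 < t <= (4 ^+ K)^-1 ->
  k = K \/ ~ near_box ((2 ^+ k.+1)^-1 / 3) z w ->
  gauss 8 t z w <= C * (cell_bound R n m k)^-1 * (2 ^+ (K - k))^-1.
Proof.
have [Q Q0 QE] : exists2 Q : R, 0 < Q & Q = 4 * 8 * 9.
  by exists (4 * 8 * 9) => //; rewrite !mulr_gt0.
have Qn0 : Q != 0 by rewrite gt_eqF.
pose C1 : R := (d.+1)`!%:R * Q ^+ d.+1.
have C10 : 0 <= C1 by rewrite mulr_ge0 ?exprn_ge0 ?(ltW Q0).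
exists (2 ^+ d * (1 + C1)); first by rewrite mulr_ge0// addr_ge0.
move=> K k t z w kK /andP[Kt tK] H.
have t0 : 0 < t by apply: lt_trans Kt; rewrite invr_gt0 exprn_gt0.
have ampK := amplitude_le_dyadic (ltW Kt).
have cbE : (cell_bound R n m k)^-1 = 2 ^+ (k * d).
  by rewrite /cell_bound exprVn invrK -exprM.
rewrite cbE.
have [->|nkK] := eqVneq k K.
  rewrite subnn expr0 invr1 mulr1.
  apply: (@le_trans _ _ (2 ^+ (K.+1 * d))).
    rewrite -[leRHS]mulr1; apply: ler_pM; rewrite ?amplitude_ge0 ?expR_ge0//.
    by rewrite -[leRHS]expR0 ler_expR oppr_le0 divr_ge0 ?dist2_ge0 ?mulr_ge0 ?(ltW t0).
  by rewrite mulSn exprD ler_wpM2r ?exprn_ge0// ler_peMr ?exprn_ge0// lerDl.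
case: H => [/eqP|]; first by rewrite (negbTE nkK).
move=> nn; have kltK : (k < K)%N by rewrite ltn_neqAle nkK.
have [l KE] : exists l, K = (k + l.+1)%N.
  by exists (K - k.+1)%N; rewrite addnS -addSn subnKC.
have r0 : 0 <= (2 ^+ k.+1)^-1 / 3 :> R by rewrite divr_ge0 ?invr_ge0 ?exprn_ge0.
have D := dist2_not_near r0 nn.
pose u : R := 4 ^+ l.+1 / Q.
have u0 : 0 < u by rewrite divr_gt0 ?exprn_gt0.
have uD : u <= dist2 z w / (8 * t).
  rewrite ler_pdivlMr ?mulr_gt0//; apply: le_trans D.
  apply: (@le_trans _ _ (u * (8 * (4 ^+ K)^-1))).
    by rewrite ler_wpM2l ?(ltW u0)// ler_wpM2l.
  rewrite le_eqVlt; apply/orP; left; apply/eqP.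
  rewrite /u QE KE exprD expr_div_n exprVn -exprM mulnC exprM two2.
  rewrite [4 ^+ k.+1]exprS; field.
  by rewrite !expf_neq0.
apply: (@le_trans _ _ (2 ^+ (K.+1 * d) * ((d.+1)`!%:R / u ^+ d.+1))).
  apply: ler_pM; rewrite ?amplitude_ge0 ?expR_ge0//.
  by apply: le_trans (expRN_le_pow d u0); rewrite ler_expR lerN2.
rewrite KE addKn.
have -> : 2 ^+ ((k + l.+1).+1 * d) * ((d.+1)`!%:R / u ^+ d.+1) =
    2 ^+ d * C1 * 2 ^+ (k * d) * (2 ^+ (l.+1 * d) / (4 ^+ l.+1) ^+ d.+1).
  rewrite /C1 /u expr_div_n mulSn mulnDl !exprD; field.
  by rewrite !expf_neq0 ?Qn0.
apply: ler_pM.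
- by apply: mulr_ge0; rewrite ?exprn_ge0//; apply: mulr_ge0; rewrite ?exprn_ge0.
- by rewrite divr_ge0// !exprn_ge0.
- by rewrite ler_wpM2r ?exprn_ge0// ler_wpM2l ?exprn_ge0// lerDr.
rewrite (_ : 4 = 2 * 2 :> R); last by rewrite -natrM.
rewrite exprMn [2 ^+ (_ * _)]exprM; set X : R := 2 ^+ l.+1.
have X1 : 1 <= X by rewrite exprn_ege1// ler1n.
have X0 : 0 < X by rewrite (lt_le_trans _ X1).
rewrite exprMn ler_pdivrMr ?mulr_gt0 ?exprn_gt0//.
rewrite [X in _ <= _ * (X * _)]exprS !mulrA mulVf ?gt_eqF// mul1r.
by rewrite ler_peMr ?exprn_ge0 ?(ltW X0)// exprn_ege1.
Qed.

Lemma measurable_dist2 z : measurable_fun setT (dist2 z).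
Proof.
apply: measurable_funD; rewrite /sqnorm; apply: measurable_sum => i;
  apply: measurable_funX.
  apply: (eq_measurable_fun (fun w : WG => (tnth z.1 i : R) - tnth w.1 i)) => [w _|].
    by rewrite tnth_mktuple.
  apply: measurable_funB => //.
  exact: (measurableT_comp (measurable_tnth i) measurable_fst).
apply: (eq_measurable_fun (fun w : WG => (tnth z.2 i : R) - tnth w.2 i)) => [w _|].
  by rewrite tnth_mktuple.
apply: measurable_funB => //.
exact: (measurableT_comp (measurable_tnth i) measurable_snd).
Qed.

Lemma measurable_gauss a t z : measurable_fun setT (gauss a t z).
Proof.
apply: measurable_funM => //; apply: measurableT_comp => //.
apply: measurable_funN; apply: measurable_funM => //; exact: measurable_dist2.
Qed.

Local Open Scope ereal_scope.

Lemma integral_gauss_le_maximal : exists2 C : R, (0 <= C)%R &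
  forall t z F, (0 < t <= 1)%R -> nonneg_measurable F ->
  \int[mu]_w (gauss 8 t z w * F w)%:E <= C%:E * wg_maximal F z.
Proof.
have [|C1 C10 HC1] := @gauss_far 3^-1; first by [].
have [C2 C20 HC2] := gauss_dyadic.
exists (C1 + C2 * 2)%R; first by rewrite addr_ge0// mulr_ge0.
move=> t z F t01 aF; have [mF F0] := aF; have /andP[t0 t1] := t01.
have [K HK] : exists K : nat, ((4 ^+ K.+1)^-1 < t <= (4 ^+ K)^-1)%R.
  have ex : exists K : nat, ((4 ^+ K.+1)^-1 < t)%R.
    exists (Num.bound t^-1); rewrite invf_plt ?posrE ?exprn_gt0//.
    apply: (lt_le_trans (archi_boundP _)); first by rewrite invr_ge0 ltW.
    by rewrite -natrX ler_nat ltnW// ltnW// ltn_expl.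
  case: (ex_minnP ex) => K Kt Kmin; exists K; rewrite Kt/=.
  case: K Kt Kmin => [|K] Kt Kmin; first by rewrite expr0 invr1.
  by rewrite leNgt; apply/negP => /Kmin; rewrite ltnn.
pose D k := [set w : WG | near_box ((2 ^+ k)^-1 / 3)%R z w].
have mD k : measurable (D k) by exact: measurable_near_box.
pose a (k : nat) : R := (C2 * (cell_bound R n m k)^-1 * (2 ^+ (K - k))^-1)%R.
have cb0 k : (0 < cell_bound R n m k)%R by exact: cell_bound_gt0.
have a0 k : (0 <= a k)%R.
  by rewrite !mulr_ge0// invr_ge0 ?exprn_ge0// ltW.
have ptw w : (gauss 8 t z w <= C1 + \sum_(k < K.+1) a k * \1_(D k) w)%R.
  have [near0|far0] := pselect (D 0%N w); last first.
    rewrite ler_wpDr//; first by apply: sumr_ge0 => k _; rewrite mulr_ge0.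
    apply: (@le_trans _ _ (C1 * t)%R); last by rewrite ler_piMr.
    by apply: HC1 => //; rewrite /D /= expr0 invr1 div1r in far0.
  have [k kK [Dk kmax]] : exists2 k, (k <= K)%N & D k w /\ (k = K \/ ~ D k.+1 w).
    apply: contrapT => nex.
    have DK k : (k <= K)%N -> D k w.
      elim: k => [//|k IH] kK; apply: contrapT => nD; apply: nex.
      by exists k; [exact: ltnW|split; [exact: IH (ltnW kK)|right]].
    by apply: nex; exists K => //; split; [exact: DK|left].
  apply: (le_trans (HC2 K k t z w kK HK kmax)).
  rewrite ler_wpDl// (bigD1 (Ordinal (kK : (k < K.+1)%N)))//= -/(a k).
  rewrite indicE mem_set// mulr1 lerDl; apply: sumr_ge0 => j _.
  by rewrite mulr_ge0.
have N0 : 0 <= wg_maximal F z by exact: wg_maximal_ge0.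
have mt k : measurable_fun setT (fun w => (a k * \1_(D k) w * F w)%:E).
  by apply/measurable_EFinP; apply: measurable_funM => //; apply: measurable_funM.
have t_0 k w : 0 <= (a k * \1_(D k) w * F w)%:E.
  by rewrite lee_fin; apply: mulr_ge0 => //; apply: mulr_ge0.
apply: (@le_trans _ _ (\int[mu]_w (C1%:E * (F w)%:E + \sum_(k < K.+1) (a k * \1_(D k) w * F w)%:E))).
  apply: le_integral_nomeas => w; first by rewrite lee_fin mulr_ge0 ?gauss_ge0.
  rewrite sumEFin -EFinM -EFinD lee_fin -big_distrl/= -mulrDl ler_wpM2r//.
rewrite ge0_integralD//; first last.
- by apply: emeasurable_sum => k.
- by move=> w _; exact: sume_ge0.
- by apply: measurable_funeM; exact/measurable_EFinP.
- by move=> w _; rewrite mule_ge0 ?lee_fin.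
rewrite EFinD ge0_muleDl ?lee_fin ?mulr_ge0//; apply: leeD.
  rewrite ge0_integralZl//; first last.
  - by move=> w _; rewrite lee_fin.
  - exact/measurable_EFinP.
  rewrite lee_wpmul2l ?lee_fin// leeDl//.
  by apply: sume_ge0 => al _; exact: grid_maximal_ge0.
rewrite ge0_integral_sum//.
apply: (@le_trans _ _ (\sum_(k < K.+1) (C2 * (2 ^+ (K - k))^-1)%:E * wg_maximal F z)).
  apply: lee_sum => k _.
  rewrite (_ : \int[mu]_w _ = (a k)%:E * \int[mu]_(w in D k) (F w)%:E); last first.
    rewrite [in RHS]ge0_integral_restrict_indic -ge0_integralZl//.
    - by apply: eq_integral => w _; rewrite -EFinM; congr EFin; ring.
    - by apply/measurable_EFinP; exact: measurable_funM.
    - by move=> w _; rewrite lee_fin mulr_ge0.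
    - by rewrite lee_fin.
  apply: (@le_trans _ _ ((a k)%:E * ((cell_bound R n m k)%:E * wg_maximal F z))).
    by rewrite lee_wpmul2l ?lee_fin//; exact: integral_near_box_le.
  rewrite muleA -EFinM /a lee_wpmul2r// lee_fin le_eqVlt; apply/orP; left; apply/eqP.
  by field; rewrite gt_eqF//= expf_neq0.
rewrite -ge0_sume_distrl; last by move=> k _; rewrite lee_fin mulr_ge0// invr_ge0 exprn_ge0.
rewrite lee_wpmul2r// sumEFin lee_fin -big_distrr/= ler_wpM2l//.
rewrite (reindex_inj rev_ord_inj)/=.
rewrite (eq_bigr (fun k : 'I_K.+1 => 2^-1 ^+ k)%R); last first.
  by move=> k _; rewrite subSS subKn ?exprVn// -ltnS.
exact: sum_half_le2.
Qed.

End gaussian_majorants.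

Section heat_kernel_bounds.
Context (R : realType) (n m : nat).
Local Notation Rm := (measurableTypeR R).
Local Notation WG := (waveguide R n m).
Local Notation d := (n + m)%N.
Implicit Types (t : R) (z w : WG).

Let lattice_exp t z w (k : n.-tuple int) : R :=
  expR (- ((sqnorm (tshift (tsub z.1 w.1) k) + sqnorm (tsub z.2 w.2)) / (4 * t))).

Let k0 : n.-tuple int := [tuple 0 | _ < n].

Lemma heat_kernel_subE t z w : heat_kernel_sub t z w =
  amplitude n m t * fine (\esum_(k in [set: n.-tuple int]) (lattice_exp t z w k)%:E).
Proof. by []. Qed.

Lemma heat_kernel_sub_ge0 t z w : 0 <= heat_kernel_sub t z w.
Proof.
rewrite heat_kernel_subE mulr_ge0 ?amplitude_ge0// fine_ge0// esum_ge0// => k _.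
by rewrite lee_fin expR_ge0.
Qed.

Let lattice_exp0 t z w : lattice_exp t z w k0 = expR (- (dist2 z w / (4 * t))).
Proof.
rewrite /lattice_exp /dist2.
suff -> : sqnorm (tshift (tsub z.1 w.1) k0) = sqnorm (tsub z.1 w.1) by [].
by apply: eq_bigr => i _; rewrite [tnth (tshift _ _) i]tnth_mktuple [tnth k0 i]tnth_mktuple mulr0z addr0.
Qed.

Lemma measurable_heat_kernel_sub t z : measurable_fun setT (heat_kernel_sub t z).
Proof.
apply: measurable_funM => //; apply: measurableT_comp => //.
apply: measurable_esum => [k|k w]; last by rewrite lee_fin expR_ge0.
apply/measurable_EFinP; apply: measurableT_comp => //.
apply: measurable_funN; apply: measurable_funM => //.
apply: measurable_funD; rewrite /sqnorm; apply: measurable_sum => i;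
  apply: measurable_funX.
  apply: (eq_measurable_fun (fun w : WG => ((tnth z.1 i : R) - tnth w.1 i) + (tnth k i)%:~R)) => [w _|].
    by rewrite !tnth_mktuple.
  apply: measurable_funD => //; apply: measurable_funB => //.
  exact: (measurableT_comp (measurable_tnth i) measurable_fst).
apply: (eq_measurable_fun (fun w : WG => (tnth z.2 i : R) - tnth w.2 i)) => [w _|].
  by rewrite tnth_mktuple.
apply: measurable_funB => //.
exact: (measurableT_comp (measurable_tnth i) measurable_snd).
Qed.

Let sqr_shift_ge (a : R) (j : int) : `|a| <= 1 -> `|j|%N%:R - 2 <= (a + j%:~R) ^+ 2.
Proof.
rewrite ler_norml => /andP[a1 a2].
have nat_ge (k : nat) (s : R) : (k%:R - 1 <= `|s|) -> k%:R - 2 <= s ^+ 2.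
  rewrite -real_normK ?num_real//; set r := `|s|; have r0 : 0 <= r by exact: normr_ge0.
  by move=> kr; nra.
apply: nat_ge; case: j => k.
  by rewrite absz_nat -pmulrn; have := ler_norm (a + k%:R); lra.
rewrite NegzE abszN absz_nat mulrNz -pmulrn.
by have := ler_norm (- (a - k.+1%:R)); rewrite normrN; lra.
Qed.

Let sub_cell (x x' : n.-tuple Rm) i : unit_cell x -> unit_cell x' ->
  `|tnth (tsub x x') i| <= 1 :> R.
Proof.
move=> /(_ i) /andP[x1 x2] /(_ i) /andP[x3 x4]; rewrite tnth_mktuple ler_norml.
by apply/andP; split; lra.
Qed.

Lemma expR_lattice_le t (a : n.-tuple R) k : 0 < t <= 2^-1 ->
  (forall i, `|tnth a i| <= 1) ->
  expR (- (sqnorm (tshift a k) / (8 * t))) <= \prod_(i < n) lattice_weight R (tnth k i).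
Proof.
move=> /andP[t0 t1] a1; rewrite /lattice_weight -expR_sum ler_expR.
apply: (@le_trans _ _ (- (sqnorm (tshift a k) / 4))).
  rewrite lerN2 ler_wpM2l ?sqnorm_ge0// lef_pV2 ?posrE ?mulr_gt0//; lra.
rewrite /sqnorm mulr_suml -sumrN; apply: ler_sum => i _.
by have := sqr_shift_ge (tnth k i) (a1 i); rewrite tnth_mktuple; lra.
Qed.

Let lattice_exp_ge0 t z w k : (0 <= (lattice_exp t z w k)%:E)%E.
Proof. by rewrite lee_fin expR_ge0. Qed.

Let lattice_exp_le t z w k : 0 < t <= 2^-1 -> unit_cell z.1 -> unit_cell w.1 ->
  lattice_exp t z w k <= \prod_(i < n) lattice_weight R (tnth k i).
Proof.
move=> t01 zc wc; have /andP[t0 _] := t01.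
apply: le_trans (expR_lattice_le k t01 (fun i => sub_cell i zc wc)).
rewrite ler_expR lerN2.
set s := sqnorm (tshift _ _); have s0 : 0 <= s by exact: sqnorm_ge0.
apply: ler_pM => //; rewrite ?invr_ge0 ?mulr_ge0 ?(ltW t0)//.
  by rewrite lerDl sqnorm_ge0.
by rewrite lef_pV2 ?posrE ?mulr_gt0// ler_pM2r// ler_nat.
Qed.

Let esum_lattice_exp_fin t z w : 0 < t <= 2^-1 -> unit_cell z.1 -> unit_cell w.1 ->
  (\esum_(k in [set: n.-tuple int]) (lattice_exp t z w k)%:E < +oo)%E.
Proof.
move=> t01 zc wc; have [c Hc] := esum_lattice_weight_tuple R n.
apply: (le_lt_trans _ (ltry c)); apply: le_trans Hc; apply: le_esum => k _.
by rewrite lee_fin; exact: lattice_exp_le.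
Qed.

Lemma gauss_le_heat_kernel_sub t z w : 0 < t <= 2^-1 -> unit_cell z.1 -> unit_cell w.1 ->
  gauss 4 t z w <= heat_kernel_sub t z w.
Proof.
move=> t01 zc wc; rewrite heat_kernel_subE ler_wpM2l ?amplitude_ge0//.
rewrite -lattice_exp0 -lee_fin fineK; last first.
  by rewrite ge0_fin_numE ?esum_lattice_exp_fin// esum_ge0.
rewrite -(@esum_set1 _ _ k0 (fun k => (lattice_exp t z w k)%:E))//.
by apply: le_ereal_sup => _ [X [finX _] <-]; exists X.
Qed.

Lemma sqnorm_tsub_le k (x y : k.-tuple R) : sqnorm y <= 2 * sqnorm x + 2 * sqnorm (tsub x y).
Proof.
rewrite /sqnorm !mulr_sumr -big_split /=; apply: ler_sum => i _.
rewrite tnth_mktuple; set a := tnth x i; set b := tnth y i.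
have := sqr_ge0 (2 * a - b); nra.
Qed.

Variable t0 : R.
Hypothesis t0_gt0 : 0 < t0.

Definition gauss_weight w : R := expR (- (sqnorm w.2 / (4 * t0))).

Lemma gauss_weight_gt0 w : 0 < gauss_weight w. Proof. exact: expR_gt0. Qed.

Lemma gauss_weight_le1 w : gauss_weight w <= 1.
Proof.
by rewrite -expR0 ler_expR oppr_le0 divr_ge0 ?sqnorm_ge0 ?mulr_ge0 ?(ltW t0_gt0).
Qed.

Lemma measurable_gauss_weight : measurable_fun setT gauss_weight.
Proof.
apply: measurableT_comp => //; apply: measurable_funN; apply: measurable_funM => //.
apply: measurable_sum => i; apply: measurable_funX.
exact: (measurableT_comp (measurable_tnth i) measurable_snd).
Qed.

(* On [core N] the terms of the heat kernel other than that of index 0 stay    *)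
(* bounded away from their singularities as [t] tends to 0.                    *)
Definition core (N : nat) : set WG :=
  [set z | (forall i, `|tnth z.1 i : R| <= 2^-1 - N.+1%:R^-1) /\ sqnorm z.2 <= N%:R].

Lemma core_cell N z : core N z -> unit_cell z.1.
Proof.
move=> [H _] i; have := H i; set x : R := tnth z.1 i; rewrite ler_norml.
have : 0 < N.+1%:R^-1 :> R by rewrite invr_gt0.
by move: (N.+1%:R^-1) => e e0 /andP[h1 h2]; apply/andP; split; lra.
Qed.

Lemma expR_vertical_le N t z w : core N z -> 0 < t <= t0 / 4 ->
  expR (- (sqnorm (tsub z.2 w.2) / (8 * t))) <= expR (N%:R / (2 * t0)) * gauss_weight w.
Proof.
move=> [_ zN] /andP[t_gt0 tt0]; rewrite -expRD ler_expR.
have S0 := sqnorm_ge0 (tsub z.2 w.2); set S := sqnorm (tsub _ _) in S0 *.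
apply: (@le_trans _ _ (- (S / (2 * t0)))).
  rewrite lerN2 ler_wpM2l// lef_pV2 ?posrE ?mulr_gt0//; lra.
have := sqnorm_tsub_le z.2 w.2; rewrite -/S => H.
have -> : N%:R / (2 * t0) - sqnorm w.2 / (4 * t0) = (2 * N%:R - sqnorm w.2) / (4 * t0).
  by field; rewrite gt_eqF.
have -> : - (S / (2 * t0)) = (- (2 * S)) / (4 * t0) by field; rewrite gt_eqF.
by rewrite ler_pM2r ?invr_gt0 ?mulr_gt0//; lra.
Qed.

Lemma heat_kernel_sub_le_gauss N : exists2 C : R, 0 <= C &
  forall t z w, 0 < t <= t0 / 4 -> t <= 2^-1 -> core N z -> unit_cell w.1 ->
  heat_kernel_sub t z w <= gauss 4 t z w + C * t * gauss_weight w.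
Proof.
have N0 : 0 < N.+1%:R^-1 :> R by rewrite invr_gt0.
have [c Hc] := esum_lattice_weight_tuple R n.
have c0 : 0 <= c.
  rewrite -lee_fin; apply: le_trans Hc; apply: esum_ge0 => k _.
  by rewrite lee_fin prodr_ge0// => i _; exact: expR_ge0.
have [|C C0 HC] := @amplitude_exp_small R n m ((N.+1%:R^-1) ^+ 2 / 8).
  by rewrite divr_gt0// exprn_gt0.
exists (C * c * expR (N%:R / (2 * t0))); first by rewrite !mulr_ge0// expR_ge0.
move=> t z w t04 t2 zN wc; have /andP[t_gt0 _] := t04.
have t01 : 0 < t <= 2^-1 by rewrite t_gt0.
have zc := core_cell zN.
pose e1 : R := expR (- ((N.+1%:R^-1) ^+ 2 / 8 / t)).
pose e2 : R := expR (- (sqnorm (tsub z.2 w.2) / (8 * t))).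
have e12 : 0 <= e1 * e2 by rewrite mulr_ge0 ?expR_ge0.
have E_le k : k <> k0 -> lattice_exp t z w k <= e1 * e2 * \prod_(i < n) lattice_weight R (tnth k i).
  move=> kk0; have [i ki] : exists i, tnth k i != 0.
    apply: contrapT => /forallNP nk; apply: kk0; apply: eq_from_tnth => i.
    by rewrite tnth_mktuple; apply/eqP/negPn/negP; exact: nk.
  have coord : N.+1%:R^-1 <= `|tnth (tshift (tsub z.1 w.1) k) i|.
    rewrite !tnth_mktuple.
    have := zN.1 i; have := wc i; set x : R := tnth z.1 i; set x' : R := tnth w.1 i.
    have kint : (1 <= tnth k i)%R \/ (tnth k i <= -1)%R.
      by move: ki; case: (tnth k i) => [[|j]|j] // _; [left|right].
    have : (1 : R) <= (tnth k i)%:~R \/ (tnth k i)%:~R <= (-1 : R).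
      by rewrite -[X in X <= _ \/ _]/(1%:~R) -[-1 : R]/((-1)%:~R) !ler_int.
    move: (N.+1%:R^-1) ((tnth k i)%:~R : R) => e q qq /andP[w1 w2].
    rewrite ler_norml ler_normr => /andP[z1 z2]; apply/orP.
    by case: qq => qq; [left|right]; lra.
  have s_ge := sqnorm_ge_coord (ltW N0) coord.
  apply: le_trans (ler_wpM2l e12 (expR_lattice_le k t01 (fun i => sub_cell i zc wc))).
  rewrite /e1 /e2 -!expRD ler_expR.
  have S0 := sqnorm_ge0 (tsub z.2 w.2); set S := sqnorm (tsub z.2 w.2) in S0 *.
  set s := sqnorm _ in s_ge *; set rho := _ ^+ 2 in s_ge *.
  have -> : - (rho / 8 / t) - S / (8 * t) - s / (8 * t) = - ((rho + S + s) / (8 * t)).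
    by field; rewrite gt_eqF.
  have -> : - ((s + S) / (4 * t)) = - ((2 * s + 2 * S) / (8 * t)).
    by field; rewrite gt_eqF.
  by rewrite lerN2 ler_pM2r ?invr_gt0 ?mulr_gt0//; lra.
rewrite heat_kernel_subE.
have fine_le : fine (\esum_(k in [set: n.-tuple int]) (lattice_exp t z w k)%:E) <=
    lattice_exp t z w k0 + e1 * e2 * c.
  rewrite -lee_fin fineK; last first.
    by rewrite ge0_fin_numE ?esum_lattice_exp_fin// esum_ge0.
  apply: (@le_trans _ _ (\esum_(k in [set: n.-tuple int]) ((if k \in [set k0] then (lattice_exp t z w k)%:E else 0) +
     (e1 * e2)%:E * (\prod_(i < n) lattice_weight R (tnth k i))%:E))%E).
    apply: le_esum => k _; have [/[!inE] ->|] := boolP (k \in [set k0]).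
      by rewrite leeDl// mule_ge0 ?lee_fin// prodr_ge0// => i _; exact: expR_ge0.
    by rewrite notin_setE => kk0; rewrite add0e -EFinM lee_fin; exact: E_le.
  rewrite esumD; first last.
  - by move=> k _; rewrite mule_ge0 ?lee_fin// prodr_ge0// => i _; exact: expR_ge0.
  - by move=> k _; case: ifP.
  rewrite -esum_mkcond esum_set1// EFinD leeD2l// ge0_esumZl//; last first.
    by move=> k; rewrite lee_fin prodr_ge0// => i _; exact: expR_ge0.
  by rewrite [leRHS]EFinM lee_wpmul2l ?lee_fin.
apply: (@le_trans _ _ (amplitude n m t * (lattice_exp t z w k0 + e1 * e2 * c))).
  by rewrite ler_wpM2l ?amplitude_ge0.
rewrite mulrDr lattice_exp0 -/(gauss 4 t z w) lerD2l.
have He : amplitude n m t * e1 <= C * t.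
  by apply: HC; rewrite t_gt0/=; lra.
have Hv := expR_vertical_le w zN t04; rewrite -/e2 in Hv.
rewrite (_ : amplitude n m t * (e1 * e2 * c) = c * ((amplitude n m t * e1) * e2)); last by ring.
rewrite (_ : C * c * _ * t * _ = c * ((C * t) * (expR (N%:R / (2 * t0)) * gauss_weight w))); last by ring.
by rewrite ler_wpM2l// ler_pM// ?mulr_ge0 ?amplitude_ge0 ?expR_ge0.
Qed.

End heat_kernel_bounds.

Section gaussian_integrals.
Context (R : realType).
Local Notation Rm := (measurableTypeR R).
Local Notation leb := (@lebesgue_measure R).
Local Notation cellI := (`[(- 2^-1)%R : R, 2^-1%R[%classic).
Implicit Types t x s : R.

Definition gauss1 t x s : R := (4 * pi * t) `^ (- 2^-1) * expR (- ((x - s) ^+ 2 / (4 * t))).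

Lemma gauss1_ge0 t x s : 0 <= gauss1 t x s.
Proof. by rewrite mulr_ge0 ?powR_ge0 ?expR_ge0. Qed.

Lemma measurable_gauss1 t x : measurable_fun setT (gauss1 t x : Rm -> R).
Proof.
apply: measurable_funM => //; apply: measurableT_comp => //.
apply: measurable_funN; apply: measurable_funM => //.
by apply: measurable_funX; exact: measurable_funB.
Qed.

Lemma integral_gauss1 t x : 0 < t -> (\int[leb]_s (gauss1 t x s)%:E = 1)%E.
Proof.
move=> t0.
have s2 : Num.sqrt (2 * t) ^+ 2 = 2 * t by rewrite sqr_sqrtr// mulr_ge0 ?(ltW t0).
have s0 : Num.sqrt (2 * t) != 0 by rewrite gt_eqF// sqrtr_gt0 mulr_gt0.
rewrite -(integral_normal_pdf x (Num.sqrt (2 * t))); apply: eq_integral => s _.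
rewrite (normal_pdfE _ s0) /normal_peak /normal_fun s2 /gauss1; congr (_ * expR _)%:E.
  rewrite powRN powR12_sqrt; last by rewrite !mulr_ge0 ?pi_ge0 ?(ltW t0).
  by congr (Num.sqrt _)^-1; rewrite -mulr_natr; ring.
by rewrite -mulr_natr mulNr -sqrrN opprB; congr (- (_ / _)); ring.
Qed.

Lemma integral_gauss1_weight t : 0 < t -> exists c : R,
  (\int[leb]_s (expR (- (s ^+ 2 / (4 * t))))%:E = c%:E)%E.
Proof.
move=> t0; exists ((4 * pi * t) `^ (- 2^-1))^-1.
set a := _ `^ _; have a0 : 0 < a by rewrite powR_gt0// !mulr_gt0// pi_gt0.
transitivity (\int[leb]_s (a^-1%:E * (gauss1 t 0 s)%:E))%E.
  apply: eq_integral => s _; rewrite -EFinM; congr EFin.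
  by rewrite /gauss1 sub0r sqrrN -/a mulKf ?gt_eqF.
rewrite ge0_integralZl//.
- by rewrite integral_gauss1// mule1.
- by apply/measurable_EFinP; exact: measurable_gauss1.
- by move=> s _; rewrite lee_fin gauss1_ge0.
- by rewrite lee_fin invr_ge0 ltW.
Qed.

(* Outside the cell, [gauss1 t] is at most [t] times a constant times          *)
(* [gauss1 (2 * t)], which also has integral 1.                                *)
Lemma integral_gauss1_cell (del : R) : 0 < del -> exists2 C : R, 0 <= C &
  forall t x, 0 < t -> `|x| <= 2^-1 - del -> exists p : R,
    (\int[leb]_s (gauss1 t x s * \1_cellI s)%:E)%E = p%:E /\ 1 - C * t <= p <= 1.
Proof.
move=> d0; exists (16 / del ^+ 2); first by rewrite divr_ge0// exprn_ge0// ltW.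
move=> t x t0 xd.
have mg := measurable_gauss1 t x.
have i1 := integral_gauss1 x t0.
have le1 : (\int[leb]_s (gauss1 t x s * \1_cellI s)%:E <= 1)%E.
  rewrite -i1; apply: le_integral_nomeas => s.
    by rewrite lee_fin mulr_ge0 ?gauss1_ge0.
  rewrite lee_fin -[leRHS]mulr1 ler_wpM2l ?gauss1_ge0//.
have ge0 : (0 <= \int[leb]_s (gauss1 t x s * \1_cellI s)%:E)%E.
  by apply: integral_ge0 => s _; rewrite lee_fin mulr_ge0 ?gauss1_ge0.
have fin : (\int[leb]_s (gauss1 t x s * \1_cellI s)%:E \is a fin_num)%E.
  by rewrite ge0_fin_numE// (le_lt_trans le1)// ltry.
exists (fine (\int[leb]_s (gauss1 t x s * \1_cellI s)%:E)%E); split; first by rewrite fineK.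
rewrite -!lee_fin fineK// le1 andbT EFinB leeBlDr//.
rewrite -[X in (X <= _)%E]i1 addeC.
have -> : ((16 / del ^+ 2 * t)%:E = \int[leb]_s ((16 / del ^+ 2 * t)%:E * (gauss1 (2 * t) x s)%:E))%E.
  rewrite ge0_integralZl//.
  - by rewrite integral_gauss1 ?mule1// mulr_gt0.
  - by apply/measurable_EFinP; exact: measurable_gauss1.
  - by move=> s _; rewrite lee_fin gauss1_ge0.
  - by rewrite lee_fin mulr_ge0 ?divr_ge0 ?exprn_ge0 ?(ltW d0) ?(ltW t0).
rewrite -ge0_integralD//; first last.
- by apply/measurable_EFinP; apply: measurable_funM.
- by move=> s _; rewrite lee_fin mulr_ge0 ?gauss1_ge0.
- by apply: measurable_funeM; apply/measurable_EFinP; exact: measurable_gauss1.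
- move=> s _; rewrite mule_ge0 ?lee_fin ?gauss1_ge0//.
  by rewrite mulr_ge0 ?divr_ge0 ?exprn_ge0 ?(ltW d0) ?(ltW t0).
apply: le_integral_nomeas => s; first by rewrite lee_fin gauss1_ge0.
rewrite -EFinM -EFinD lee_fin indicE; have [|] := boolP (s \in cellI).
  rewrite mulr1 lerDr mulr_ge0 ?gauss1_ge0//.
  by rewrite mulr_ge0 ?divr_ge0 ?exprn_ge0 ?(ltW d0) ?(ltW t0).
rewrite mulr0 addr0 notin_setE /= in_itv/= => sc.
have ds : del ^+ 2 <= (x - s) ^+ 2.
  have dxs : del <= `|x - s|.
    rewrite leNgt; apply/negP => xs; apply: sc.
    move: xd xs; rewrite ler_norml ltr_norml => /andP[? ?] /andP[? ?].
    by apply/andP; split; lra.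
  by rewrite -[leRHS]real_normK ?num_real// ler_pXn2r ?nnegrE ?(ltW d0).
set P := 4 * pi * t; have P0 : 0 < P by rewrite !mulr_gt0// pi_gt0.
have amp : P `^ (- 2^-1) <= 2 * (4 * pi * (2 * t)) `^ (- 2^-1).
  rewrite (_ : 4 * pi * (2 * t) = 2 * P); last by rewrite /P; ring.
  rewrite powRM ?(ltW P0)// mulrA ler_peMl ?powR_ge0//.
  rewrite -[X in X * _]powRr1// -powRD ?pnatr_eq0 ?implybT//.
  by rewrite -[leLHS](powRr0 2) ler_powR ?ler1n//; lra.
rewrite /gauss1 -/P.
set E := (x - s) ^+ 2 in ds *.
have dd0 : 0 < del ^+ 2 by rewrite exprn_gt0.
have expo : expR (- (E / (4 * t))) <= (8 * t / del ^+ 2) * expR (- (E / (4 * (2 * t)))).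
  have -> : - (E / (4 * t)) = - (E / (8 * t)) + - (E / (4 * (2 * t))) by field; rewrite gt_eqF.
  rewrite expRD ler_wpM2r ?expR_ge0//.
  apply: (@le_trans _ _ (expR (- (del ^+ 2 / (8 * t))))).
    by rewrite ler_expR lerN2 ler_wpM2r// invr_ge0 mulr_ge0 ?(ltW t0).
  have u0 : 0 < del ^+ 2 / (8 * t) by rewrite divr_gt0// mulr_gt0.
  apply: le_trans (expRN_le_pow 0 u0) _.
  by rewrite expr1 /= mul1r invf_div.
apply: (@le_trans _ _ ((2 * (4 * pi * (2 * t)) `^ (- 2^-1)) * (8 * t / del ^+ 2 * expR (- (E / (4 * (2 * t))))))).
  by rewrite ler_pM// ?powR_ge0 ?expR_ge0.
by rewrite le_eqVlt; apply/orP; left; apply/eqP; field; rewrite !gt_eqF.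
Qed.

End gaussian_integrals.

Section gaussian_mass.
Context (R : realType) (n m : nat).
Local Notation Rm := (measurableTypeR R).
Local Notation WG := (waveguide R n m).
Local Notation mu := (WG_measure R n m).
Implicit Types (t : R) (z w : WG).

Lemma gauss4_prod t z w : 0 < t -> gauss 4 t z w =
  \prod_(i < n) gauss1 t (tnth z.1 i) (tnth w.1 i) *
  \prod_(j < m) gauss1 t (tnth z.2 j) (tnth w.2 j).
Proof.
move=> t0; rewrite /gauss1 !big_split /= !prodr_const !card_ord -!expR_sum.
rewrite mulrACA -exprD -expRD /gauss; congr (_ * expR _).
  by rewrite /amplitude -powR_mulrn ?powR_ge0// -powRrM; congr (_ `^ _); ring.
rewrite /dist2 /sqnorm mulrDl opprD !mulr_suml -!sumrN; congr (_ + _);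
  by apply: eq_bigr => i _; rewrite tnth_mktuple.
Qed.

Lemma prod_ge_1sub k (p : 'I_k -> R) (e : R) : 0 <= e ->
  (forall i, 0 <= p i <= 1) -> (forall i, 1 - e <= p i) ->
  1 - k%:R * e <= \prod_(i < k) p i.
Proof.
move=> e0; elim: k p => [|k IH] p p01 pe; first by rewrite big_ord0 mul0r subr0.
rewrite big_ord_recl -natr1 /=.
have := IH (fun i => p (lift ord0 i)) (fun i => p01 _) (fun i => pe _).
have Q01 : 0 <= \prod_(i < k) p (lift ord0 i) <= 1.
  rewrite prodr_ge0/=; last by move=> i _; case/andP: (p01 (lift ord0 i)).
  by apply: prodr_ile1 => i _; exact: p01.
move: Q01; set Q := \prod_(i < k) _ => /andP[Q0 Q1].
have := p01 ord0; have := pe ord0; set a := p ord0 => a1 /andP[a0 a2].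
have := mulr_ge0 e0 (ler0n R k).
nra.
Qed.

Local Open Scope ereal_scope.

Lemma integral_gauss4 N : exists2 C : R, (0 <= C)%R &
  forall t z, (0 < t)%R -> core N z -> exists p : R,
    \int[mu]_w (gauss 4 t z w)%:E = p%:E /\ (1 - C * t <= p <= 1)%R.
Proof.
have [|C C0 HC] := @integral_gauss1_cell R (N.+1%:R^-1); first by rewrite invr_gt0.
exists (n%:R * C)%R; first by rewrite mulr_ge0.
move=> t z t0 zN.
have /choice[p Hp] := fun i : 'I_n => HC t (tnth z.1 i) t0 (zN.1 i).
have p0 i : (0 <= p i)%R.
  rewrite -lee_fin -(Hp i).1; apply: integral_ge0 => s _.
  by rewrite lee_fin mulr_ge0 ?gauss1_ge0.
exists (\prod_(i < n) p i)%R; split.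
  under eq_integral do rewrite gauss4_prod//.
  rewrite (@integral_WG_prod R n m (fun i => gauss1 t (tnth z.1 i)) (fun j => gauss1 t (tnth z.2 j)) p (fun=> 1%R)).
  - by rewrite [X in (_ * X)%R]big1 ?mulr1.
  - by move=> i; exact: measurable_gauss1.
  - by move=> i; exact: measurable_gauss1.
  - by move=> i s; exact: gauss1_ge0.
  - by move=> i s; exact: gauss1_ge0.
  - by move=> i; exact: (Hp i).1.
  - by move=> j; exact: integral_gauss1.
apply/andP; split.
  rewrite -mulrA; apply: prod_ge_1sub; first by rewrite mulr_ge0 ?(ltW t0).
    by move=> i; rewrite p0; case/andP: (Hp i).2.
  by move=> i; case/andP: (Hp i).2.
by apply: prodr_ile1 => i _; rewrite p0; case/andP: (Hp i).2.
Qed.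

Variable t0 : R.
Hypothesis t0_gt0 : (0 < t0)%R.
Local Notation gw := (@gauss_weight R n m t0).

Lemma integral_gauss_weight_lty : \int[mu]_w (gw w)%:E < +oo.
Proof.
have [c Hc] := integral_gauss1_weight t0_gt0.
have E (w : WG) : gw w = (\prod_(i < n) (fun=> 1) (tnth w.1 i) *
    \prod_(j < m) expR (- ((tnth w.2 j) ^+ 2 / (4 * t0))))%R.
  rewrite big1// mul1r -expR_sum /gauss_weight; congr expR.
  by rewrite /sqnorm mulr_suml -sumrN.
under eq_integral do rewrite E.
rewrite (@integral_WG_prod R n m (fun _ _ => 1%R) (fun _ s => expR (- (s ^+ 2 / (4 * t0)))) (fun=> 1%R) (fun=> c)).
- exact: ltry.
- by move=> i.
- move=> j; apply: measurableT_comp => //; apply: measurable_funN; apply: measurable_funM => //.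
- by [].
- by move=> *; exact: expR_ge0.
- move=> i; under eq_integral do rewrite mul1r.
  by rewrite integral_indic// setIT; exact: lebesgue_measure_cell.
- by [].
Qed.

Lemma gauss4_le_gauss8 N t z w : core N z -> (0 < t <= t0 / 4)%R ->
  (gauss 4 t z w <= expR (N%:R / (2 * t0)) * (gauss 8 t z w * gw w))%R.
Proof.
move=> zN t01; have /andP[t_gt0 _] := t01.
rewrite [leRHS](_ : _ = amplitude n m t * (expR (- (dist2 z w / (8 * t))) *
   (expR (N%:R / (2 * t0)) * gw w)))%R; last by rewrite /gauss; ring.
rewrite ler_wpM2l ?amplitude_ge0//.
apply: (@le_trans _ _ (expR (- (dist2 z w / (8 * t))) * expR (- (sqnorm (tsub z.2 w.2) / (8 * t))))%R).
  rewrite -expRD ler_expR.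
  have -> : (- (dist2 z w / (4 * t)) = (- dist2 z w - dist2 z w) / (8 * t))%R.
    by field; rewrite gt_eqF.
  rewrite -!mulNr -mulrDl ler_wpM2r ?invr_ge0 ?mulr_ge0 ?(ltW t_gt0)//.
  by rewrite lerD2l lerN2 /dist2 lerDr sqnorm_ge0.
by rewrite ler_wpM2l ?expR_ge0//; exact: expR_vertical_le.
Qed.

Let mker t z : measurable_fun setT (heat_kernel_sub t z : WG -> R).
Proof. exact: measurable_heat_kernel_sub. Qed.

Let mgw : measurable_fun setT gw.
Proof. exact: measurable_gauss_weight. Qed.

Lemma measurable_not_cell : measurable [set z : WG | ~ unit_cell z.1].
Proof.
rewrite (_ : [set z | _] = ~` (fst @^-1` @unit_cell R n)); last by [].
apply: measurableC; rewrite -[X in measurable X]setTI.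
exact: (@measurable_fst _ _ (n.-tuple Rm) (m.-tuple Rm) measurableT _
  (@measurable_unit_cell R n)).
Qed.

Let nullNC : mu [set z : WG | ~ unit_cell z.1] = 0.
Proof. exact: WG_measure_not_cell. Qed.

Lemma le_integral_cell (f g : WG -> R) : (forall w, (0 <= f w)%R) -> (forall w, (0 <= g w)%R) ->
  (forall w, unit_cell w.1 -> (f w <= g w)%R) ->
  \int[mu]_w (f w)%:E <= \int[mu]_w (g w)%:E.
Proof.
move=> f0 g0 fg; apply: (le_integral_off_null measurable_not_cell nullNC) => w; rewrite ?lee_fin//.
by move=> /contrapT; exact: fg.
Qed.

Lemma heat_kernel_maximal_le N : exists2 C : R, (0 <= C)%R &
  forall t z f, (0 < t <= t0 / 4)%R -> (t <= 2^-1)%R -> core N z -> nonneg_measurable f ->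
  \int[mu]_w (heat_kernel_sub t z w * f w)%:E <=
    C%:E * wg_maximal (fun w => f w * gw w)%R z.
Proof.
have [C1 C10 H1] := heat_kernel_sub_le_gauss n m t0_gt0 N.
have [C2 C20 H2] := integral_gauss_le_maximal R n m.
pose E := expR (N%:R / (2 * t0)) : R; have E0 : (0 <= E)%R by exact: expR_ge0.
exists (E * C2 + C1)%R; first by rewrite addr_ge0 ?mulr_ge0.
move=> t z f t01 t2 zN [mf f0]; have /andP[t_gt0 _] := t01.
have gw0 w : (0 <= gw w)%R by exact: expR_ge0.
have aF : nonneg_measurable (fun w => f w * gw w)%R.
  by split => [|w]; [exact: measurable_funM|rewrite mulr_ge0].
have fg0 w : (0 <= f w * gw w)%R by exact: aF.2.
have gg0 w : (0 <= gauss 8 t z w * (f w * gw w))%R by rewrite mulr_ge0 ?gauss_ge0.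
apply: (@le_trans _ _ (\int[mu]_w (E * (gauss 8 t z w * (f w * gw w)) + C1 * (f w * gw w))%R%:E)).
  apply: le_integral_cell => [w|w|w wc].
  - by rewrite mulr_ge0 ?heat_kernel_sub_ge0.
  - by apply: addr_ge0; apply: mulr_ge0.
  apply: (@le_trans _ _ ((gauss 4 t z w + C1 * t * gw w) * f w)%R).
    by rewrite ler_wpM2r//; exact: H1.
  rewrite mulrDl; apply: lerD.
    rewrite (_ : E * _ = (E * (gauss 8 t z w * gw w)) * f w)%R; last by ring.
    by rewrite ler_wpM2r//; exact: gauss4_le_gauss8.
  rewrite (_ : C1 * t * gw w * f w = (C1 * (f w * gw w)) * t)%R; last by ring.
  by rewrite ler_piMr ?mulr_ge0//; lra.
have mg8 := measurable_gauss 8 t z.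
under eq_integral do rewrite EFinD (EFinM E) (EFinM C1).
rewrite ge0_integralD//; first last.
- by apply: measurable_funeM; apply/measurable_EFinP; exact: aF.1.
- by move=> w _; rewrite mule_ge0 ?lee_fin.
- by apply: measurable_funeM; apply/measurable_EFinP; apply: measurable_funM => //; exact: aF.1.
- by move=> w _; rewrite mule_ge0 ?lee_fin.
rewrite EFinD ge0_muleDl ?lee_fin ?mulr_ge0//; apply: leeD.
  rewrite ge0_integralZl//; first last.
  - by move=> w _; rewrite lee_fin.
  - by apply/measurable_EFinP; apply: measurable_funM => //; exact: aF.1.
  rewrite EFinM -muleA lee_wpmul2l ?lee_fin//; apply: H2 => //.
  by rewrite t_gt0/=; lra.
rewrite ge0_integralZl//; first last.
- by move=> w _; rewrite lee_fin.
- by apply/measurable_EFinP; exact: aF.1.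
rewrite lee_wpmul2l ?lee_fin// leeDl// sume_ge0// => al _.
by apply: grid_maximal_ge0; exact: aF.2.
Qed.

Lemma heat_kernel_far_le N (rho : R) : (0 < rho)%R -> exists2 C : R, (0 <= C)%R &
  forall t z (S : set WG), (0 < t <= t0 / 4)%R -> (t <= 2^-1)%R -> core N z -> measurable S ->
  (forall w, S w -> ~ near_box rho z w) ->
  \int[mu]_w (heat_kernel_sub t z w * \1_S w)%:E <= (C * t)%:E.
Proof.
move=> rho0.
have [C1 C10 H1] := heat_kernel_sub_le_gauss n m t0_gt0 N.
have [C2 C20 H2] := @gauss_far R n m rho rho0.
pose E := expR (N%:R / (2 * t0)) : R; have E0 : (0 <= E)%R by exact: expR_ge0.
have gw0 w : (0 <= gw w)%R by exact: expR_ge0.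
have igw := integral_gauss_weight_lty.
set I := \int[mu]_w (gw w)%:E in igw.
have I0 : 0 <= I by apply: integral_ge0 => w _; rewrite lee_fin.
have Ifin : I \is a fin_num by rewrite ge0_fin_numE.
exists ((E * C2 + C1) * fine I)%R; first by rewrite mulr_ge0 ?addr_ge0 ?mulr_ge0 ?fine_ge0.
move=> t z S t01 t2 zN mS Sfar; have /andP[t_gt0 _] := t01.
apply: (@le_trans _ _ (\int[mu]_w ((E * C2 + C1) * t * gw w)%R%:E)).
  apply: le_integral_cell => [w|w|w wc].
  - by rewrite mulr_ge0 ?heat_kernel_sub_ge0.
  - by rewrite !mulr_ge0 ?addr_ge0 ?mulr_ge0 ?(ltW t_gt0).
  rewrite indicE; have [|_] := boolP (w \in S); last first.
    by rewrite mulr0 !mulr_ge0 ?addr_ge0 ?mulr_ge0 ?(ltW t_gt0).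
  rewrite inE mulr1 => Sw; apply: (le_trans (H1 t z w t01 t2 zN wc)).
  rewrite !mulrDl lerD2r.
  apply: (le_trans (gauss4_le_gauss8 w zN t01)).
  rewrite -/E (_ : E * C2 * t * gw w = E * (C2 * t * gw w))%R; last by ring.
  rewrite ler_wpM2l// ler_wpM2r//; apply: H2; last exact: Sfar.
  by rewrite t_gt0/=; lra.
under eq_integral do rewrite EFinM.
rewrite ge0_integralZl//; first last.
- by rewrite lee_fin !mulr_ge0 ?addr_ge0 ?mulr_ge0 ?(ltW t_gt0).
- by move=> w _; rewrite lee_fin.
- exact/measurable_EFinP.
by rewrite -/I -(fineK Ifin) -EFinM lee_fin mulrAC.
Qed.

Lemma heat_kernel_total N : exists2 C : R, (0 <= C)%R &
  forall t z, (0 < t <= t0 / 4)%R -> (t <= 2^-1)%R -> core N z ->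
  exists p : R, \int[mu]_w (heat_kernel_sub t z w)%:E = p%:E /\
    (1 - C * t <= p <= 1 + C * t)%R.
Proof.
have [C1 C10 H1] := heat_kernel_sub_le_gauss n m t0_gt0 N.
have [C2 C20 H2] := integral_gauss4 N.
have gw0 w : (0 <= gw w)%R by exact: expR_ge0.
have igw := integral_gauss_weight_lty.
set I := \int[mu]_w (gw w)%:E in igw.
have I0 : 0 <= I by apply: integral_ge0 => w _; rewrite lee_fin.
have Ifin : I \is a fin_num by rewrite ge0_fin_numE.
have fI0 : (0 <= fine I)%R by rewrite fine_ge0.
have cgw0 t w : (0 < t)%R -> (0 <= C1 * t * gw w)%R.
  by move=> t_gt0; rewrite !mulr_ge0 ?(ltW t_gt0).
exists (C2 + C1 * fine I)%R; first by rewrite addr_ge0 ?mulr_ge0.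
move=> t z t01 t2 zN; have /andP[t_gt0 _] := t01.
have [p [Hp /andP[p1 p2]]] := H2 t z t_gt0 zN.
have lo : p%:E <= \int[mu]_w (heat_kernel_sub t z w)%:E.
  rewrite -Hp; apply: le_integral_cell => [w|w|w wc].
  - exact: gauss_ge0.
  - exact: heat_kernel_sub_ge0.
  - apply: gauss_le_heat_kernel_sub => //; first by rewrite t_gt0.
    exact: core_cell zN.
have hi : \int[mu]_w (heat_kernel_sub t z w)%:E <= (p + C1 * t * fine I)%:E.
  apply: (@le_trans _ _ (\int[mu]_w (gauss 4 t z w + C1 * t * gw w)%R%:E)).
    apply: le_integral_cell => [w|w|w wc].
    - exact: heat_kernel_sub_ge0.
    - by rewrite addr_ge0 ?gauss_ge0 ?cgw0.
    - exact: H1.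
  have mg4 := measurable_gauss 4 t z.
  under eq_integral do rewrite EFinD (EFinM (C1 * t)).
  rewrite ge0_integralD//; first last.
  - by apply: measurable_funeM; exact/measurable_EFinP.
  - by move=> w _; rewrite -EFinM lee_fin cgw0.
  - exact/measurable_EFinP.
  - by move=> w _; rewrite lee_fin gauss_ge0.
  rewrite Hp EFinD leeD2l// ge0_integralZl//; first last.
  - by rewrite lee_fin mulr_ge0 ?(ltW t_gt0).
  - by move=> w _; rewrite lee_fin.
  - exact/measurable_EFinP.
  by rewrite -/I -(fineK Ifin) -EFinM.
have fin : \int[mu]_w (heat_kernel_sub t z w)%:E \is a fin_num.
  rewrite ge0_fin_numE; first by apply: le_lt_trans hi _; exact: ltry.
  by apply: integral_ge0 => w _; rewrite lee_fin heat_kernel_sub_ge0.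
exists (fine (\int[mu]_w (heat_kernel_sub t z w)%:E)); split; first by rewrite fineK.
move: lo hi; rewrite -(fineK fin) !lee_fin /= => lo hi.
have : (0 <= C1 * t * fine I)%R by rewrite !mulr_ge0 ?(ltW t_gt0).
by rewrite mulrDl (mulrAC C1); move=> ?; apply/andP; split; lra.
Qed.

End gaussian_mass.

(** * Almost everywhere convergence *)

Section heat_means.
Context (R : realType) (n m : nat).
Local Notation WG := (waveguide R n m).
Local Notation mu := (WG_measure R n m).
Implicit Types (t : R) (z w : WG) (f g : WG -> R).

Lemma core_covers : exists Z, [/\ measurable Z, mu Z = 0%E &
  forall z, ~ Z z -> exists N, core N z].
Proof.
pose H (i : 'I_n) := [set z : WG | tnth z.1 i = - 2^-1 :> R].
have mH i : measurable (H i) by exact: measurable_hyperplane1.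
have mN := @measurable_not_cell R n m.
exists ([set z : WG | ~ unit_cell z.1] `|` \big[setU/set0]_(i < n) H i); split.
- by apply: measurableU => //; apply: bigsetU_measurable.
- apply: measure_setU_null => //; first exact: bigsetU_measurable.
    exact: WG_measure_not_cell.
  by apply: measure_bigsetU_null => // i; exact: WG_measure_hyperplane1.
move=> z /not_orP[/contrapT zc nH].
have z1 i : - 2^-1 < (tnth z.1 i : R) < 2^-1.
  have /andP[h1 h2] := zc i; rewrite h2 andbT lt_neqAle h1 andbT eq_sym.
  by apply/eqP => E; apply: nH; rewrite (bigD1 i)//=; left.
have /choice[k Hk] : forall i, exists k : nat, `|tnth z.1 i : R| <= 2^-1 - k.+1%:R^-1.
  move=> i; have : 0 < 2^-1 - `|tnth z.1 i : R|.
    by rewrite subr_gt0 ltr_norml; exact: z1.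
  set e := _ - _ => e0; exists (Num.bound e^-1).
  rewrite lerBrDr -lerBrDl -/e invf_ple ?posrE//.
  apply/ltW/(lt_le_trans (archi_boundP _)); first by rewrite invr_ge0 ltW.
  by rewrite ler_nat.
exists (\max_(i < n) k i + Num.bound (sqnorm z.2))%N; split.
  move=> i; apply: (le_trans (Hk i)); rewrite lerD2l lerN2 lef_pV2 ?posrE//.
  by rewrite ler_nat ltnS (leq_trans (leq_bigmax i))// leq_addr.
apply/ltW/(lt_le_trans (archi_boundP (sqnorm_ge0 _))).
by rewrite ler_nat leq_addl.
Qed.

Variable t0 : R.
Hypothesis t0_gt0 : 0 < t0.
Local Notation gw := (@gauss_weight R n m t0).

Definition heat_mean t f z : R := \int[mu]_w (heat_kernel_sub t z w * f w).

Definition weighted_integrable f : Prop :=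
  measurable_fun setT f /\ (\int[mu]_w (`|f w| * gw w)%:E < +oo)%E.

Let wt f w : R := `|f w| * gw w.

Definition heat_time : R := Num.min (t0 / 4) 2^-1.

Lemma heat_time_gt0 : 0 < heat_time.
Proof. by rewrite lt_min divr_gt0//=. Qed.

Definition regular_point f z : Prop :=
  (exists N, core N z) /\ (wg_maximal (wt f) z < +oo)%E.

Let gw0 w : 0 <= gw w. Proof. exact: expR_ge0. Qed.

Let wt_ge0 f w : 0 <= wt f w. Proof. by rewrite mulr_ge0. Qed.

Let mwt f : measurable_fun setT f -> measurable_fun setT (wt f).
Proof.
move=> mf; apply: measurable_funM; first exact: measurableT_comp.
exact: measurable_gauss_weight.
Qed.

Lemma regular_point_ae f : weighted_integrable f ->
  exists Z, [/\ measurable Z, mu Z = 0%E & forall z, ~ Z z -> regular_point f z].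
Proof.
move=> [mf fy]; have [Z1 [mZ1 Z10 H1]] := core_covers.
have [|Z2 [mZ2 Z20 H2]] := @wg_maximal_fin R n m (wt f) _ fy.
  by split => // w; exact: mwt.
exists (Z1 `|` Z2); split.
- exact: measurableU.
- exact: measure_setU_null.
- by move=> z /not_orP[/H1 ? /H2 ?]; split.
Qed.

Lemma heat_kernel_abs_le f z : measurable_fun setT f -> regular_point f z ->
  exists2 C : R, 0 <= C & forall t, 0 < t <= heat_time ->
  (\int[mu]_w (heat_kernel_sub t z w * `|f w|)%:E <= C%:E)%E.
Proof.
move=> mf [[N zN] fin]; have [C C0 HC] := @heat_kernel_maximal_le R n m t0 t0_gt0 N.
have fn : wg_maximal (wt f) z \is a fin_num by rewrite ge0_fin_numE// wg_maximal_ge0.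
exists (C * fine (wg_maximal (wt f) z)).
  by rewrite mulr_ge0// fine_ge0// wg_maximal_ge0.
move=> t /andP[t1]; rewrite le_min => /andP[t2 t3].
rewrite EFinM fineK//; apply: HC => //; first by rewrite t1.
by split => //; exact: measurableT_comp.
Qed.

Lemma heat_kernel_integrable t f z : measurable_fun setT f -> regular_point f z ->
  0 < t <= heat_time -> mu.-integrable setT (EFin \o (fun w => heat_kernel_sub t z w * f w)).
Proof.
move=> mf rf t01; apply/integrableP; split.
  by apply/measurable_EFinP; apply: measurable_funM => //; exact: measurable_heat_kernel_sub.
have [C C0 HC] := heat_kernel_abs_le mf rf.
apply: le_lt_trans (ltry C); apply: le_trans (HC t t01); rewrite le_eqVlt; apply/orP; left.
by apply/eqP/eq_integral => w _ /=; rewrite normrM ger0_norm// heat_kernel_sub_ge0.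
Qed.

Lemma heat_mean_comb t f g (c : R) z : measurable_fun setT f -> measurable_fun setT g ->
  regular_point f z -> regular_point g z -> 0 < t <= heat_time ->
  heat_mean t (fun w => f w + c * g w) z = heat_mean t f z + c * heat_mean t g z.
Proof.
move=> mf mg rf rg t01.
have If := heat_kernel_integrable mf rf t01; have Ig := heat_kernel_integrable mg rg t01.
rewrite /heat_mean -RintegralZl// -RintegralD//; last first.
  by have := integrableZl measurableT c Ig.
by apply: eq_Rintegral => w _; ring.
Qed.

Definition converges_ae f : Prop := exists Z, [/\ measurable Z, mu Z = 0%E &
  forall z, ~ Z z -> heat_mean t f z @[t --> 0^'+] --> f z].

Lemma near_heat_time : \forall t \near 0^'+, 0 < t <= heat_time.
Proof.
have h0 := heat_time_gt0; near=> t; apply/andP; split; near: t.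
  exact: nbhs_right_gt.
exact: nbhs_right_le.
Unshelve. all: by end_near. Qed.

Lemma weighted_integrable_comb f g (c : R) : weighted_integrable f -> weighted_integrable g ->
  weighted_integrable (fun w => f w + c * g w).
Proof.
move=> [mf fy] [mg gy]; split.
  by apply: measurable_funD => //; exact: measurable_funM.
apply: (@le_lt_trans _ _ (\int[mu]_w ((wt f w)%:E + `|c|%:E * (wt g w)%:E))%E).
  apply: le_integral_nomeas => w; first by rewrite lee_fin mulr_ge0.
  rewrite -EFinM -EFinD lee_fin mulrA -mulrDl ler_wpM2r//.
  by rewrite (le_trans (ler_normD _ _))// normrM.
have mf' := mwt mf; have mg' := mwt mg.
rewrite ge0_integralD//; first last.
- by apply: measurable_funeM; exact/measurable_EFinP.
- by move=> w _; rewrite mule_ge0 ?lee_fin.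
- exact/measurable_EFinP.
- by move=> w _; rewrite lee_fin.
rewrite ge0_integralZl//; first last.
- by move=> w _; rewrite lee_fin.
- exact/measurable_EFinP.
by rewrite lte_add_pinfty// lte_mul_pinfty// lee_fin.
Qed.

Lemma converges_ae_comb f g (c : R) : weighted_integrable f -> weighted_integrable g ->
  converges_ae f -> converges_ae g -> converges_ae (fun w => f w + c * g w).
Proof.
move=> wf wg [Z1 [mZ1 Z10 H1]] [Z2 [mZ2 Z20 H2]].
have [Z3 [mZ3 Z30 H3]] := regular_point_ae wf.
have [Z4 [mZ4 Z40 H4]] := regular_point_ae wg.
exists ((Z1 `|` Z2) `|` (Z3 `|` Z4)); split.
- by apply: measurableU; exact: measurableU.
- by apply: measure_setU_null; [exact: measurableU|exact: measurableU|exact: measure_setU_null..].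
move=> z /not_orP[/not_orP[/H1 c1 /H2 c2] /not_orP[/H3 r1 /H4 r2]].
have : heat_mean t f z + c * heat_mean t g z @[t --> 0^'+] --> f z + c * g z.
  by apply: cvgD => //; apply: cvgM => //; exact: cvg_cst.
apply: cvg_trans; apply: near_eq_cvg.
near=> t; rewrite heat_mean_comb//; [exact: wf.1|exact: wg.1|].
by near: t; exact: near_heat_time.
Unshelve. all: by end_near. Qed.

(* Summing [2^j |f - h_j|] into a single weighted integrable function lets one *)
(* application of the maximal inequality control all the errors at once.       *)
Lemma converges_ae_closed f : weighted_integrable f ->
  (forall e : R, 0 < e -> exists h, [/\ weighted_integrable h, converges_ae h &
     (\int[mu]_w (`|f w - h w| * gw w)%:E <= e%:E)%E]) ->
  converges_ae f.
Proof.
move=> wf H; have mf := wf.1.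
have /choice[h Hh] : forall j : nat, exists h, [/\ weighted_integrable h, converges_ae h &
     (\int[mu]_w (`|f w - h w| * gw w)%:E <= (4 ^- j)%:E)%E].
  by move=> j; apply: H; rewrite invr_gt0 exprn_gt0.
have wh j : weighted_integrable (h j) by case: (Hh j).
have /choice[Z HZ] : forall j, exists Z, [/\ measurable Z, mu Z = 0%E &
  forall z, ~ Z z -> heat_mean t (h j) z @[t --> 0^'+] --> h j z] by move=> j; case: (Hh j).
have wd j : weighted_integrable (fun w => f w - h j w).
  rewrite (_ : (fun w => _) = (fun w => f w + (-1) * h j w)).
    exact: weighted_integrable_comb.
  by apply/funext => w; rewrite mulN1r.
pose F j := wt (fun w => f w - h j w).
have mF j : measurable_fun setT (F j) by apply: mwt; exact: (wd j).1.
have F0 j w : 0 <= F j w by exact: wt_ge0.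
pose S w : \bar R := (\sum_(j <oo) (2 ^+ j * F j w)%:E)%E.
have s0 j w : (0 <= (2 ^+ j * F j w)%:E)%E by rewrite lee_fin mulr_ge0.
have ms j : measurable_fun setT (fun w => (2 ^+ j * F j w)%:E).
  by apply/measurable_EFinP; exact: measurable_funM.
have S0 w : (0 <= S w)%E by apply: nneseries_ge0.
have mS : measurable_fun setT S by apply: ge0_emeasurable_sum.
have Sy : (\int[mu]_w S w < +oo)%E.
  rewrite /S integral_nneseries//.
  apply: (@le_lt_trans _ _ (\sum_(j <oo) ((2^-1) ^+ j)%:E)%E).
    apply: lee_nneseries => [j _ _|j _]; first exact: integral_ge0.
    under eq_integral do rewrite EFinM.
    rewrite ge0_integralZl//; last 2 first.
    - exact/measurable_EFinP.
    - by move=> w _; rewrite lee_fin.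
    apply: (@le_trans _ _ ((2 ^+ j)%:E * (4 ^- j)%:E)%E).
      by rewrite lee_wpmul2l//; case: (Hh j).
    have e24 : 2 * 4^-1 = 2^-1 :> R by field.
    by rewrite -EFinM lee_fin -exprVn -exprMn e24 lexx.
  exact: le_lt_trans (nneseries_half_le2 R) (ltry _).
have [ZS [mZS ZS0 HS]] := integral_lty_fin_off_null mS S0 Sy.
pose G w := fine (S w).
have aG : nonneg_measurable G.
  by split => [|w]; [exact: measurableT_comp|rewrite fine_ge0].
have Gy : (\int[mu]_w (G w)%:E < +oo)%E.
  apply: le_lt_trans Sy; apply: le_integral_nomeas => w; first by rewrite lee_fin aG.2.
  by rewrite /G; case: (S w) (S0 w) => [r| |]//= _; rewrite leey.
have FG j w : ~ ZS w -> F j w <= 2^-1 ^+ j * G w.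
  move=> nZ; rewrite exprVn ler_pdivlMl ?exprn_gt0//.
  have fS : S w \is a fin_num by rewrite ge0_fin_numE// HS.
  rewrite -lee_fin fineK//; apply: le_trans (nneseries_lim_ge j.+1 _) => //.
  by rewrite big_nat_recr//= leeDr// sume_ge0.
have [ZG [mZG ZG0 HG]] := wg_maximal_fin aG Gy.
have [Zf [mZf Zf0 Hf]] := regular_point_ae wf.
have /choice[Zh HZh] := fun j => regular_point_ae (wh j).
pose ZZ := \bigcup_j (Z j `|` Zh j).
have mZZj j : measurable (Z j `|` Zh j) /\ mu (Z j `|` Zh j) = 0%E.
  have [? ? _] := HZ j; have [? ? _] := HZh j.
  by split; [exact: measurableU|exact: measure_setU_null].
have mZZ : measurable ZZ by apply: bigcupT_measurable => j; exact: (mZZj j).1.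
have ZZ0 : mu ZZ = 0%E.
  apply/negligibleP => //; apply: negligible_bigcup => j.
  by apply/negligibleP; [exact: (mZZj j).1|exact: (mZZj j).2].
exists ((ZS `|` ZG) `|` (Zf `|` ZZ)); split.
- by apply: measurableU; exact: measurableU.
- by apply: measure_setU_null; [exact: measurableU|exact: measurableU|exact: measure_setU_null..].
move=> z /not_orP[/not_orP[nZS /HG NGz] /not_orP[/Hf rf nZZ]].
have rh j : regular_point (h j) z.
  by have [_ _] := HZh j; apply; apply: contra_not nZZ => zj; exists j => //; right.
have ch j : heat_mean t (h j) z @[t --> 0^'+] --> h j z.
  by have [_ _] := HZ j; apply; apply: contra_not nZZ => zj; exists j => //; left.
have [N zN] := rf.1.
have [C C0 HC] := @heat_kernel_maximal_le R n m t0 t0_gt0 N.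
have NGf : wg_maximal G z \is a fin_num.
  by rewrite ge0_fin_numE//; apply: wg_maximal_ge0 => w; exact: aG.2.
set M := fine (wg_maximal G z).
have M0 : 0 <= M by rewrite fine_ge0// wg_maximal_ge0// => w; exact: aG.2.
have gwz : 0 < gw z by exact: gauss_weight_gt0.
have mean_err j t : 0 < t <= heat_time ->
    `|heat_mean t f z - heat_mean t (h j) z| <= C * (2^-1 ^+ j * M).
  move=> t01.
  have md := (wd j).1.
  have Id : mu.-integrable setT (EFin \o (fun w => heat_kernel_sub t z w * f w)).
    exact: heat_kernel_integrable.
  have Ih : mu.-integrable setT (EFin \o (fun w => heat_kernel_sub t z w * h j w)).
    by apply: heat_kernel_integrable => //; exact: (wh j).1.
  rewrite /heat_mean -RintegralB//.
  apply: le_trans (le_normr_Rintegral _ _) _ => //.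
    exact: (integrableB measurableT Id Ih).
  have t1 := t01; move: t1 => /andP[t1]; rewrite le_min => /andP[t2 t3].
  rewrite -lee_fin /Rintegral.
  have le1 : (\int[mu]_w `|heat_kernel_sub t z w * f w - heat_kernel_sub t z w * h j w|%:E <=
     (C * (2^-1 ^+ j * M))%:E)%E.
    rewrite (_ : (\int[mu]_w _ = \int[mu]_w (heat_kernel_sub t z w * `|f w - h j w|)%:E)%E); last first.
      apply: eq_integral => w _; congr EFin.
      by rewrite -mulrBr normrM ger0_norm// heat_kernel_sub_ge0.
    apply: (@le_trans _ _ (C%:E * wg_maximal (F j) z)%E).
      apply: HC => //; first by rewrite t1.
      by split => //; exact: measurableT_comp.
    rewrite EFinM lee_wpmul2l ?lee_fin//.
    apply: (@le_trans _ _ (wg_maximal (fun w => 2^-1 ^+ j * G w) z)).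
      apply: (wg_maximal_le_off_null z mZS ZS0) => // w; last exact: FG.
      by rewrite mulr_ge0// aG.2.
    by rewrite EFinM fineK//; exact: wg_maximalZ_le.
  rewrite fineK//; rewrite ge0_fin_numE; first by apply: le_lt_trans le1 _; exact: ltry.
  by apply: integral_ge0 => w _; rewrite lee_fin.
apply/cvgrPdist_le => e e0.
pose K := C * M + G z / gw z.
have K0 : 0 <= K by apply: addr_ge0; [exact: mulr_ge0|apply: divr_ge0; [exact: aG.2|exact: ltW]].
have [j Hj] : exists j : nat, 2^-1 ^+ j * K <= e / 2.
  have [j jK] := exists_exp2_ge (K / (e / 2)); exists j.
  by rewrite exprVn mulrC ler_pdivrMr ?exprn_gt0// mulrC -ler_pdivrMr ?divr_gt0.
have fz : `|f z - h j z| <= 2^-1 ^+ j * (G z / gw z).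
  rewrite mulrA ler_pdivlMr//; exact: FG.
near=> t.
have t01 : 0 < t <= heat_time by near: t; exact: near_heat_time.
have c1 : `|h j z - heat_mean t (h j) z| <= e / 2.
  near: t; move/cvgrPdist_le: (ch j); apply; exact: divr_gt0.
have c2 := mean_err j t t01.
have -> : f z - heat_mean t f z = (f z - h j z) + (h j z - heat_mean t (h j) z)
   - (heat_mean t f z - heat_mean t (h j) z) by ring.
apply: le_trans (ler_normB _ _) _; apply: le_trans (lerD (ler_normD _ _) (lexx _)) _.
move: Hj; rewrite /K mulrDr => Hj.
move: c2; rewrite mulrCA => c2.
have : `|f z - h j z| + `|h j z - heat_mean t (h j) z| + `|heat_mean t f z - heat_mean t (h j) z| <=
   2^-1 ^+ j * (G z / gw z) + e / 2 + 2^-1 ^+ j * (C * M) by rewrite !lerD.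
by move=> /le_trans; apply; move: Hj; set a := _ * (C * M); set b := _ * (G z / _); lra.
Unshelve. all: by end_near. Qed.

End heat_means.

Section heat_mean_convergence.
Context (R : realType) (n m : nat).
Local Notation Rm := (measurableTypeR R).
Local Notation WG := (waveguide R n m).
Local Notation mu := (WG_measure R n m).
Implicit Types (z w : WG).

Definition ray (a : \bar R) : set R := [set s | (s%:E < a)%E].

Definition ray_box (a : 'I_n -> \bar R) (b : 'I_m -> \bar R) : set WG :=
  wbox (fun i => ray (a i)) (fun j => ray (b j)).

Definition ray_boxes : set (set WG) := [set S | exists a b, S = ray_box a b].

Lemma measurable_ray a : measurable (ray a : set Rm).
Proof.
rewrite (_ : ray a = EFin @^-1` `]-oo, a[%classic); last first.
  by apply/seteqP; split => s; rewrite /ray /= in_itv.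
rewrite -[X in measurable X]setTI.
exact: (EFin_measurable measurableT (emeasurable_itv _)).
Qed.

Lemma rayI a b : ray a `&` ray b = ray (Order.min a b).
Proof.
apply/seteqP; split => s; rewrite /ray /= lt_min; first by case=> -> ->.
by move=> /andP.
Qed.

Lemma ray_open a (s : R) : s%:E <> a -> exists2 rho : R, 0 < rho &
  forall s', `|s - s'| < rho -> (ray a s' <-> ray a s).
Proof.
rewrite /ray /=; case: a => [a| |] sa.
- exists `|s - a|; first by rewrite normr_gt0 subr_eq0; apply/eqP => E; apply: sa; rewrite E.
  move=> s'; rewrite !lte_fin; have [sa'|sa'|E] := ltgtP s a.
  + by rewrite [X in _ < X]ltr0_norm ?subr_lt0// ltr_norml => /andP[? ?]; split => //; lra.
  + rewrite [X in _ < X]gtr0_norm ?subr_gt0// ltr_norml => /andP[? ?]; split => // s'a; suff : a < s' by rewrite ltNge (ltW s'a).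
    lra.
  + by rewrite E subrr normr0 normr_lt0.
- by exists 1 => // s' _; rewrite !ltry.
- by exists 1 => // s' _; rewrite !ltNge !leNye.
Qed.

Lemma ray_boxes_setI : setI_closed ray_boxes.
Proof.
move=> _ _ [a1 [b1 ->]] [a2 [b2 ->]].
exists (fun i => Order.min (a1 i) (a2 i)), (fun j => Order.min (b1 j) (b2 j)).
apply/seteqP; split => z.
  by move=> [[H1 H2] [H3 H4]]; split => i; rewrite -rayI; split.
move=> [H1 H2]; split; split => i.
- by have := H1 i; rewrite -rayI => -[].
- by have := H2 i; rewrite -rayI => -[].
- by have := H1 i; rewrite -rayI => -[].
- by have := H2 i; rewrite -rayI => -[].
Qed.

Lemma ray_boxes_generate : @measurable _ WG = <<s ray_boxes >>.
Proof.
apply/seteqP; split; last first.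
  apply: smallest_sub; first exact: sigma_algebra_measurable.
  by move=> _ [a [b ->]]; apply: measurable_wbox => i; exact: measurable_ray.
suff mid : measurable_fun setT (id : g_sigma_algebraType ray_boxes -> WG).
  by move=> A mA; have := mid measurableT A mA; rewrite setTI preimage_id.
pose ray_coord (k : 'I_n + 'I_m) (c : R) : set WG :=
  match k with inl i => [set z : WG | tnth z.1 i < c] | inr j => [set z : WG | tnth z.2 j < c] end.
have genR k c : <<s ray_boxes >> (ray_coord k c).
  apply: sub_sigma_algebra.
  exists (fun i => if k is inl i0 then (if i == i0 then c%:E else +oo%E) else +oo%E).
  exists (fun j => if k is inr j0 then (if j == j0 then c%:E else +oo%E) else +oo%E).
  case: k => [i0|j0] /=; apply/seteqP; split => z /=.
  - move=> zc; split => [i|j]; rewrite /ray /= ?ltry//.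
    by case: eqP => [->|_]; rewrite ?lte_fin ?ltry.
  - by move=> [H _]; have := H i0; rewrite /ray /= eqxx lte_fin.
  - move=> zc; split => [i|j]; rewrite /ray /= ?ltry//.
    by case: eqP => [->|_]; rewrite ?lte_fin ?ltry.
  - by move=> [_ H]; have := H j0; rewrite /ray /= eqxx lte_fin.
apply/measurable_fun_pairP; split; apply/measurable_fun_tnthP => i;
  apply: (measurability _ (RGenInftyO.measurableE R)) => /= _ [_ [c ->] <-]; rewrite setTI.
- rewrite (_ : _ @^-1` _ = ray_coord (inl i) c); first exact: genR.
  by apply/seteqP; split => z; rewrite /= in_itv.
- rewrite (_ : _ @^-1` _ = ray_coord (inr i) c); first exact: genR.
  by apply/seteqP; split => z; rewrite /= in_itv.
Qed.


Lemma ray_box_local a b : exists Z, [/\ measurable Z, mu Z = 0%E &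
  forall z, ~ Z z -> exists2 rho : R, 0 < rho &
    forall w, near_box rho z w -> (ray_box a b w <-> ray_box a b z)].
Proof.
pose H1 (i : 'I_n) := [set z : WG | tnth z.1 i = fine (a i) :> R].
pose H2 (j : 'I_m) := [set z : WG | tnth z.2 j = fine (b j) :> R].
have mH1 i : measurable (H1 i) by exact: measurable_hyperplane1.
have mH2 j : measurable (H2 j) by exact: measurable_hyperplane2.
exists ((\big[setU/set0]_(i < n) H1 i) `|` (\big[setU/set0]_(j < m) H2 j)); split.
- by apply: measurableU; apply: bigsetU_measurable.
- apply: measure_setU_null; [exact: bigsetU_measurable|exact: bigsetU_measurable|..].
    by apply: measure_bigsetU_null => // i; exact: WG_measure_hyperplane1.
  by apply: measure_bigsetU_null => // j; exact: WG_measure_hyperplane2.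
move=> z /not_orP[n1 n2].
have za i : ((tnth z.1 i : R)%:E <> a i)%E.
  by move=> E; apply: n1; rewrite (bigD1 i)//=; left; rewrite /H1 /= -E.
have zb j : ((tnth z.2 j : R)%:E <> b j)%E.
  by move=> E; apply: n2; rewrite (bigD1 j)//=; left; rewrite /H2 /= -E.
have /choice[r1 Hr1] : forall i, exists rho : R, 0 < rho /\
    forall s', `|(tnth z.1 i : R) - s'| < rho -> (ray (a i) s' <-> ray (a i) (tnth z.1 i)).
  by move=> i; have [rho ? ?] := ray_open (za i); exists rho.
have /choice[r2 Hr2] : forall j, exists rho : R, 0 < rho /\
    forall s', `|(tnth z.2 j : R) - s'| < rho -> (ray (b j) s' <-> ray (b j) (tnth z.2 j)).
  by move=> j; have [rho ? ?] := ray_open (zb j); exists rho.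
exists (Order.min (\big[Order.min/1]_(i < n) r1 i) (\big[Order.min/1]_(j < m) r2 j)).
  rewrite lt_min; apply/andP; split; apply: lt_bigmin => // i _.
    by case: (Hr1 i).
  by case: (Hr2 i).
move=> w [W1 W2].
have L1 i : `|(tnth z.1 i : R) - tnth w.1 i| < r1 i.
  apply: lt_le_trans (W1 i) _; rewrite ge_min; apply/orP; left; exact: bigmin_le_cond.
have L2 j : `|(tnth z.2 j : R) - tnth w.2 j| < r2 j.
  apply: lt_le_trans (W2 j) _; rewrite ge_min; apply/orP; right; exact: bigmin_le_cond.
split => -[B1 B2]; split => i.
- by apply/((Hr1 i).2 _ (L1 i)).
- by apply/((Hr2 i).2 _ (L2 i)).
- by apply/((Hr1 i).2 _ (L1 i)).
- by apply/((Hr2 i).2 _ (L2 i)).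
Qed.

End heat_mean_convergence.

Section heat_mean_convergence_ae.
Context (R : realType) (n m : nat).
Local Notation WG := (waveguide R n m).
Local Notation mu := (WG_measure R n m).
Implicit Types (t : R) (z w : WG) (f g : WG -> R).
Variable t0 : R.
Hypothesis t0_gt0 : 0 < t0.
Local Notation gw := (@gauss_weight R n m t0).
Local Notation weighted_integrable := (@weighted_integrable R n m t0).
Local Notation heat_time := (heat_time t0).

Lemma weighted_integrable_le f g : measurable_fun setT f -> weighted_integrable g ->
  (forall w, `|f w| <= `|g w|) -> weighted_integrable f.
Proof.
move=> mf [_ gy] fg; split => //; apply: le_lt_trans gy.
apply: le_integral_nomeas => w; rewrite lee_fin; first by rewrite mulr_ge0// expR_ge0.
by rewrite ler_wpM2r ?expR_ge0.
Qed.

Lemma weighted_integrable1 : weighted_integrable (fun=> 1).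
Proof.
split => //; under eq_integral do rewrite normr1 mul1r.
exact: integral_gauss_weight_lty.
Qed.

Lemma weighted_integrable_indic (S : set WG) : measurable S ->
  weighted_integrable (\1_S : WG -> R).
Proof.
move=> mS; apply: weighted_integrable_le weighted_integrable1 _ => //.
by move=> w; rewrite normr1 ger0_norm// indicE lern1 leq_b1.
Qed.

Lemma converges_ae_dominated f D (h : nat -> WG -> R) : measurable_fun setT f ->
  weighted_integrable D -> (forall k, measurable_fun setT (h k)) ->
  (forall k, converges_ae (h k)) -> (forall k w, `|h k w| <= D w) ->
  (forall w, h k w @[k --> \oo] --> f w) -> converges_ae f.
Proof.
move=> mf wD mh ch hD hf.
have mgw := @measurable_gauss_weight R n m t0.
have gw0 w : 0 <= gw w by exact: expR_ge0.
have D0 w : 0 <= D w by apply: le_trans (hD 0%N w).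
have fD w : `|f w| <= D w.
  have : `|h k w| @[k --> \oo] --> `|f w| by exact: cvg_norm.
  move=> c; have := cvg_lim (@Rhausdorff R) c; move=> <-.
  apply: limr_le; first by apply/cvg_ex; exists `|f w|.
  by apply: nearW => k; exact: hD.
have wh k : weighted_integrable (h k).
  by apply: weighted_integrable_le wD _ => // w; rewrite [X in _ <= X]ger0_norm.
have wf : weighted_integrable f.
  by apply: weighted_integrable_le wD _ => // w; rewrite [X in _ <= X]ger0_norm.
have cw : {ae mu, forall w, setT w -> (h k w * gw w)%:E @[k --> \oo] --> (f w * gw w)%:E}.
  apply: aeW => w _; apply/fine_cvgP; split; first exact: nearW.
  by apply: cvgM => //; exact: cvg_cst.
have iD : mu.-integrable setT (fun w => (D w * gw w)%:E).
  apply/integrableP; split.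
    by apply/measurable_EFinP; apply: measurable_funM => //; exact: wD.1.
  by under eq_integral do rewrite /= normrM (ger0_norm (gw0 _)); exact: wD.2.
have hDw : {ae mu, forall w k, setT w -> (`|(h k w * gw w)%:E| <= (D w * gw w)%:E)%E}.
  by apply: aeW => w k _; rewrite /= lee_fin normrM (ger0_norm (gw0 _)) ler_wpM2r.
have [_ + _] := @dominated_convergence _ _ R mu setT measurableT
  (fun k w => (h k w * gw w)%:E) (fun w => (f w * gw w)%:E) (fun w => (D w * gw w)%:E)
  (fun k => (measurable_EFinP _ _).2 (measurable_funM (mh k) mgw))
  ((measurable_EFinP _ _).2 (measurable_funM mf mgw))
  cw iD hDw.
move=> /fine_cvgP[ffin c0].
apply: (converges_ae_closed t0_gt0 wf) => e e0.
near \oo => k; exists (h k); split => //.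
rewrite (_ : (\int[mu]_w _ = \int[mu]_w `|(h k w * gw w)%:E - (f w * gw w)%:E|)%E); last first.
  by apply: eq_integral => w _; rewrite /= -mulrBl normrM distrC (ger0_norm (gw0 w)).
rewrite -[X in (X <= _)%E]fineK; last by near: k; exact: ffin.
rewrite lee_fin; apply: (le_trans (ler_norm _)); rewrite -normrN -[X in `|X|]sub0r.
by near: k; move/cvgrPdist_le: c0; apply.
Unshelve. all: by end_near. Qed.

Lemma converges_ae_ray_box a b : converges_ae (\1_(@ray_box R n m a b) : WG -> R).
Proof.
have mS : measurable (@ray_box R n m a b) by apply: measurable_wbox => i; exact: measurable_ray.
set S := ray_box a b in mS *.
have [Z1 [mZ1 Z10 H1]] := core_covers R n m.
have [Z2 [mZ2 Z20 H2]] := ray_box_local a b.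
exists (Z1 `|` Z2); split.
- exact: measurableU.
- exact: measure_setU_null.
move=> z /not_orP[/H1[N zN] /H2[rho rho0 near_S]].
have [C1 C10 HC1] := heat_kernel_far_le n m t0_gt0 N rho0.
have [C2 C20 HC2] := heat_kernel_total n m t0_gt0 N.
have mker t := measurable_heat_kernel_sub t z.
have ker0 t w : 0 <= heat_kernel_sub t z w by exact: heat_kernel_sub_ge0.
have split_total t : (\int[mu]_w (heat_kernel_sub t z w)%:E =
  \int[mu]_w (heat_kernel_sub t z w * \1_S w)%:E + \int[mu]_w (heat_kernel_sub t z w * \1_(~` S) w)%:E)%E.
  rewrite -ge0_integralD//; first last.
  - by apply/measurable_EFinP; apply: measurable_funM => //; apply: measurable_indic; exact: measurableC.
  - by move=> w _; rewrite lee_fin mulr_ge0.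
  - by apply/measurable_EFinP; apply: measurable_funM.
  - by move=> w _; rewrite lee_fin mulr_ge0.
  apply: eq_integral => w _; rewrite -EFinD -mulrDr; congr EFin.
  by rewrite !indicE in_setC; case: (_ \in _); rewrite ?addr0 ?add0r mulr1.
have int0 t (A : set WG) : (0 <= \int[mu]_w (heat_kernel_sub t z w * \1_A w)%:E)%E.
  by apply: integral_ge0 => w _; rewrite lee_fin mulr_ge0.
suff est t : 0 < t <= heat_time ->
    `|\1_S z - heat_mean t (\1_S : WG -> R) z| <= (C1 + C2) * t.
  apply/cvgrPdist_le => e e0.
  have K0 : 0 < C1 + C2 + 1 by rewrite ltr_wpDl// addr_ge0.
  near=> t.
  have t01 : 0 < t <= heat_time by near: t; exact: near_heat_time.
  have te : t <= e / (C1 + C2 + 1) by near: t; apply: nbhs_right_le; exact: divr_gt0.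
  apply: (le_trans (est t t01)).
  apply: (@le_trans _ _ ((C1 + C2 + 1) * t)).
    by rewrite ler_wpM2r ?lerDl//; case/andP: t01 => /ltW.
  by rewrite mulrC -ler_pdivlMr.
move=> /andP[t1]; rewrite le_min => /andP[t2 t3].
have t12 : 0 < t <= t0 / 4 by rewrite t1.
rewrite /heat_mean /Rintegral.
have [p [Hp /andP[p1 p2]]] := HC2 t z t12 t3 zN.
have [zS|zS] := pselect (S z).
  have far w : (~` S) w -> ~ near_box rho z w.
    by move=> nS /near_S[_ /(_ zS)].
  have := HC1 t z _ t12 t3 zN (measurableC mS) far.
  move: (split_total t) (int0 t S) (int0 t (~` S)); rewrite Hp.
  case: (\int[mu]_w _)%E => [q| |] //; case: (\int[mu]_w _)%E => [s| |] // /eqP.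
  rewrite -EFinD eqe => /eqP E; rewrite !lee_fin => q0 s0 sC.
  rewrite indicE mem_set//= ler_norml; apply/andP; split.
    have : 0 <= C1 * t by rewrite mulr_ge0// ltW.
    by rewrite mulrDl; lra.
  by rewrite mulrDl; lra.
have far w : S w -> ~ near_box rho z w.
  by move=> Sw /near_S[/(_ Sw)].
have := HC1 t z _ t12 t3 zN mS far.
move: (int0 t S); case: (\int[mu]_w _)%E => [q| |] //; rewrite !lee_fin => q0 qC.
rewrite indicE memNset//= sub0r normrN ger0_norm//.
by apply: (le_trans qC); rewrite ler_wpM2r ?lerDl// ltW.
Unshelve. all: by end_near. Qed.

Lemma converges_ae_indic (S : set WG) : measurable S -> converges_ae (\1_S : WG -> R).
Proof.
move=> mS.
have indicC (A : set WG) : (\1_(~` A) : WG -> R) = (fun w => \1_[set: WG] w + (-1) * \1_A w).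
  apply/funext => w; rewrite !indicE in_setC in_setT.
  by case: (_ \in _); rewrite /= ?mulr0 ?addr0 ?mulr1 ?subrr.
have sT : [set: WG] = @ray_box R n m (fun=> +oo%E) (fun=> +oo%E).
  by apply/seteqP; split => // w _; split => i; rewrite /ray /= ltry.
have cT : converges_ae (\1_[set: WG] : WG -> R).
  by rewrite sT; exact: converges_ae_ray_box.
apply: (@dynkin_induction _ WG (@ray_boxes R n m) (fun S => converges_ae (\1_S : WG -> R))).
- exact: ray_boxes_generate.
- exact: ray_boxes_setI.
- exact: cT.
- by move=> _ [a [b ->]]; exact: converges_ae_ray_box.
- move=> A mA cA; rewrite indicC; apply: (converges_ae_comb t0_gt0) => //.
    exact: weighted_integrable_indic.
  exact: weighted_integrable_indic.
- move=> F mF tF cF.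
  pose U k := \big[setU/set0]_(j < k) F j.
  have mU k : measurable (U k) by exact: bigsetU_measurable.
  apply: (@converges_ae_dominated _ (fun=> 1) (fun k => \1_(U k))).
  + by apply: measurable_indic; exact: bigcupT_measurable.
  + exact: weighted_integrable1.
  + by move=> k; apply: measurable_indic.
  + elim=> [|k IH].
      rewrite /U big_ord0 -setCT indicC; apply: (converges_ae_comb t0_gt0) => //;
        exact: weighted_integrable_indic.
    rewrite (_ : \1_(U k.+1) = (fun w => \1_(U k) w + 1 * \1_(F k) w)).
      apply: (converges_ae_comb t0_gt0) => //; exact: weighted_integrable_indic.
    apply/funext => w; rewrite /U big_ord_recr /= mul1r !indicE in_setU.
    have [wU|wU] := boolP (w \in \big[setU/set0]_(j < k) F j); last by rewrite add0r.
    have -> : (w \in F k) = false; last by rewrite addr0.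
    apply/negbTE; rewrite notin_setE => wk; move: wU; rewrite inE -bigcup_mkord => -[j /= jk wj].
    by move/trivIsetP: tF => /(_ j k Logic.I Logic.I); rewrite (ltn_eqF jk) => /(_ isT)/seteqP[+ _] => /(_ w); apply.
  + by move=> k w; rewrite ger0_norm// indicE lern1 leq_b1.
  + move=> w; apply: cvg_near_cst; have [[j _ wj]|nw] := pselect ((\bigcup_k F k) w).
      near=> k; rewrite !indicE !mem_set//; first by exists j.
      rewrite /U -bigcup_mkord; exists j => //=.
      by near: k; exact: nbhs_infty_gt.
    apply: nearW => k; rewrite !indicE !memNset//.
    by rewrite /U -bigcup_mkord => -[j _ wj]; apply: nw; exists j.
- by rewrite -ray_boxes_generate.
Unshelve. all: by end_near. Qed.

Lemma converges_ae_sum_indic (I : Type) (s : seq I) (c : I -> R) (A : I -> set WG) :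
  (forall i, measurable (A i)) -> converges_ae (fun w => \sum_(i <- s) c i * \1_(A i) w).
Proof.
move=> mA; have wA i := weighted_integrable_indic (mA i).
suff [_] : weighted_integrable (fun w => \sum_(i <- s) c i * \1_(A i) w) /\
  converges_ae (fun w => \sum_(i <- s) c i * \1_(A i) w) by [].
elim: s => [|i s [IHw IHc]].
  rewrite (_ : (fun w => _) = (fun w => \1_set0 w + 0 * \1_set0 w)); last first.
    by apply/funext => w; rewrite big_nil mul0r addr0 indic0.
  split; first by apply: weighted_integrable_comb => //; exact: weighted_integrable_indic.
  by apply: (converges_ae_comb t0_gt0); [exact: weighted_integrable_indic..|
    exact: converges_ae_indic|exact: converges_ae_indic].
rewrite (_ : (fun w => _) = (fun w => (\sum_(i <- s) c i * \1_(A i) w) + c i * \1_(A i) w)); last first.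
  by apply/funext => w; rewrite big_cons addrC.
split; first exact: weighted_integrable_comb.
by apply: (converges_ae_comb t0_gt0) => //; exact: converges_ae_indic.
Qed.

Lemma converges_ae_ge0 f : weighted_integrable f -> (forall w, 0 <= f w) -> converges_ae f.
Proof.
move=> wf f0; have mf := (measurable_EFinP _ _).2 wf.1.
pose h := nnsfun_approx measurableT mf.
apply: (@converges_ae_dominated f f (fun k => h k)) => //.
- exact: wf.1.
- move=> k; rewrite (_ : (h k : WG -> R) =
    (fun w => \sum_(r <- finmap.enum_fset (fset_set (range (h k)))) r * \1_(h k @^-1` [set r]) w)).
    by apply: converges_ae_sum_indic => r; exact: measurable_sfunP.
  by apply/funext => w; rewrite fimfunE fsbig_finite.
- move=> k w; rewrite ger0_norm// /h nnsfun_approxE -lee_fin; apply: le_approx => //.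
  by move=> x _; rewrite lee_fin.
- move=> w; have /fine_cvgP[_] := cvg_nnsfun_approx measurableT mf (fun w _ => f0 w : (0 <= (f w)%:E)%E) (I : setT w).
  by [].
Qed.

Lemma converges_ae_weighted f : weighted_integrable f -> converges_ae f.
Proof.
move=> wf; have mf := wf.1.
have wp : weighted_integrable (fun w => Num.max (f w) 0).
  apply: weighted_integrable_le wf _; first exact: measurable_maxr.
  by move=> w; rewrite ger0_norm ?le_max ?lexx ?orbT// ge_max ler_norm normr_ge0.
have wn : weighted_integrable (fun w => Num.max (- f w) 0).
  apply: weighted_integrable_le wf _.
    by apply: measurable_maxr => //; exact: measurable_funN.
  by move=> w; rewrite ger0_norm ?le_max ?lexx ?orbT// ge_max -normrN ler_norm normr_ge0.
rewrite (_ : f = (fun w => Num.max (f w) 0 + (-1) * Num.max (- f w) 0)).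
  apply: (converges_ae_comb t0_gt0) => //; apply: converges_ae_ge0 => // w;
    by rewrite le_max lexx orbT.
apply/funext => w; rewrite mulN1r.
have [w0|w0] := leP 0 (f w).
  by rewrite max_r ?subr0// oppr_le0.
by rewrite max_l ?opprK ?add0r// oppr_ge0 ltW.
Qed.

End heat_mean_convergence_ae.

(** * The complex heat convolution *)

Section complex_heat_convolution.
Context (R : realType) (n m : nat).
Local Notation WG := (waveguide R n m).
Local Notation mu := (WG_measure R n m).
Implicit Types (t : R) (z w : WG) (f : WG -> R[i]) (a b : WG -> R).

Definition borel_parts f a b (Z : set WG) : Prop :=
  [/\ measurable_fun setT a, measurable_fun setT b, measurable Z, mu Z = 0%E &
    forall w, ~ Z w -> f w = Complex (a w) (b w)].

Lemma complex_borel_parts f : complex_measurable_fun f -> exists a b Z, borel_parts f a b Z.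
Proof.
move=> [/completed_measurable_borel[a [Z1 [ma mZ1 Z10 H1]]]
        /completed_measurable_borel[b [Z2 [mb mZ2 Z20 H2]]]].
exists a, b, (Z1 `|` Z2); split => //.
- exact: measurableU.
- exact: measure_setU_null.
- by move=> w /not_orP[/H1 <- /H2 <-]; case: (f w).
Qed.

Definition modulus a b w : R := Num.sqrt (a w ^+ 2 + b w ^+ 2).

Lemma modulus_ge0 a b w : 0 <= modulus a b w. Proof. exact: sqrtr_ge0. Qed.

Lemma measurable_modulus a b : measurable_fun setT a -> measurable_fun setT b ->
  measurable_fun setT (modulus a b).
Proof.
move=> ma mb; apply: (eq_measurable_fun (fun w => (a w ^+ 2 + b w ^+ 2) `^ 2^-1)).
  by move=> w _; rewrite powR12_sqrt// addr_ge0 ?sqr_ge0.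
apply: (measurableT_comp (measurable_powR _)).
by apply: measurable_funD; exact: measurable_funX.
Qed.

Lemma normr_le_modulus_l a b w : `|a w| <= modulus a b w.
Proof. by rewrite -sqrtr_sqr ler_sqrt ?addr_ge0 ?sqr_ge0// lerDl sqr_ge0. Qed.

Lemma normr_le_modulus_r a b w : `|b w| <= modulus a b w.
Proof. by rewrite -sqrtr_sqr ler_sqrt ?addr_ge0 ?sqr_ge0// lerDr sqr_ge0. Qed.

Lemma normc_le_sum (x y : R) : Normc.normc (Complex x y) <= `|x| + `|y|.
Proof.
rewrite /= -[leRHS]ger0_norm ?addr_ge0// -sqrtr_sqr ler_sqrt ?sqr_ge0//.
rewrite sqrrD !real_normK ?num_real// addrAC lerDl mulrn_wge0// mulr_ge0//.
Qed.

Section parts.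
Variables (f : WG -> R[i]) (a b : WG -> R) (Z : set WG).
Hypothesis Hf : borel_parts f a b Z.

Let ma : measurable_fun setT a. Proof. by case: Hf. Qed.
Let mb : measurable_fun setT b. Proof. by case: Hf. Qed.
Let mZ : measurable Z. Proof. by case: Hf. Qed.
Let Z0 : mu Z = 0%E. Proof. by case: Hf. Qed.
Let fE w : ~ Z w -> f w = Complex (a w) (b w). Proof. by case: Hf => _ _ _ _; apply. Qed.

Lemma normc_borel w : ~ Z w -> Normc.normc (f w) = modulus a b w.
Proof. by move=> nZ; rewrite fE. Qed.

Lemma heat_conv_finiteE t z : heat_conv_finite t f z =
  (\int[mu]_w (heat_kernel_sub t z w * modulus a b w)%:E < +oo)%E.
Proof.
rewrite /heat_conv_finite; congr (is_true (_ < _)%E).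
by apply: (eq_integral_off_null mZ Z0) => w nZ; rewrite normc_borel.
Qed.

Lemma heat_convE t z : heat_conv t f z = Complex (heat_mean t a z) (heat_mean t b z).
Proof.
rewrite /heat_conv /heat_mean /Rintegral; congr (Complex (fine _) (fine _));
  by apply: (eq_integral_off_null mZ Z0) => w nZ; rewrite fE.
Qed.

Let heat_mean_le t z (c : WG -> R) (M : R) : measurable_fun setT c ->
  (forall w, `|c w| <= modulus a b w) ->
  (\int[mu]_w (heat_kernel_sub t z w * modulus a b w)%:E <= M%:E)%E ->
  `|heat_mean t c z| <= M.
Proof.
move=> mc cm HM.
have ker0 w : 0 <= heat_kernel_sub t z w by exact: heat_kernel_sub_ge0.
have le1 : (\int[mu]_w `|(heat_kernel_sub t z w * c w)%:E| <= M%:E)%E.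
  apply: le_trans HM; apply: le_integral_nomeas => w; first exact: abse_ge0.
  by rewrite /= lee_fin normrM ger0_norm// ler_wpM2l.
have mk : measurable_fun setT (fun w => (heat_kernel_sub t z w * c w)%:E).
  by apply/measurable_EFinP; apply: measurable_funM => //; exact: measurable_heat_kernel_sub.
have Ic : mu.-integrable setT (EFin \o (fun w => heat_kernel_sub t z w * c w)).
  by apply/integrableP; split => //; apply: le_lt_trans le1 _; exact: ltry.
rewrite -lee_fin /heat_mean EFin_normr_Rintegral//.
by apply: le_trans le1; exact: le_abse_integral.
Qed.

Lemma normc_heat_conv_le t z (M : R) :
  (\int[mu]_w (heat_kernel_sub t z w * modulus a b w)%:E <= M%:E)%E ->
  Normc.normc (heat_conv t f z) <= 2 * M.
Proof.
move=> HM; rewrite heat_convE mulr2n mulrDl mul1r; apply: le_trans (normc_le_sum _ _) _.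
by apply: lerD; apply: heat_mean_le HM => // w;
  [exact: normr_le_modulus_l|exact: normr_le_modulus_r].
Qed.

Variable t0 : R.
Hypothesis t0_gt0 : 0 < t0.
Local Notation gw := (@gauss_weight R n m t0).
Hypothesis fw : (\int[mu]_w (modulus a b w * gw w)%:E < +oo)%E.

Let F w := modulus a b w * gw w.

Let wa : weighted_integrable t0 a.
Proof.
split => //; apply: le_lt_trans fw; apply: le_integral_nomeas => w.
  by rewrite lee_fin mulr_ge0 ?expR_ge0.
by rewrite lee_fin ler_wpM2r ?expR_ge0 ?normr_le_modulus_l.
Qed.

Let wb : weighted_integrable t0 b.
Proof.
split => //; apply: le_lt_trans fw; apply: le_integral_nomeas => w.
  by rewrite lee_fin mulr_ge0 ?expR_ge0.
by rewrite lee_fin ler_wpM2r ?expR_ge0 ?normr_le_modulus_r.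
Qed.

Lemma nonneg_measurable_modulus : nonneg_measurable (modulus a b).
Proof. by split; [exact: measurable_modulus|exact: modulus_ge0]. Qed.

Lemma nonneg_measurable_weighted_modulus : nonneg_measurable F.
Proof.
split; last by move=> w; rewrite mulr_ge0 ?modulus_ge0 ?expR_ge0.
by apply: measurable_funM; [exact: measurable_modulus|exact: measurable_gauss_weight].
Qed.

Lemma wg_maximal_modulus_ae : exists Z', [/\ measurable Z', mu Z' = 0%E &
  forall z, ~ Z' z -> (exists N, core N z) /\ (wg_maximal F z < +oo)%E].
Proof.
have [Z1 [mZ1 Z10 H1]] := core_covers R n m.
have [Z2 [mZ2 Z20 H2]] := wg_maximal_fin nonneg_measurable_weighted_modulus fw.
exists (Z1 `|` Z2); split.
- exact: measurableU.
- exact: measure_setU_null.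
- by move=> z /not_orP[/H1 ? /H2 ?]; split.
Qed.

Lemma heat_conv_finite_ae : {ae mu, forall z, forall t, 0 < t <= heat_time t0 -> heat_conv_finite t f z}.
Proof.
have [Z' [mZ' Z'0 H]] := wg_maximal_modulus_ae.
exists Z'; split => // z; apply: contra_notP => /H[[N zN] NF] t /andP[t1].
rewrite le_min => /andP[t2 t3].
have [C C0 HC] := @heat_kernel_maximal_le R n m t0 t0_gt0 N.
rewrite heat_conv_finiteE; apply: le_lt_trans (HC t z _ _ t3 zN nonneg_measurable_modulus) _.
  by rewrite t1.
by rewrite lte_mul_pinfty// lee_fin.
Qed.

Lemma heat_conv_converges_ae : {ae mu, forall z, heat_conv_converges f z}.
Proof.
have [Z' [mZ' Z'0 H']] := heat_conv_finite_ae.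
have [Za [mZa Za0 Ha]] := converges_ae_weighted t0_gt0 wa.
have [Zb [mZb Zb0 Hb]] := converges_ae_weighted t0_gt0 wb.
have mU : measurable ((Z `|` Z') `|` (Za `|` Zb)).
  by apply: measurableU; apply: measurableU.
exists ((Z `|` Z') `|` (Za `|` Zb)); split => //.
  by apply: measure_setU_null; [exact: measurableU|exact: measurableU|exact: measure_setU_null..].
move=> z; apply: contra_notP => /not_orP[/not_orP[nZ nZ'] /not_orP[/Ha ca /Hb cb]].
have fin : forall t, 0 < t <= heat_time t0 -> heat_conv_finite t f z.
  by apply: contrapT => nfin; apply: nZ'; apply: H'.
split.
  near=> t; apply: fin; near: t; exact: near_heat_time.
apply: (@squeeze_cvgr _ _ _ _ (fun=> 0) (fun t => `|heat_mean t a z - a z| + `|heat_mean t b z - b z|)).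
- near=> t; rewrite heat_convE fE//; apply/andP; split; first exact: sqrtr_ge0.
  by rewrite (_ : Complex _ _ - _ = Complex (heat_mean t a z - a z) (heat_mean t b z - b z)) ?normc_le_sum.
- exact: cvg_cst.
- rewrite -[X in _ --> X](addr0 (0 : R)).
  by apply: cvgD; apply/norm_cvg0P; apply/subr_cvg0.
Unshelve. all: by end_near. Qed.

End parts.
End complex_heat_convolution.

(** * The weight class and the maximal operator *)

Section weights.
Context (R : realType) (n m : nat).
Local Notation WG := (waveguide R n m).
Local Notation mu := (WG_measure R n m).
Implicit Types (p : R) (z : WG) (f : WG -> R[i]) (a b u v vb : WG -> R).

Definition positive_or_one (g : WG -> R) z : R := if 0 < g z then g z else 1.

Lemma positive_or_one_gt0 (g : WG -> R) z : 0 < positive_or_one g z.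
Proof. by rewrite /positive_or_one; case: ifPn. Qed.

Lemma measurable_positive_or_one (g : WG -> R) :
  measurable_fun setT g -> measurable_fun setT (positive_or_one g).
Proof. by move=> mg; apply: measurable_fun_ifT => //; exact: measurable_fun_ltr. Qed.

Definition borel_version v vb (Z : set WG) : Prop :=
  [/\ measurable_fun setT vb, forall z, 0 < vb z, measurable Z, mu Z = 0%E &
    forall z, ~ Z z -> v z = vb z].

Lemma weight_borel v : weight v -> exists vb Z, borel_version v vb Z.
Proof.
move=> [/completed_measurable_borel[v' [Z [mv' mZ Z0 H]]] v0].
have mN := @measurable_not_cell R n m.
exists (positive_or_one v'), (Z `|` [set z : WG | ~ unit_cell z.1]); split.
- exact: measurable_positive_or_one.
- exact: positive_or_one_gt0.
- exact: measurableU.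
- by apply: measure_setU_null => //; exact: WG_measure_not_cell.
- by move=> z /not_orP[/H vE /contrapT/v0]; rewrite /positive_or_one vE => ->.
Qed.

Lemma borel_lebesgue_measurable (g : WG -> R) : measurable_fun setT g -> lebesgue_measurable_fun g.
Proof.
move=> mg Y mY; exists (g @^-1` Y); first by rewrite -[X in measurable X]setTI; exact: mg.
by exists set0; rewrite ?setU0//; exact: negligible_set0.
Qed.

Lemma borel_weight u : measurable_fun setT u -> (forall z, 0 < u z) -> weight u.
Proof. by move=> mu_ u0; split => // ; exact: borel_lebesgue_measurable. Qed.

Lemma wLnormE p v vb Zv f a b Z : 0 < p -> borel_version v vb Zv -> borel_parts f a b Z ->
  wLnorm p v (cabs f) = ((\int[mu]_z (modulus a b z `^ p * vb z)%:E) `^ p^-1)%E.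
Proof.
move=> p0 [mvb vb0 mZv Zv0 vE] Hf; have [ma mb mZ Z0 fE] := Hf.
rewrite /wLnorm unlock; congr (_ `^ _)%E.
apply: (@eq_integral_off_null _ _ _ _ (Zv `|` Z)).
- exact: measurableU.
- exact: measure_setU_null.
move=> z /not_orP[/vE-> nZ]; rewrite /cabs (normc_borel Hf nZ) -EFinM abse_EFin poweR_EFin.
rewrite ger0_norm ?mulr_ge0 ?powR_ge0 ?modulus_ge0// powRM ?powR_ge0 ?modulus_ge0//.
by rewrite -powRrM mulVf ?gt_eqF// powRr1// ltW.
Qed.

Lemma wLp_integral_lty p v vb Zv f a b Z : 0 < p -> borel_version v vb Zv -> borel_parts f a b Z ->
  wLp p v f -> (\int[mu]_z (modulus a b z `^ p * vb z)%:E < +oo)%E.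
Proof.
move=> p0 Hv Hf [_]; rewrite (wLnormE p0 Hv Hf).
by apply: lty_poweRy; rewrite invr_neq0// gt_eqF.
Qed.

Lemma hoelder_conjugateE p : 1 < p -> hoelder_conjugate p%:E = (p / (p - 1))%:E.
Proof.
move=> p1; rewrite /hoelder_conjugate/= eqe gt_eqF ?(lt_trans ltr01)//.
by rewrite -EFinB inver subr_eq0 gt_eqF.
Qed.

Definition damped_weight p t0 vb z : R := vb z `^ (- p^-1) * @gauss_weight R n m t0 z.

Lemma measurable_damped_weight p t0 vb : measurable_fun setT vb ->
  measurable_fun setT (damped_weight p t0 vb).
Proof.
move=> mvb; apply: measurable_funM; last exact: measurable_gauss_weight.
by apply: (measurableT_comp (measurable_powR _)).
Qed.

Lemma damped_weight_gt0 p t0 vb z : 0 < vb z -> 0 < damped_weight p t0 vb z.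
Proof. by move=> vb0; rewrite mulr_gt0 ?powR_gt0 ?expR_gt0. Qed.

Lemma D_WG_integral p v vb Zv t0 : 1 < p -> borel_version v vb Zv ->
  (Lnorm mu (hoelder_conjugate p%:E)
    (fun z => (v z `^ (- p^-1) * expR (- (sqnorm z.2 / (4 * t0))))%:E) < +oo)%E =
  (\int[mu]_z (damped_weight p t0 vb z `^ (p / (p - 1)))%:E < +oo)%E.
Proof.
move=> p1 [mvb vb0 mZv Zv0 vE].
have q0 : 0 < p / (p - 1) by rewrite divr_gt0 ?subr_gt0// (lt_trans ltr01).
rewrite hoelder_conjugateE// unlock.
rewrite (@eq_integral_off_null _ _ _ _ Zv _
  (fun z => (damped_weight p t0 vb z `^ (p / (p - 1)))%:E) mZv Zv0); last first.
  move=> z /vE->; rewrite abse_EFin poweR_EFin ger0_norm//.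
  exact/ltW/damped_weight_gt0.
apply/idP/idP; last by move/poweR_lty; apply.
by apply: lty_poweRy; rewrite invr_neq0// gt_eqF.
Qed.

Lemma D_WG_bounded v vb Zv t0 : borel_version v vb Zv ->
  (Lnorm mu (hoelder_conjugate 1%:E)
    (fun z => (v z `^ (- 1^-1) * expR (- (sqnorm z.2 / (4 * t0))))%:E) < +oo)%E <->
  exists M : R, {ae mu, forall z, damped_weight 1 t0 vb z <= M}.
Proof.
move=> [mvb vb0 mZv Zv0 vE].
have aev : {ae mu, forall z, v z = vb z}.
  by exists Zv; split => // z; apply: contra_notP; exact: vE.
rewrite hoelder_conjugate1 unlock WG_measure_gt0; split.
- move=> fin; set g := (X in (ess_sup mu X < _)%E) in fin.
  have [M HM] : exists M : R, (ess_sup mu g <= M%:E)%E.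
    by case: (ess_sup mu g) fin => [x| |]//; [exists x|exists 0; rewrite leNye].
  exists M; move: HM => /ess_supP HM; near=> z.
  have : (g z <= M%:E)%E by near: z.
  rewrite /g /= lee_fin (_ : v z = vb z); last by near: z.
  by apply: le_trans; rewrite ler_norm.
- move=> [M HM]; apply: (@le_lt_trans _ _ M%:E); last exact: ltry.
  apply/ess_supP; near=> z; rewrite /= lee_fin (_ : v z = vb z); last by near: z.
  rewrite ger0_norm; last exact/ltW/damped_weight_gt0.
  by near: z.
Unshelve. all: by end_near. Qed.

End weights.

Section maximal_operator.
Context (R : realType) (n m : nat) (t0 : R).
Hypothesis t0_gt0 : 0 < t0.
Local Notation WG := (waveguide R n m).
Local Notation gw := (@gauss_weight R n m t0).
Implicit Types (t : R) (z w : WG) (f : WG -> R[i]) (a b : WG -> R).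

Lemma heat_maximal_ge0 r f z : 0 < r -> (0 <= heat_maximal r f z)%E.
Proof.
move=> r0; apply: le_trans (_ : (0 <= (Normc.normc (heat_conv (r / 2) f z))%:E)%E) _.
  by rewrite lee_fin; case: (heat_conv _ _ _) => x y; exact: sqrtr_ge0.
apply: ereal_sup_ubound; exists (r / 2) => //=.
by rewrite divr_gt0//= ltr_pdivrMr// ltr_pMr// ltr1n.
Qed.

Lemma heat_maximal_le_core : exists c : nat -> R, (forall N, 1 <= c N) /\
  forall N f a b Z r z, borel_parts f a b Z -> r <= heat_time t0 -> core N z ->
    (heat_maximal r f z <= (c N)%:E * wg_maximal (fun w => modulus a b w * gw w)%R z)%E.
Proof.
have /choice[C HC] := fun N => (let: ex_intro2 C C0 H := @heat_kernel_maximal_le R n m t0 t0_gt0 N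
   in ex_intro (fun C => 0 <= C /\ _) C (conj C0 H)).
exists (fun N => 1 + 2 * C N); split=> [N|N f a b Z r z Hf rh zN].
  by rewrite lerDl mulr_ge0//; case: (HC N).
have [ma mb _ _ _] := Hf; have [C0 {}HC] := HC N.
have c0 : 0 < 1 + 2 * C N by rewrite ltr_pwDl// mulr_ge0.
have M0 : (0 <= wg_maximal (fun w => modulus a b w * gw w)%R z)%E.
  by apply: wg_maximal_ge0 => w; rewrite mulr_ge0 ?modulus_ge0 ?expR_ge0.
case E : (wg_maximal _ _) M0 => [M| |]// M0; last by rewrite gt0_muley ?leey ?lte_fin.
rewrite lee_fin in M0.
apply: ub_ereal_sup => _ [t /= /andP[t1 t2] <-].
rewrite -EFinM lee_fin mulrDl mul1r -mulrA.
have := lt_le_trans t2 rh; rewrite lt_min => /andP[/ltW t3 /ltW t4].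
apply: le_trans (normc_heat_conv_le Hf (_ : (_ <= (C N * M)%:E)%E)) _; last by rewrite lerDr.
rewrite EFinM -E; apply: HC => //; first by rewrite t1.
exact: nonneg_measurable_modulus Hf.
Qed.

End maximal_operator.

Section core_weight.
Context (R : realType) (n m : nat).
Local Notation WG := (waveguide R n m).
Implicit Types (z : WG).

Lemma measurable_core N : measurable (@core R n m N).
Proof.
rewrite (_ : core N = (\big[setI/setT]_(i < n)
    ((fun z : WG => `|tnth z.1 i : R|) @^-1` `]-oo, 2^-1 - N.+1%:R^-1]%classic)) `&`
    ((fun z : WG => sqnorm z.2) @^-1` `]-oo, (N%:R : R)]%classic)); last first.
  apply/seteqP; split => z; rewrite -bigcap_seq /=.
    by move=> [H1 H2]; split => [i _|]; rewrite /= in_itv /=; [exact: H1|exact: H2].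
  move=> [H1]; rewrite in_itv /= => H2; split => // i.
  by have := H1 i (mem_index_enum i); rewrite /= in_itv.
apply: measurableI.
  apply: bigsetI_measurable => i _; rewrite -[X in measurable X]setTI.
  have mi : measurable_fun setT (fun z : WG => `|tnth z.1 i : R|).
    by apply: measurableT_comp => //; exact: (measurableT_comp (measurable_tnth i) measurable_fst).
  by apply: mi => //; exact: measurable_itv.
rewrite -[X in measurable X]setTI.
have ms : measurable_fun setT (fun z : WG => sqnorm z.2).
  apply: measurable_sum => i; apply: measurable_funX.
  exact: (measurableT_comp (measurable_tnth i) measurable_snd).
by apply: ms => //; exact: measurable_itv.
Qed.

Local Open Scope ereal_scope.

Lemma nneseries_half_le1 : \sum_(N <oo) ((2^-1 : R) ^+ N.+1)%:E <= 1.
Proof.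
under eq_eseriesr do rewrite exprS EFinM.
rewrite nneseriesZl; last by move=> k _; rewrite lee_fin exprn_ge0.
apply: (@le_trans _ _ ((2^-1)%:E * 2%:E)).
  by rewrite lee_wpmul2l ?lee_fin//; exact: nneseries_half_le2.
by rewrite -EFinM mulVf.
Qed.

Variable c : nat -> R.
Hypothesis c1 : forall N, (1 <= c N)%R.

Let c0 N : (0 < c N)%R. Proof. exact: lt_le_trans (c1 N). Qed.

Let coef N : R := ((2^-1) ^+ N.+1 / c N)%R.

Let coef_gt0 N : (0 < coef N)%R. Proof. by rewrite divr_gt0// exprn_gt0. Qed.

Let term N z : R := (coef N * \1_(core N) z)%R.

Let term_ge0 N z : 0 <= (term N z)%:E.
Proof. by rewrite lee_fin mulr_ge0// ltW. Qed.

Definition core_series z : \bar R := \sum_(N <oo) ((2^-1) ^+ N.+1 / c N * \1_(core N) z)%:E.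

Lemma core_series_ge0 z : 0 <= core_series z.
Proof. by apply: nneseries_ge0 => N _ _; exact: term_ge0. Qed.

Lemma core_series_le1 z : core_series z <= 1.
Proof.
apply: le_trans nneseries_half_le1; apply: lee_nneseries => [N _ _|N _]; first exact: term_ge0.
rewrite lee_fin -mulrA ler_piMr//; apply: (@le_trans _ _ (c N)^-1%R); last by rewrite invf_le1.
by rewrite ler_piMr ?invr_ge0 ?(ltW (c0 N))// indicE; case: (_ \in _).
Qed.

Lemma core_series_fin z : core_series z \is a fin_num.
Proof.
by rewrite ge0_fin_numE ?core_series_ge0//; apply: le_lt_trans (core_series_le1 z) (ltry _).
Qed.

Lemma core_series_gt0 N z : core N z -> 0 < core_series z.
Proof.
move=> zN; apply: (@lt_le_trans _ _ (\sum_(0 <= i < N.+1) (term i z)%:E)); last first.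
  by apply: (@nneseries_lim_ge _ (fun i => (term i z)%:E)) => i _ _; exact: term_ge0.
rewrite big_nat_recr//=; apply: (@lt_le_trans _ _ (term N z)%:E); last first.
  by rewrite leeDr// sume_ge0.
by rewrite lte_fin /term indicE mem_set// mulr1.
Qed.

Definition core_weight : WG -> R := positive_or_one (fun z => fine (core_series z)).

Lemma core_weightE N z : core N z -> (core_weight z)%:E = core_series z.
Proof.
move=> zN; rewrite /core_weight /positive_or_one -lte_fin fineK ?core_series_fin//.
by rewrite (core_series_gt0 zN) fineK// core_series_fin.
Qed.

Lemma core_weight_gt0 z : (0 < core_weight z)%R.
Proof. exact: positive_or_one_gt0. Qed.

Lemma measurable_core_weight : measurable_fun setT core_weight.
Proof.
apply: measurable_positive_or_one; apply: measurableT_comp => //.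
apply: ge0_emeasurable_sum => [N z _ _|N _]; first exact: term_ge0.
apply/measurable_EFinP; apply: measurable_funM => //.
by apply: measurable_indic; exact: measurable_core.
Qed.

Lemma core_weight_mul_le N z (x y : R) : core N z -> (0 <= y)%R ->
  (forall k, core k z -> (y <= c k * x)%R) -> (core_weight z * y <= x)%R.
Proof.
move=> zN y0 H; rewrite -lee_fin EFinM (core_weightE zN) muleC -nneseriesZl; last first.
  by move=> k _; exact: term_ge0.
have x0 : (0 <= x)%R by have := le_trans y0 (H N zN); rewrite pmulr_rge0.
apply: (@le_trans _ _ (\sum_(k <oo) x%:E * ((2^-1) ^+ k.+1)%:E)).
  apply: lee_nneseries => [k _ _|k _]; first by apply: mule_ge0; [rewrite lee_fin|exact: term_ge0].
  rewrite -!EFinM lee_fin indicE; have [/set_mem/H yx|_] := boolP (_ \in _); last first.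
    by rewrite !mulr0 mulr_ge0.
  rewrite mulr1 mulrA ler_pdivrMr// mulrAC ler_wpM2r//.
  by rewrite mulrC.
rewrite nneseriesZl; last by move=> k _; rewrite lee_fin.
by rewrite -[leRHS]mule1; apply: lee_wpmul2l; [rewrite lee_fin|exact: nneseries_half_le1].
Qed.

End core_weight.

Section strong_type.
Context (R : realType) (n m : nat) (p t0 : R).
Local Notation WG := (waveguide R n m).
Local Notation mu := (WG_measure R n m).
Local Notation gw := (@gauss_weight R n m t0).
Implicit Types (z w : WG) (f : WG -> R[i]).
Hypotheses (p1 : 1 < p) (t0_gt0 : 0 < t0).
Variables (v vb : WG -> R) (Zv : set WG).
Hypothesis Hv : borel_version v vb Zv.
Let q := p / (p - 1).
Hypothesis fin : (\int[mu]_z (damped_weight p t0 vb z `^ q)%:E < +oo)%E.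

Let p0 : 0 < p. Proof. exact: lt_trans p1. Qed.
Let vb0 z : 0 < vb z. Proof. by case: Hv. Qed.
Let mvb : measurable_fun setT vb. Proof. by case: Hv. Qed.
Let s0 z : 0 < damped_weight p t0 vb z. Proof. exact: damped_weight_gt0. Qed.
Let ms : measurable_fun setT (damped_weight p t0 vb).
Proof. exact: measurable_damped_weight. Qed.

Let sigma z : R := damped_weight p t0 vb z `^ q.
Let h (a b : WG -> R) z : R :=
  modulus a b z * vb z `^ p^-1 * damped_weight p t0 vb z `^ (1 - q).

Let adm_sigma : nonneg_measurable sigma.
Proof.
split; last by move=> z; exact: powR_ge0.
exact: (measurableT_comp (measurable_powR q) ms).
Qed.

Let adm_h f a b Z : borel_parts f a b Z -> nonneg_measurable (h a b).
Proof.
move=> [ma mb _ _ _]; split; last by move=> z; rewrite !mulr_ge0 ?modulus_ge0 ?powR_ge0.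
apply: measurable_funM; last exact: (measurableT_comp (measurable_powR _) ms).
apply: measurable_funM; first exact: measurable_modulus.
exact: (measurableT_comp (measurable_powR _) mvb).
Qed.

Let h_sigma a b z : h a b z * sigma z = modulus a b z * gw z.
Proof.
rewrite /h /sigma -!mulrA -powRD; last by rewrite (gt_eqF (s0 z)) implybT.
rewrite subrK powRr1 ?ltW// /damped_weight (mulrA (vb z `^ _)) -powRD.
  by rewrite subrr powRr0 mul1r.
by rewrite (gt_eqF (vb0 z)) implybT.
Qed.

Let hp_sigma a b z : h a b z `^ p * sigma z = modulus a b z `^ p * vb z.
Proof.
rewrite /h /sigma; move: (damped_weight p t0 vb z) (s0 z) => d d0.
rewrite !powRM ?mulr_ge0 ?modulus_ge0 ?powR_ge0// -!powRrM mulVf ?gt_eqF//.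
rewrite powRr1 ?ltW// -mulrA -powRD; last by rewrite (gt_eqF d0) implybT.
rewrite (_ : (1 - q) * p + q = 0) ?powRr0 ?mulr1//.
by rewrite /q; field; rewrite subr_eq0 gt_eqF.
Qed.

Lemma weighted_modulus_lty f a b Z : borel_parts f a b Z -> wLp p v f ->
  (\int[mu]_w (modulus a b w * gw w)%:E < +oo)%E.
Proof.
move=> Hf Lf; have [mh h0] := adm_h Hf; have [msg sg0] := adm_sigma.
have fin' := wLp_integral_lty p0 Hv Hf Lf.
have m1 : measurable_fun setT (fun w => h a b w `^ p * sigma w).
  by apply: measurable_funM => //; exact: (measurableT_comp (measurable_powR _) mh).
apply: (@le_lt_trans _ _ (\int[mu]_w ((sigma w)%:E + (h a b w `^ p * sigma w)%:E))%E).
  apply: le_integral_nomeas => w; first by rewrite lee_fin -h_sigma mulr_ge0.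
  rewrite -h_sigma -EFinD lee_fin -[X in X + _]mul1r -mulrDl ler_wpM2r//.
  have [h1|h1] := leP (h a b w) 1; first by rewrite (le_trans h1)// lerDl powR_ge0.
  by rewrite -[leLHS]powRr1// (le_trans (ler_powR (ltW h1) (ltW p1)))// lerDr.
rewrite ge0_integralD//; first last.
- exact/measurable_EFinP.
- by move=> w _; rewrite lee_fin mulr_ge0 ?powR_ge0.
- exact/measurable_EFinP.
- by move=> w _; rewrite lee_fin.
rewrite lte_add_pinfty//; apply: le_lt_trans fin'.
by apply: le_integral_nomeas => w; rewrite ?hp_sigma// lee_fin -hp_sigma mulr_ge0 ?powR_ge0.
Qed.

(* With [h] as above, [h * sigma] is the weighted modulus of [f] and the norm  *)
(* of [h] in [L^p (sigma mu)] is the norm of [f] in [L^p_v].                   *)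
Lemma heat_maximal_strong r : 0 < r <= heat_time t0 -> exists u : WG -> R, weight u /\
  exists C : R, forall f, wLp p v f ->
    (wLnorm p u (heat_maximal r f) <= C%:E * wLnorm p v (cabs f))%E.
Proof.
move=> /andP[r0 rh]; have [c [c1 Hc]] := heat_maximal_le_core n m t0_gt0.
have mgw : measurable_fun setT gw by exact: measurable_gauss_weight.
have gw0 z : 0 <= gw z by exact: expR_ge0.
have gwy := integral_gauss_weight_lty n m t0_gt0.
have gw1 z : 0 <= gw z <= 1 by rewrite gw0 gauss_weight_le1.
have [K K0 weak] := wg_maximal_weak mgw gw1 gwy.
have [Z1 [mZ1 Z10 H1]] := wg_maximal_fin adm_sigma fin.
pose B z : R := 1 + fine (wg_maximal sigma z).
have Ns0 z : (0 <= wg_maximal sigma z)%E by apply: wg_maximal_ge0; exact: adm_sigma.2.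
have B1 z : 1 <= B z by rewrite lerDl fine_ge0.
have B0 z : 0 < B z by exact: lt_le_trans (B1 z).
have mB : measurable_fun setT B.
  apply: measurable_funD; first exact: measurable_cst.
  by apply: measurableT_comp; [exact: fine_measurable|exact: measurable_wg_maximal].
have NB z : ~ Z1 z -> (wg_maximal sigma z <= (B z)%:E)%E.
  move=> /H1 Ny; rewrite EFinD fineK; last by rewrite ge0_fin_numE.
  by rewrite leeDr.
pose W := @core_weight R n m c.
have W0 z : 0 < W z by exact: core_weight_gt0.
have mW : measurable_fun setT W by exact: measurable_core_weight.
pose u z : R := (W z / B z) `^ p * gw z.
have u0 z : 0 < u z by rewrite mulr_gt0 ?expR_gt0// powR_gt0// divr_gt0.
have mu_ : measurable_fun setT u.
  apply: measurable_funM; last exact: measurable_gauss_weight.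
  apply: (measurableT_comp (measurable_powR _)).
  apply: measurable_funM => //; apply: (eq_measurable_fun (fun z => B z `^ (-1))) => [z _|].
    by rewrite powRN powRr1// ltW.
  exact: (measurableT_comp (measurable_powR _) mB).
exists u; split; first exact: borel_weight.
pose K' := 2 `^ p * (2 * K) * (2 `^ (p - 1) / (2 `^ (p - 1) - 1) * 2 `^ (p - 1)).
have K'0 : 0 <= K'.
  rewrite /K' !mulr_ge0 ?powR_ge0// invr_ge0 subr_ge0.
  by rewrite -[leLHS](powRr0 2) ler_powR ?ler1n// subr_ge0 ltW.
exists (K' `^ p^-1) => f Lf.
have [a [b [Z Hf]]] := complex_borel_parts Lf.1.
have [Z3 [mZ3 Z30 H3]] := wg_maximal_modulus_ae Hf (weighted_modulus_lty Hf Lf).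
have main := marcinkiewicz K0 mgw gw0 gwy
  (fun F _ => measurable_wg_maximal F) (fun F z aF => wg_maximal_ge0 z aF.2)
  (fun F G k z aF aG k0 => wg_maximal_sub z aF aG k0)
  (fun F G z aF aG FG => wg_maximal_le_off_null z measurable0 (measure0 mu) aF.2 aG.2 (fun w _ => FG w))
  (fun F lam aF l0 => weak F lam aF l0) p1 adm_sigma (adm_h Hf) mB B1 mZ1 Z10 NB.
rewrite -/K' (_ : (fun w => h a b w * sigma w) = (fun w => modulus a b w * gw w)) in main; last first.
  by apply/funext => w; exact: h_sigma.
rewrite (wLnormE p0 Hv Hf) /wLnorm unlock -poweR_EFin -poweRM ?lee_fin//; last first.
  by apply: integral_ge0 => z _; rewrite lee_fin mulr_ge0 ?powR_ge0// ltW.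
have pV0 : 0 <= p^-1 by rewrite invr_ge0 ltW.
have i0 : (0 <= \int[mu]_z (modulus a b z `^ p * vb z)%:E)%E.
  by apply: integral_ge0 => z _; rewrite lee_fin mulr_ge0 ?powR_ge0// ltW.
apply: (gt0_ler_poweR pV0); rewrite ?in_itv/= ?leey ?andbT.
- by apply: integral_ge0 => z _; exact: poweR_ge0.
- by rewrite mule_ge0 ?lee_fin.
under [in leRHS]eq_integral do rewrite -hp_sigma.
apply: le_trans main; apply: (le_integral_off_null mZ3 Z30) => z.
- exact: poweR_ge0.
- by rewrite lee_fin mulr_ge0 ?powR_ge0.
move=> /H3[[N zN]]; set F := fun w => (modulus a b w * gw w)%R => My.
have M0 : (0 <= wg_maximal F z)%E.
  by apply: wg_maximal_ge0 => w; rewrite mulr_ge0 ?modulus_ge0.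
have Sc k : core k z -> (heat_maximal r f z <= (c k)%:E * wg_maximal F z)%E.
  by move=> zk; exact: (Hc k f a b Z).
move: My M0 Sc (heat_maximal_ge0 f z r0).
case: (wg_maximal F z) => [M| |]// _; rewrite lee_fin => M0 Sc.
case: (heat_maximal r f z) Sc => [y| |] Sc; first last.
- by [].
- by have := Sc N zN; rewrite -EFinM leye_eq.
rewrite lee_fin => y0.
have Wy : W z * y <= M.
  by apply: (core_weight_mul_le c1 zN y0) => k /Sc; rewrite -EFinM lee_fin.
rewrite -EFinM abse_EFin poweR_EFin lee_fin ger0_norm; last by rewrite mulr_ge0 ?powR_ge0.
have -> : (y * u z `^ p^-1) `^ p = y `^ p * u z.
  move: (u z) (u0 z) => x x0.
  by rewrite powRM ?powR_ge0// -powRrM mulVf ?gt_eqF// powRr1// ltW.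
rewrite /u mulrA ler_wpM2r//.
have WB0 : 0 <= W z / B z by rewrite divr_ge0// ltW.
rewrite -powRM//; apply: (ge0_ler_powR (ltW p0)); rewrite ?nnegrE.
- exact: mulr_ge0.
- by rewrite divr_ge0// ltW.
by rewrite mulrA (mulrC y) ler_wpM2r// invr_ge0 ltW.
Qed.

End strong_type.

Section weak_type.
Context (R : realType) (n m : nat) (t0 : R).
Local Notation WG := (waveguide R n m).
Local Notation mu := (WG_measure R n m).
Local Notation gw := (@gauss_weight R n m t0).
Implicit Types (z w : WG) (f : WG -> R[i]).
Hypothesis t0_gt0 : 0 < t0.
Variables (v vb : WG -> R) (Zv : set WG) (M : R).
Hypothesis Hv : borel_version v vb Zv.
Hypothesis damped_le : {ae mu, forall z, damped_weight 1 t0 vb z <= M}.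

Let vb0 z : 0 < vb z. Proof. by case: Hv. Qed.
Let mvb : measurable_fun setT vb. Proof. by case: Hv. Qed.

Local Open Scope ereal_scope.

Lemma weighted_modulus_le1 f a b Z : borel_parts f a b Z ->
  \int[mu]_w (modulus a b w * gw w)%:E <= `|M|%:E * wLnorm 1 v (cabs f).
Proof.
move=> Hf; have [ma mb _ _ _] := Hf.
rewrite (wLnormE ltr01 Hv Hf) invr1 poweRe1; last first.
  by apply: integral_ge0 => z _; rewrite lee_fin mulr_ge0 ?powR_ge0// ltW.
under [in leRHS]eq_integral do rewrite powRr1 ?modulus_ge0//.
have vm0 w : (0 <= modulus a b w * vb w)%R by rewrite mulr_ge0 ?modulus_ge0// ltW.
rewrite -ge0_integralZl//; last 2 first.
- by apply/measurable_EFinP; apply: measurable_funM => //; exact: measurable_modulus.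
- by move=> w _; rewrite lee_fin.
have [Z' [mZ' Z'0 H]] := damped_le.
apply: (le_integral_off_null mZ' Z'0) => w.
- by rewrite lee_fin mulr_ge0 ?modulus_ge0 ?expR_ge0.
- by rewrite mule_ge0 ?lee_fin.
move=> nZ; have {nZ} : (damped_weight 1 t0 vb w <= M)%R.
  by apply: contrapT => nle; apply: nZ; exact: H.
rewrite /damped_weight invr1 powRN (powRr1 (ltW (vb0 w))) mulrC ler_pdivrMr// => le.
rewrite -EFinM lee_fin mulrCA ler_wpM2l ?modulus_ge0//.
by apply: le_trans le _; rewrite ler_wpM2r ?ler_norm// ltW.
Qed.

Lemma heat_maximal_weak r : (0 < r <= heat_time t0)%R -> exists u : WG -> R, weight u /\
  exists C : R, forall f, wLp 1 v f -> forall lam : R, (0 < lam)%R ->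
    \int[mu]_(z in [set z | lam%:E < `|heat_maximal r f z|]) (u z)%:E
      <= (C / lam)%:E * wLnorm 1 v (cabs f).
Proof.
move=> /andP[r0 rh]; have [c [c1 Hc]] := heat_maximal_le_core n m t0_gt0.
have mgw : measurable_fun setT gw by exact: measurable_gauss_weight.
have gw0 z : (0 <= gw z)%R by exact: expR_ge0.
have gwy := integral_gauss_weight_lty n m t0_gt0.
have gw1 z : (0 <= gw z <= 1)%R by rewrite gw0 gauss_weight_le1.
have [K K0 weak] := wg_maximal_weak mgw gw1 gwy.
have [Z2 [mZ2 Z20 H2]] := core_covers R n m.
pose W := @core_weight R n m c.
have W0 z : (0 < W z)%R by exact: core_weight_gt0.
exists (fun z => gw z * W z)%R; split.
  apply: borel_weight => [|z]; last by rewrite mulr_gt0 ?expR_gt0.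
  by apply: measurable_funM => //; exact: measurable_core_weight.
exists (K * `|M|)%R => f Lf lam lam0.
have [a [b [Z Hf]]] := complex_borel_parts Lf.1.
have aF := @nonneg_measurable_weighted_modulus _ _ _ _ _ _ _ Hf t0.
set F := fun w => _ in aF.
have c0 k : (0 < c k)%R by exact: lt_le_trans (c1 k).
pose E k := [set z | (lam / c k)%:E < wg_maximal F z].
have mE k : measurable (E k).
  rewrite -[E k]setTI; apply: emeasurable_fun_o_infty => //; exact: measurable_wg_maximal.
pose term k z : R := ((2^-1) ^+ k.+1 / c k * (gw z * \1_(E k) z))%R.
have term0 k z : (0 <= term k z)%R.
  by rewrite mulr_ge0// ?divr_ge0// ?exprn_ge0 ?mulr_ge0// ltW.
have mterm k : measurable_fun setT (fun z => (gw z * \1_(E k) z)%:E).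
  apply/measurable_EFinP; apply: measurable_funM => //; exact: measurable_indic.
apply: (@le_trans _ _ (\int[mu]_z \sum_(k <oo) (term k z)%:E)).
  rewrite ge0_integral_restrict_indic; apply: (le_integral_off_null mZ2 Z20) => z.
  - by rewrite lee_fin !mulr_ge0// ltW.
  - by apply: nneseries_ge0 => k _ _; rewrite lee_fin.
  move=> /H2[N zN]; rewrite indicE; have [/set_mem lamS|_] := boolP (z \in _); last first.
    by rewrite mulr0 nneseries_ge0// => k _ _; rewrite lee_fin.
  rewrite mulr1 EFinM /W (core_weightE c1 zN) -nneseriesZl; last first.
    by move=> k _; rewrite lee_fin mulr_ge0// divr_ge0 ?exprn_ge0// ltW.
  apply: lee_nneseries => [k _ _|k _].
    by rewrite -EFinM lee_fin !mulr_ge0// ?invr_ge0 ?exprn_ge0// ltW.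
  rewrite -EFinM lee_fin /term mulrCA ler_wpM2l//.
    by rewrite divr_ge0 ?exprn_ge0// ltW.
  rewrite ler_wpM2l// !indicE; have [/set_mem zk|//] := boolP (z \in core k).
  rewrite mem_set// /E /= EFinM lte_pdivrMr//.
  rewrite muleC; apply: lt_le_trans (Hc k f a b Z r z Hf rh zk).
  by move: lamS; rewrite /= gee0_abs// heat_maximal_ge0.
have X0 : 0 <= \int[mu]_w (F w)%:E by apply: integral_ge0 => w _; rewrite lee_fin aF.2.
rewrite integral_nneseries//; first last.
- by move=> k z _; rewrite lee_fin.
- move=> k; apply: (eq_measurable_fun (fun z => ((2^-1) ^+ k.+1 / c k)%:E * (gw z * \1_(E k) z)%:E)).
    by move=> z _; rewrite -EFinM.
  exact: measurable_funeM.
apply: (@le_trans _ _ (\sum_(k <oo) ((2^-1) ^+ k.+1)%:E * ((K / lam)%:E * \int[mu]_w (F w)%:E))).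
  apply: lee_nneseries => [k _ _|k _]; first by apply: integral_ge0 => z _; rewrite lee_fin.
  under eq_integral do rewrite EFinM.
  rewrite ge0_integralZl//; first last.
  - by rewrite lee_fin divr_ge0 ?exprn_ge0// ltW.
  - by move=> z _; rewrite lee_fin mulr_ge0.
  rewrite -ge0_integral_restrict_indic.
  have := weak F (lam / c k)%R aF (divr_gt0 lam0 (c0 k)); rewrite -/(E k).
  set Y := \int[mu]_(z in E k) _; set X := \int[mu]_w _ => H.
  rewrite (_ : (2^-1 ^+ k.+1 / c k)%R = (2^-1 ^+ k.+1 / lam * (lam / c k))%R); last first.
    by field; rewrite !gt_eqF.
  rewrite EFinM -muleA.
  apply: (@le_trans _ _ ((2^-1 ^+ k.+1 / lam)%:E * (K%:E * X))).
    by rewrite lee_wpmul2l// lee_fin divr_ge0 ?exprn_ge0// ltW.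
  by rewrite !muleA -!EFinM mulrAC -mulrA.
have Xle := weighted_modulus_le1 Hf.
have Xfin : \int[mu]_w (F w)%:E \is a fin_num.
  rewrite ge0_fin_numE//; apply: le_lt_trans Xle _.
  by rewrite lte_mul_pinfty ?lee_fin//; exact: Lf.2.
move: Xle X0; rewrite -/F -(fineK Xfin); set X := fine _ => Xle X0.
under eq_eseriesr do rewrite -!EFinM mulrC EFinM.
rewrite nneseriesZl; last by move=> k _; rewrite lee_fin exprn_ge0.
apply: (@le_trans _ _ (K / lam * X)%:E).
  rewrite -[leRHS]mule1; apply: lee_wpmul2l; last exact: nneseries_half_le1.
  by rewrite lee_fin mulr_ge0// divr_ge0// ltW.
by rewrite (mulrAC K `|M|%R) [in leLHS]EFinM [in leRHS]EFinM -muleA lee_wpmul2l// lee_fin divr_ge0// ltW.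
Qed.

End weak_type.

(** * Necessity of the weight condition *)

Section necessity.
Context (R : realType) (n m : nat).
Local Notation Rm := (measurableTypeR R).
Local Notation WG := (waveguide R n m).
Local Notation mu := (WG_measure R n m).
Implicit Types (t p : R) (z w : WG) (f : WG -> R[i]).

Lemma sqnorm_tsub_ge k (x y : k.-tuple R) : sqnorm (tsub x y) <= 2 * sqnorm x + 2 * sqnorm y.
Proof.
rewrite /sqnorm !mulr_sumr -big_split /=; apply: ler_sum => i _.
rewrite tnth_mktuple; set a := tnth x i; set b := tnth y i.
have := sqr_ge0 (a + b); nra.
Qed.

Lemma sqnorm_unit_cell (x : n.-tuple Rm) : unit_cell x -> sqnorm x <= n%:R.
Proof.
move=> xc; rewrite /sqnorm -[X in _ <= X%:R]card_ord -sumr_const.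
by apply: ler_sum => i _; have := xc i; set s : R := tnth x i; nra.
Qed.

Lemma gauss_weight_le_gauss t z : 0 < t -> exists2 c : R, 0 < c &
  forall w, unit_cell w.1 -> @gauss_weight R n m (t / 2) w <= c * gauss 4 t z w.
Proof.
move=> t0; pose b : R := (2 * sqnorm z.1 + 2 * n%:R + 2 * sqnorm z.2) / (4 * t).
have A0 : 0 < amplitude n m t by rewrite powR_gt0// !mulr_gt0// pi_gt0.
exists ((amplitude n m t)^-1 * expR b); first by rewrite mulr_gt0 ?invr_gt0 ?expR_gt0.
move=> w wc; rewrite /gauss mulrACA mulVf ?gt_eqF// mul1r -expRD ler_expR.
have -> : sqnorm w.2 / (4 * (t / 2)) = 2 * sqnorm w.2 / (4 * t).
  by field; rewrite gt_eqF.
rewrite -lerBlDr opprK addrC -lerBrDr opprK /b -mulrDl ler_pM2r ?invr_gt0 ?mulr_gt0// /dist2.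
have := sqnorm_tsub_ge z.1 w.1; have := sqnorm_tsub_ge z.2 w.2.
have := sqnorm_unit_cell wc.
set x := sqnorm (tsub z.1 w.1); set y := sqnorm (tsub z.2 w.2).
set x1 := sqnorm w.1; set x2 := sqnorm w.2; set y1 := sqnorm z.1; set y2 := sqnorm z.2; lra.
Qed.

Lemma ae_exists (P : set WG) : {ae mu, forall z, P z} -> exists z, P z.
Proof.
move=> [Z [mZ Z0 H]]; apply: contrapT => nP.
have := WG_measure_gt0 R n m; rewrite (_ : setT = Z) ?Z0 ?ltxx//.
by apply/esym/seteqP; split => // z _; apply: H => Pz; apply: nP; exists z.
Qed.

Lemma D_WG_necessary p v t : 1 <= p -> weight v -> 0 < t <= 2^-1 ->
  (forall f, wLp p v f -> {ae mu, forall z, heat_conv_finite t f z}) -> D_WG p v.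
Proof.
move=> p1 wv t01 H; have /andP[t0 _] := t01.
have p0 : 0 < p by exact: lt_le_trans p1.
split => //; exists (t / 2); first by rewrite divr_gt0.
have [vb [Zv Hv]] := weight_borel wv; have [mvb vb0 mZv Zv0 vE] := Hv.
pose G := damped_weight p (t / 2) vb.
have mG : measurable_fun setT G by exact: measurable_damped_weight.
have G0 z : 0 <= G z by exact/ltW/damped_weight_gt0.
have HG (P : WG -> R) : measurable_fun setT P /\ (forall z, 0 <= P z) ->
    (\int[mu]_z (P z `^ p)%:E < +oo)%E -> (\int[mu]_z (P z * G z)%:E < +oo)%E.
  move=> [mP P0] Pfin.
  pose a z : R := P z * vb z `^ (- p^-1).
  pose f z : R[i] := Complex (a z) 0.
  have a0 z : 0 <= a z by rewrite mulr_ge0 ?powR_ge0.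
  have ma : measurable_fun setT a.
    by apply: measurable_funM => //; exact: (measurableT_comp (measurable_powR _) mvb).
  have Hf : borel_parts f a (fun=> 0) set0 by split => //; exact: measure0.
  have modE z : modulus a (fun=> 0) z = a z.
    by rewrite /modulus expr0n/= addr0 sqrtr_sqr ger0_norm.
  have Lf : wLp p v f.
    split; first by split; apply: borel_lebesgue_measurable.
    rewrite (wLnormE p0 Hv Hf); apply: poweR_lty; apply: le_lt_trans Pfin.
    apply: le_integral_nomeas => z; first by rewrite lee_fin mulr_ge0 ?powR_ge0// ltW.
    rewrite modE lee_fin powRM ?powR_ge0// -powRrM mulNr mulVf ?gt_eqF//.
    by rewrite powRN powRr1 ?(ltW (vb0 z))// mulfVK ?gt_eqF.
  have [z [zfin zc]] : exists z, heat_conv_finite t f z /\ unit_cell z.1.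
    apply: ae_exists; apply: filterS2 (H f Lf) (_ : {ae mu, forall z, unit_cell z.1}) => //.
    exists [set z : WG | ~ unit_cell z.1]; split => //.
      exact: measurable_not_cell.
    exact: WG_measure_not_cell.
  have [c c0 Hc] := gauss_weight_le_gauss z t0.
  move: zfin; rewrite (heat_conv_finiteE Hf) => zfin.
  have mk : measurable_fun setT (fun w => (heat_kernel_sub t z w * modulus a (fun=> 0) w)%:E).
    apply/measurable_EFinP; apply: measurable_funM; first exact: measurable_heat_kernel_sub.
    by apply: (eq_measurable_fun a) => // w _; rewrite modE.
  apply: (@le_lt_trans _ _ (\int[mu]_w (c%:E * (heat_kernel_sub t z w * modulus a (fun=> 0) w)%:E))%E).
    apply: (le_integral_off_null (@measurable_not_cell R n m) (WG_measure_not_cell R n m)) => w.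
    - by rewrite lee_fin mulr_ge0.
    - apply: mule_ge0; rewrite lee_fin ?(ltW c0)//.
      by rewrite mulr_ge0 ?modulus_ge0 ?heat_kernel_sub_ge0.
    move=> /contrapT wc; rewrite -EFinM lee_fin modE /G /damped_weight (mulrA (P w)) -/(a w).
    rewrite (mulrC (a w)) (mulrA c) ler_wpM2r//; apply: le_trans (Hc w wc) _.
    by rewrite ler_wpM2l ?(ltW c0)//; exact: gauss_le_heat_kernel_sub.
  rewrite ge0_integralZl//; first by rewrite lte_mul_pinfty// lee_fin ltW.
  - by move=> w _; rewrite lee_fin mulr_ge0 ?modulus_ge0 ?heat_kernel_sub_ge0.
  - by rewrite lee_fin ltW.
have [p_gt1|] := ltP 1 p.
  rewrite (D_WG_integral _ p_gt1 Hv); apply: converse_hoelder mG G0 p1 HG _ p_gt1.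
  exact: sigma_finite_WG.
move=> p_le1; have pE : p = 1 by apply/eqP; rewrite eq_le p1 p_le1.
have [M HM] := converse_hoelder1 mG G0 p1 HG (sigma_finite_WG R n m) pE.
move: mG HM; rewrite /G pE => mG HM; apply/(D_WG_bounded _ Hv); exists M.
exists [set z | M < damped_weight 1 (t / 2) vb z]; split => //.
  rewrite -[X in measurable X]setTI.
  rewrite (_ : [set z | _] = damped_weight 1 (t / 2) vb @^-1` `]M, +oo[%classic).
    by apply: mG => //; exact: measurable_itv.
  by apply/seteqP; split => z /=; rewrite in_itv/= andbT.
by move=> z /= /negP; rewrite -ltNge.
Qed.

End necessity.

Section sufficiency.
Context (R : realType) (n m : nat).
Local Notation WG := (waveguide R n m).
Local Notation mu := (WG_measure R n m).
Implicit Types (v : WG -> R) (f : WG -> R[i]).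

Lemma D_WG_weighted_modulus (p : R) v : 1 <= p -> D_WG p v -> exists2 t0 : R, 0 < t0 &
  forall f, wLp p v f -> exists a b Z, borel_parts f a b Z /\
    (\int[mu]_w (modulus a b w * @gauss_weight R n m t0 w)%:E < +oo)%E.
Proof.
move=> p1 [wv [t0 t0_gt0 fin]]; exists t0 => // f Lf.
have [a [b [Z Hf]]] := complex_borel_parts Lf.1; exists a, b, Z; split => //.
have [vb [Zv Hv]] := weight_borel wv.
have [p_gt1|p_le1] := ltP 1 p.
  rewrite (D_WG_integral _ p_gt1 Hv) in fin.
  exact: (weighted_modulus_lty p_gt1 Hv fin Hf).
have pE : p = 1 by apply/eqP; rewrite eq_le p1 p_le1.
rewrite pE in fin Lf; have [M HM] := (D_WG_bounded _ Hv).1 fin.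
apply: le_lt_trans (weighted_modulus_le1 Hv HM Hf) _.
by rewrite lte_mul_pinfty ?lee_fin//; exact: Lf.2.
Qed.

Lemma min_heat_time (t0 : R) : 0 < t0 ->
  0 < Num.min (heat_time t0) 4^-1 < 2^-1 /\ Num.min (heat_time t0) 4^-1 <= heat_time t0.
Proof.
move=> t0_gt0; split; last by rewrite ge_min lexx.
apply/andP; split; first by rewrite lt_min heat_time_gt0//=.
by rewrite gt_min; apply/orP; right; lra.
Qed.

Lemma D_WG_maximal (p : R) v : 1 <= p -> D_WG p v -> exists (r : R) (u : WG -> R),
  [/\ 0 < r < 2^-1, weight u,
    1 < p -> maps_strong p v u (heat_maximal r) (heat_maximal_defined r) &
    p = 1 -> maps_weak1 v u (heat_maximal r) (heat_maximal_defined r)].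
Proof.
move=> p1 [wv [t0 t0_gt0 fin]].
have [] := min_heat_time t0_gt0; set r := Num.min _ _ => /andP[r0 r2] r_le.
have rh : 0 < r <= heat_time t0 by rewrite r0.
have [vb [Zv Hv]] := weight_borel wv.
have dom f a b Z : borel_parts f a b Z ->
    (\int[mu]_w (modulus a b w * @gauss_weight R n m t0 w)%:E < +oo)%E ->
    {ae mu, forall z, heat_maximal_defined r f z}.
  move=> Hf fw; apply: filterS (heat_conv_finite_ae Hf t0_gt0 fw) => z zP t /andP[t1 t2].
  by apply: zP; rewrite t1 (le_trans (ltW t2)).
have [p_gt1|p_le1] := ltP 1 p.
  have pN1 : p <> 1 by move=> pE; rewrite pE ltxx in p_gt1.
  rewrite (D_WG_integral _ p_gt1 Hv) in fin.
  have [u [wu HC]] := heat_maximal_strong p_gt1 t0_gt0 Hv fin rh.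
  exists r, u; split => //; [by rewrite r0|move=> _; split => // f Lf].
  have [a [b [Z Hf]]] := complex_borel_parts Lf.1.
  exact: dom Hf (weighted_modulus_lty p_gt1 Hv fin Hf Lf).
have pE : p = 1 by apply/eqP; rewrite eq_le p1 p_le1.
rewrite pE in fin *; have [M HM] := (D_WG_bounded _ Hv).1 fin.
have [u [wu HC]] := heat_maximal_weak t0_gt0 Hv HM rh.
exists r, u; split => //; [by rewrite r0|move=> _; split => // f Lf].
have [a [b [Z Hf]]] := complex_borel_parts Lf.1.
apply: (dom _ _ _ _ Hf); apply: le_lt_trans (weighted_modulus_le1 Hv HM Hf) _.
by rewrite lte_mul_pinfty ?lee_fin//; exact: Lf.2.
Qed.

Lemma D_WG_converges (p : R) v : 1 <= p -> D_WG p v -> exists2 r : R, 0 < r < 2^-1 &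
  forall f, wLp p v f ->
    {ae mu, forall z, heat_conv_finite r f z} /\ {ae mu, forall z, heat_conv_converges f z}.
Proof.
move=> p1 Dv; have [t0 t0_gt0 H] := D_WG_weighted_modulus p1 Dv.
have [r01 rh] := min_heat_time t0_gt0; exists (Num.min (heat_time t0) 4^-1) => //.
move=> f Lf; have [a [b [Z [Hf fw]]]] := H f Lf; split.
  apply: filterS (heat_conv_finite_ae Hf t0_gt0 fw) => z; apply.
  by rewrite rh andbT; case/andP: r01.
exact (heat_conv_converges_ae Hf t0_gt0 fw).
Qed.

Lemma D_WG_maximal_finite (p : R) v : 1 <= p -> D_WG p v -> exists2 r : R, 0 < r < 2^-1 &
  forall f, wLp p v f ->
    {ae mu, forall z, heat_maximal_defined r f z /\ (heat_maximal r f z < +oo)%E}.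
Proof.
move=> p1 Dv; have [t0 t0_gt0 H] := D_WG_weighted_modulus p1 Dv.
have [] := min_heat_time t0_gt0; set r := Num.min _ _ => r01 rh; exists r => //.
move=> f Lf; have [a [b [Z [Hf fw]]]] := H f Lf.
have [c [c1 Hc]] := heat_maximal_le_core n m t0_gt0.
have [Z' [mZ' Z'0 HZ']] := wg_maximal_modulus_ae Hf fw.
have fin : {ae mu, forall z, (heat_maximal r f z < +oo)%E}.
  exists Z'; split => // z; apply: contra_notP => /HZ'[[N zN] My].
  apply: le_lt_trans (Hc N f a b Z r z Hf rh zN) _.
  by rewrite lte_mul_pinfty// lee_fin (le_trans ler01).
apply: filterS2 fin (heat_conv_finite_ae Hf t0_gt0 fw) => z Sy zfin; split => // t /andP[t1 t2].
by apply: zfin; rewrite t1 (le_trans (ltW t2)).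
Qed.

End sufficiency.

Theorem theorem4p5 (R : realType) (n m : nat) (p : R) (hp : 1 <= p)
    (v : waveguide R n m -> R) (hv : weight v) :
  [<->
    D_WG p v;
    exists (r : R) (u : waveguide R n m -> R),
      [/\ 0 < r < 2^-1, weight u,
          1 < p -> maps_strong p v u (heat_maximal r) (heat_maximal_defined r) &
          p = 1 -> maps_weak1 v u (heat_maximal r) (heat_maximal_defined r)];
    exists2 r : R, 0 < r < 2^-1 &
      forall f, wLp p v f ->
        {ae WG_measure R n m, forall z, heat_conv_finite r f z} /\
        {ae WG_measure R n m, forall z, heat_conv_converges f z};
    exists2 r : R, 0 < r < 2^-1 &
      forall f, wLp p v f ->
        {ae WG_measure R n m, forall z,
          heat_maximal_defined r f z /\ (heat_maximal r f z < +oo)%E}].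
Proof.
have sub (r t : R) : 0 < r < 2^-1 -> 0 < t <= r -> 0 < t <= 2^-1.
  by move=> /andP[_ r2] /andP[-> tr] /=; rewrite (le_trans tr)// ltW.
have half (r : R) : 0 < r < 2^-1 -> 0 < r / 2 < r.
  by move=> /andP[r0 _]; rewrite divr_gt0//= ltr_pdivrMr// ltr_pMr// ltr1n.
tfae.
- exact: D_WG_maximal.
- move=> [r [u [r01 _ strong weak]]]; apply: D_WG_converges => //.
  have /andP[r0 rr] := half r r01.
  apply: (D_WG_necessary hp hv (t := r / 2)) => [|f Lf].
    by apply: (sub r) => //; rewrite r0 ltW.
  have : {ae WG_measure R n m, forall z, heat_maximal_defined r f z}.
    have [/strong[H _]|p_le1] := ltP 1 p; first exact: H.
    have pE : p = 1 by apply/eqP; rewrite eq_le hp p_le1.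
    by have [H _] := weak pE; apply: H; rewrite -pE.
  by apply: filterS => z; apply; rewrite r0.
- move=> [r r01 H]; apply: D_WG_maximal_finite => //.
  apply: (D_WG_necessary hp hv (t := r)) => [|f /H[]//].
  by apply: (sub r) => //; case/andP: r01 => ->/=.
- move=> [r r01 H]; have /andP[r0 rr] := half r r01.
  apply: (D_WG_necessary hp hv (t := r / 2)) => [|f /H].
    by apply: (sub r) => //; rewrite r0 ltW.
  by apply: filterS => z [+ _]; apply; rewrite r0.
Qed.
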